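(* Let $G=(V,E)$ be a connected, locally finite graph with vertex weight $\mu:V\to(0,\infty)$ satisfying $\mu(x)\ge\mu_{\min}>0$ for all $x\in V$. Assume that $a,b:V\to\mathbb R$ satisfy: (A1) there is a constant $V_0>0$ with $a(x)\ge V_0$ and $b(x)\ge V_0$ for all $x\in V$; (A2') there exists $\mathcal M_0>0$ such that $\frac1{a}\in L^1(V\setminus D^a_{\mathcal M_0})$ and $\frac1{b}\in L^1(V\setminus D^b_{\mathcal M_0})$, where $D^a_{\mathcal M_0}=\{x\in V:a(x)\le\mathcal M_0\}$ and $D^b_{\mathcal M_0}=\{x\in V:b(x)\le\mathcal M_0\}$, and $D^a_{\mathcal M_0},D^b_{\mathcal M_0}$ have finite volume (with respect to $\mu$). Then for every $p>4$ the system $$\begin{cases}-\Delta_p u+a(x)|u|^{p-2}u=\frac{p-2}{p}|u|^{p-4}u\,v^2\log v^2+\frac2p|v|^{p-2}u\log u^2+\frac2p|v|^{p-2}u,\\ -\Delta_p v+b(x)|v|^{p-2}v=\frac{p-2}{p}|v|^{p-4}v\,u^2\log u^2+\frac2p|u|^{p-2}v\log v^2+\frac2p|u|^{p-2}v,\end{cases}\quad\text{on }V,$$ admits a mountain pass solution, which is also a ground state solution.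
   Context: Notation. $x\sim y$ means $(x,y)\in E$; $\int_V f\,d\mu=\sum_{x\in V}f(x)\mu(x)$; $C_c(V)$ is the space of finitely supported real functions on $V$. $\Gamma(u,v)(x)=\frac1{2\mu(x)}\sum_{y\sim x}(u(y)-u(x))(v(y)-v(x))$, $|\nabla u|(x)=\sqrt{\Gamma(u,u)(x)}$, and $$\Delta_pu(x)=\frac1{2\mu(x)}\sum_{y\sim x}\big(|\nabla u|^{p-2}(y)+|\nabla u|^{p-2}(x)\big)(u(y)-u(x)).$$ $W^{1,p}(V)$ is the completion of $C_c(V)$ under $\|u\|_{W^{1,p}}=(\int_V(|\nabla u|^p+|u|^p)d\mu)^{1/p}$. $\mathcal H_a=\{u\in W^{1,p}(V):\int_Va|u|^pd\mu<\infty\}$ with norm $\|u\|_{\mathcal H_a}=(\int_V(|\nabla u|^p+a|u|^p)d\mu)^{1/p}$, $\mathcal H_b$ likewise with $b$, and $\mathcal H=\mathcal H_a\times\mathcal H_b$ with $\|(u,v)\|_{\mathcal H}=\|u\|_{\mathcal H_a}+\|v\|_{\mathcal H_b}$. Expressions such as $s\log s^2$, $s^2\log s^2$ are $0$ at $s=0$. Under (A1) and (A2') the energy $$J(u,v)=\tfrac1p\big(\|u\|_{\mathcal H_a}^p+\|v\|_{\mathcal H_b}^p\big)-\tfrac1p\int_V|u|^{p-2}v^2\log v^2\,d\mu-\tfrac1p\int_V|v|^{p-2}u^2\log u^2\,d\mu$$ is a $C^1$ functional on $\mathcal H$, whose critical points are the weak solutions of the system. The Nehari manifold is $\mathcal N=\{(u,v)\in\mathcal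 H\setminus\{(0,0)\}:J'(u,v)\cdot(u,v)=0\}$, $d=\inf_{\mathcal N}J$, and a ground state solution is a pair $(u_0,v_0)\in\mathcal N$ with $J(u_0,v_0)=d$. A mountain pass solution is a pair $(u_0,v_0)\in\mathcal H$ with $J'(u_0,v_0)=0$ and $J(u_0,v_0)=c$, where $c=\inf_{\gamma\in\mathcal P}\max_{t\in[0,1]}J(\gamma(t))$, $\mathcal P=\{\gamma\in C([0,1],\mathcal H):\gamma(0)=0,\gamma(1)=e\}$, for some $e\in\mathcal H$ and $r>0$ with $\|e\|_{\mathcal H}>r$ and $\inf_{\|(u,v)\|_{\mathcal H}=r}J>J(0)\ge J(e)$. *)

(* Defs.v *)
From HB Require Import structures.
From mathcomp Require Import all_boot all_order all_algebra.
From mathcomp Require Import all_classical all_reals all_analysis.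
From mathcomp Require Import ring lra.

Set Implicit Arguments.
Unset Strict Implicit.
Unset Printing Implicit Defensive.

Import Order.TTheory GRing.Theory Num.Theory.
Import numFieldNormedType.Exports.

Local Open Scope classical_set_scope.
Local Open Scope ring_scope.

(* Loops are not excluded: they contribute nothing to Gamma nor to plap. *)
Record weighted_graph (R : realType) (V : choiceType) := WeightedGraph {
  adj : rel V;
  adj_sym : symmetric adj;
  adj_finite : forall x, finite_set [set y | adj x y];
  mu : V -> R;
  mu_gt0 : forall x, 0 < mu x
}.

(* The empty graph is not connected. *)
Definition connected_graph (R : realType) (V : choiceType)
    (G : weighted_graph R V) : Prop :=
  inhabited V /\
  forall x y : V, exists s : seq V, path (adj G) x s /\ last x s = y.

Section Calculus.
Context {R : realType} {V : choiceType} (G : weighted_graph R V).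
Implicit Types (u v f w : V -> R) (D : set V).

Definition Gamma u v (x : V) : R :=
  (2 * mu G x)^-1 *
    \sum_(y \in [set y | adj G x y]) (u y - u x) * (v y - v x).

Definition grad u (x : V) : R := Num.sqrt (Gamma u u x).

Definition plap (p : R) u (x : V) : R :=
  (2 * mu G x)^-1 *
    \sum_(y \in [set y | adj G x y])
      (grad u y `^ (p - 2) + grad u x `^ (p - 2)) * (u y - u x).

(* Integral of a nonnegative function over D, possibly infinite. *)
Definition nnint D f : \bar R := \esum_(x in D) (f x * mu G x)%:E.

Definition L1 D f : Prop := summable D (fun x => (f x * mu G x)%:E).

Definition volume D : \bar R := \esum_(x in D) (mu G x)%:E.

(* Integral over V of a function in L1; \esum is meaningful for nonnegative
   families only, hence the splitting into positive and negative parts. *)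
Definition gint f : R :=
  fine (\esum_(x in [set: V]) (fun x => (f x * mu G x)%:E)^\+ x
      - \esum_(x in [set: V]) (fun x => (f x * mu G x)%:E)^\- x)%E.

Definition modular (p : R) w u : \bar R :=
  nnint [set: V] (fun x => grad u x `^ p + w x * `|u x| `^ p).

Definition enorm (p : R) w u : \bar R := (modular p w u `^ (p^-1)%R)%E.

Definition Cc : set (V -> R) := [set phi | finite_set [set x | phi x != 0]].

(* The completion of Cc for the norm enorm p 1, realized in the space of
   functions on V: since mu > 0, a Cauchy sequence of Cc converges pointwise,
   and by Fatou its pointwise limit is its limit in norm. *)
Definition W1p (p : R) : set (V -> R) := [set u |
  (enorm p (cst 1)%R u < +oo)%E /\
  forall eps : R, 0 < eps ->
    exists2 phi, Cc phi & (enorm p (cst 1)%R (u - phi)%R < eps%:E)%E].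

Definition potential_energy (p : R) w u : \bar R :=
  nnint [set: V] (fun x => w x * `|u x| `^ p).

Section Bilinear.
Variable x : V.

Lemma GammaDD u v (s t : R) :
  Gamma (s *: u + t *: v) (s *: u + t *: v) x =
  s ^+ 2 * Gamma u u x + 2 * s * t * Gamma u v x + t ^+ 2 * Gamma v v x.
Proof.
rewrite /Gamma !(mulrCA _ (_ ^-1)) -!mulrDr; congr (_ * _).
rewrite !mulr_fsumr -!fsbig_split //=; try exact: adj_finite.
apply: eq_fsbigr => y _.
by rewrite !fctE /GRing.scale /=; ring.
Qed.

Lemma Gamma_ge0 u : 0 <= Gamma u u x.
Proof.
rewrite /Gamma mulr_ge0 ?invr_ge0 ?mulr_ge0 ?(ltW (mu_gt0 G x)) //.
by apply: fsumr_ge0 => y _; rewrite -expr2 sqr_ge0.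
Qed.

Lemma gradZ c u : grad (c *: u) x = `|c| * grad u x.
Proof.
have := GammaDD u u c 0; rewrite scale0r addr0 /grad => ->.
rewrite expr0n /= mulr0 !mul0r !addr0 sqrtrM ?sqr_ge0 // sqrtr_sqr //.
Qed.

Lemma grad_ge0 u : 0 <= grad u x. Proof. exact: sqrtr_ge0. Qed.

Lemma grad_sqr u : grad u x ^+ 2 = Gamma u u x.
Proof. by rewrite sqr_sqrtr // Gamma_ge0. Qed.

Lemma gradD u v : grad (u + v) x <= grad u x + grad v x.
Proof.
set A := grad u x; set B := grad v x.
have A0 : 0 <= A := grad_ge0 u.
have B0 : 0 <= B := grad_ge0 v.
have h (s t : R) :
    0 <= s ^+ 2 * A ^+ 2 + 2 * s * t * Gamma u v x + t ^+ 2 * B ^+ 2.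
  by rewrite !grad_sqr -GammaDD Gamma_ge0.
have CS : Gamma u v x <= A * B.
  apply/ler_addgt0Pr => e e0.
  have [AB0|AB0] := eqVneq (A * B) 0; last first.
    have AB : 0 < A * B by rewrite lt_neqAle eq_sym AB0 mulr_ge0.
    have := h B (- A).
    have -> : B ^+ 2 * A ^+ 2 + 2 * B * - A * Gamma u v x + (- A) ^+ 2 * B ^+ 2
       = 2 * (A * B) * (A * B - Gamma u v x) by ring.
    have AB2 : 0 < 2 * (A * B) by rewrite mulr_gt0.
    rewrite (pmulr_rge0 _ AB2) subr_ge0 => /le_trans; apply.
    by rewrite lerDl ltW.
  rewrite AB0 add0r leNgt; apply/negP => ge.
  have g0 : 0 < Gamma u v x := lt_trans e0 ge.
  move/eqP : AB0; rewrite mulf_eq0 => /orP[/eqP E|/eqP E].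
    have := h (B ^+ 2 + 1) (- Gamma u v x); rewrite E.
    by nra.
  have := h (- Gamma u v x) (A ^+ 2 + 1); rewrite E.
  by nra.
rewrite -(@ler_pXn2r _ 2) ?nnegrE ?addr_ge0 ?grad_ge0 // grad_sqr.
have := GammaDD u v 1 1; rewrite !scale1r => ->.
by rewrite -!grad_sqr -/A -/B; nra.
Qed.

End Bilinear.


Lemma powR_convex (p a b A B : R) : 1 <= p -> 0 <= a -> 0 <= b ->
  0 < A -> 0 < B ->
  (a + b) `^ p <= (A + B) `^ p *
    (A / (A + B) * (A `^ p)^-1 * a `^ p + B / (A + B) * (B `^ p)^-1 * b `^ p).
Proof.
move=> p1 a0 b0 A0 B0.
have AB0 : 0 < A + B by rewrite addr_gt0.
have tP : 0 <= A / (A + B) <= 1.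
  rewrite divr_ge0 ?(ltW A0) ?(ltW AB0) //= ler_pdivrMr // mul1r.
  by rewrite lerDl ltW.
have tC : 1 - A / (A + B) = B / (A + B).
  by field; rewrite gt_eqF.
have /andP[t0 t1] := tP.
pose t := Itv01 t0 t1.
have aA : 0 <= a / A by rewrite divr_ge0 // ltW.
have bB : 0 <= b / B by rewrite divr_ge0 // ltW.
have /= := @convex_powR R p p1 t (a / A) (b / B).
rewrite !inE /= !in_itv /= !andbT => /(_ aA bB).
rewrite !convRE /= /unstable.onem => cvx; rewrite -!tC.
have -> : a + b =
    (A + B) * (A / (A + B) * (a / A) + (1 - A / (A + B)) * (b / B)).
  by rewrite tC; field; rewrite !gt_eqF.
have q0 : 0 <= A / (A + B) * (a / A) + (1 - A / (A + B)) * (b / B).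
  by rewrite tC addr_ge0 // mulr_ge0 // divr_ge0 // ltW.
rewrite powRM ?(ltW AB0) // ler_wpM2l ?powR_ge0 //.
apply: (le_trans cvx); rewrite tC.
rewrite !powRM ?invr_ge0 ?(ltW A0) ?(ltW B0) //.
have invC (C : R) : 0 < C -> C^-1 `^ p = (C `^ p)^-1.
  by move=> C0; rewrite -powR_inv1 ?(ltW C0) // -powRrM mulN1r powRN.
rewrite !invC // le_eqVlt; apply/orP; left; apply/eqP; ring.
Qed.

Lemma ge0_nnintZ (f : V -> R) (k : R) : 0 <= k -> (forall x, 0 <= f x) ->
  nnint [set: V] (fun x => k * f x) = (k%:E * nnint [set: V] f)%E.
Proof.
move=> k0 f0; rewrite /nnint /esum -ereal_supZl //; last first.
  apply/set0P; exists (\sum_(x \in set0) (f x * mu G x)%:E)%E.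
  by exists set0 => //; split.
congr ereal_sup; rewrite image_comp; apply: eq_imagel => A _ /=.
rewrite ge0_mule_fsumr; last by move=> x; rewrite lee_fin mulr_ge0 // ltW ?mu_gt0.
by apply: eq_fsbigr => x _; rewrite -EFinM mulrA.
Qed.

Lemma nnintD (f g : V -> R) : (forall x, 0 <= f x) -> (forall x, 0 <= g x) ->
  nnint [set: V] (fun x => f x + g x) =
  (nnint [set: V] f + nnint [set: V] g)%E.
Proof.
move=> f0 g0; rewrite /nnint -esumD.
- by apply: eq_esum => x _; rewrite mulrDl EFinD.
- by move=> x _; rewrite lee_fin mulr_ge0 // ltW ?mu_gt0.
- by move=> x _; rewrite lee_fin mulr_ge0 // ltW ?mu_gt0.
Qed.

Lemma le_nnint (f g : V -> R) : (forall x, f x <= g x) ->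
  (nnint [set: V] f <= nnint [set: V] g)%E.
Proof.
by move=> fg; apply: le_esum => x _; rewrite lee_fin ler_wpM2r // ltW ?mu_gt0.
Qed.

Lemma nnint_ge0 (f : V -> R) : (forall x, 0 <= f x) ->
  (0 <= nnint [set: V] f)%E.
Proof.
by move=> f0; apply: esum_ge0 => x _; rewrite lee_fin mulr_ge0 // ltW ?mu_gt0.
Qed.

Lemma modular_cst0 (p : R) w : 0 < p -> modular p w 0 = 0%E.
Proof.
move=> p0; rewrite /modular /nnint esum1 // => x _.
have -> : grad 0 x = 0.
  by have := gradZ x 0 (0 : V -> R); rewrite scale0r normr0 mul0r.
by rewrite (_ : (0 : V -> R) x = 0) // normr0 powR0 ?gt_eqF // mulr0 addr0 mul0r.
Qed.

Section Power.
Variables (p : R) (p1 : 1 <= p).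

Let p_gt0 : 0 < p. Proof. exact: lt_le_trans p1. Qed.
Let p_ge0 : 0 <= p. Proof. exact: ltW. Qed.

Lemma root_triangle (m n l : R) : 0 <= m -> 0 <= n -> 0 <= l ->
  (forall A B, 0 < A -> 0 < B ->
    l <= (A + B) `^ p * (A / (A + B) * (A `^ p)^-1) * m +
         (A + B) `^ p * (B / (A + B) * (B `^ p)^-1) * n) ->
  l `^ p^-1 <= m `^ p^-1 + n `^ p^-1.
Proof.
move=> m0 n0 l0 lAB; apply/ler_addgt0Pr => e e0.
have rootK (x : R) : 0 <= x -> (x `^ p^-1) `^ p = x.
  by move=> x0; rewrite -powRrM mulVf ?gt_eqF // powRr1.
have powK (x : R) : 0 <= x -> (x `^ p) `^ p^-1 = x.
  by move=> x0; rewrite -powRrM mulfV ?gt_eqF // powRr1.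
have [A [A0 mA EA]] :
    exists A : R, [/\ 0 < A, m <= A `^ p & A = m `^ p^-1 + e / 2].
  exists (m `^ p^-1 + e / 2); split => //.
    by rewrite ltr_wpDl ?powR_ge0 // divr_gt0.
  rewrite -[leLHS](rootK _ m0) ge0_ler_powR ?nnegrE ?powR_ge0 //.
    by rewrite addr_ge0 ?powR_ge0 // ltW // divr_gt0.
  by rewrite lerDl ltW // divr_gt0.
have [B [B0 nB EB]] :
    exists B : R, [/\ 0 < B, n <= B `^ p & B = n `^ p^-1 + e / 2].
  exists (n `^ p^-1 + e / 2); split => //.
    by rewrite ltr_wpDl ?powR_ge0 // divr_gt0.
  rewrite -[leLHS](rootK _ n0) ge0_ler_powR ?nnegrE ?powR_ge0 //.
    by rewrite addr_ge0 ?powR_ge0 // ltW // divr_gt0.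
  by rewrite lerDl ltW // divr_gt0.
have -> : m `^ p^-1 + n `^ p^-1 + e = A + B.
  by rewrite EA EB [in LHS](splitr e) addrACA.
have AB0 : 0 < A + B by rewrite addr_gt0.
have lC : l <= (A + B) `^ p.
  apply: (le_trans (lAB _ _ A0 B0)).
  rewrite -!mulrA -mulrDr -[leRHS]mulr1 ler_wpM2l ?powR_ge0 //.
  have <- : A * ((A + B)^-1 * 1) + B * ((A + B)^-1 * 1) = 1.
    by rewrite !mulr1 -mulrDl mulfV // gt_eqF.
  apply: lerD; apply: ler_wpM2l; rewrite ?(ltW A0) ?(ltW B0) //.
    apply: ler_wpM2l; first by rewrite invr_ge0 ltW.
    by rewrite mulrC ler_pdivrMr ?powR_gt0 // mul1r.
  apply: ler_wpM2l; first by rewrite invr_ge0 ltW.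
  by rewrite mulrC ler_pdivrMr ?powR_gt0 // mul1r.
rewrite -[leRHS](powK _ (ltW AB0)) ge0_ler_powR ?nnegrE ?powR_ge0 //.
by rewrite invr_ge0.
Qed.

Section Weight.
Variables (w : V -> R) (w0 : forall x, 0 <= w x).

Lemma modularE_ge0 u x : 0 <= grad u x `^ p + w x * `|u x| `^ p.
Proof. by rewrite addr_ge0 ?mulr_ge0 ?powR_ge0. Qed.

Lemma modular_ge0 u : (0 <= modular p w u)%E.
Proof. by apply: nnint_ge0 => x; exact: modularE_ge0. Qed.

Lemma modularZ (c : R) u : modular p w (c *: u) = ((`|c| `^ p)%:E * modular p w u)%E.
Proof.
rewrite -ge0_nnintZ ?powR_ge0 //; last exact: modularE_ge0.
congr nnint; apply/funext => x.
by rewrite gradZ fctE normrM !powRM ?grad_ge0 //; ring.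
Qed.

Lemma powR_seminorm_le (N : (V -> R) -> R) (A B : R) u v :
  (forall f, 0 <= N f) -> N (u + v) <= N u + N v -> 0 < A -> 0 < B ->
  N (u + v) `^ p <=
    (A + B) `^ p * (A / (A + B) * (A `^ p)^-1) * N u `^ p +
    (A + B) `^ p * (B / (A + B) * (B `^ p)^-1) * N v `^ p.
Proof.
move=> N0 Nuv A0 B0; rewrite -!(mulrA (_ `^ p)) -mulrDr.
apply: le_trans (powR_convex p1 (N0 u) (N0 v) A0 B0).
by rewrite ge0_ler_powR ?nnegrE ?addr_ge0.
Qed.

Lemma modularD_le (A B : R) u v : 0 < A -> 0 < B ->
  (modular p w (u + v)%R <=
    ((A + B) `^ p * (A / (A + B) * (A `^ p)^-1))%:E * modular p w u +
    ((A + B) `^ p * (B / (A + B) * (B `^ p)^-1))%:E * modular p w v)%E.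
Proof.
move=> A0 B0.
have AB0 : 0 < A + B by rewrite addr_gt0.
rewrite /modular -!ge0_nnintZ; first last.
- by move=> x; exact: modularE_ge0.
- by rewrite !mulr_ge0 ?invr_ge0 ?powR_ge0 // ltW.
- by move=> x; exact: modularE_ge0.
- by rewrite !mulr_ge0 ?invr_ge0 ?powR_ge0 // ltW.
rewrite -nnintD; first last.
- move=> x; rewrite mulr_ge0 ?modularE_ge0 //.
  by rewrite !mulr_ge0 ?invr_ge0 ?powR_ge0 // ltW.
- move=> x; rewrite mulr_ge0 ?modularE_ge0 //.
  by rewrite !mulr_ge0 ?invr_ge0 ?powR_ge0 // ltW.
apply: le_nnint => x.
have h1 := @powR_seminorm_le (fun f => grad f x) A B u v
  (fun f => grad_ge0 x f) (gradD x u v) A0 B0.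
have h2 := @powR_seminorm_le (fun f => `|f x|) A B u v
  (fun f => normr_ge0 (f x)) (ler_normD (u x) (v x)) A0 B0.
have := lerD h1 (ler_wpM2l (w0 x) h2); move/le_trans; apply.
by rewrite !mulrDr addrACA !(mulrCA (w x)).
Qed.

Lemma enormE u : (modular p w u < +oo)%E ->
  enorm p w u = (fine (modular p w u) `^ p^-1)%:E.
Proof.
by move=> uoo; rewrite /enorm -poweR_EFin fineK // ge0_fin_numE ?modular_ge0.
Qed.

Lemma enorm_lty u : (enorm p w u < +oo)%E = (modular p w u < +oo)%E.
Proof.
apply/idP/idP => [|h]; last by rewrite enormE ?ltry.
by apply: lty_poweRy; rewrite invr_neq0 // gt_eqF.
Qed.

Lemma enorm_ge0 u : (0 <= enorm p w u)%E. Proof. exact: poweR_ge0. Qed.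

Lemma enormZ (c : R) u : enorm p w (c *: u) = (`|c|%:E * enorm p w u)%E.
Proof.
rewrite /enorm modularZ poweRM ?modular_ge0 ?lee_fin ?powR_ge0 //.
by rewrite poweR_EFin -powRrM mulfV ?gt_eqF // powRr1.
Qed.

Lemma enormD u v : (enorm p w (u + v)%R <= enorm p w u + enorm p w v)%E.
Proof.
have [uoo|] := ltP (modular p w u) +oo%E; last first.
  rewrite leye_eq => /eqP E; rewrite {2}/enorm E poweRyr ?invr_neq0 ?gt_eqF //.
  by rewrite addye ?leey // gt_eqF // (lt_le_trans (ltNyr 0)) ?enorm_ge0.
have [voo|] := ltP (modular p w v) +oo%E; last first.
  rewrite leye_eq => /eqP E; rewrite {3}/enorm E poweRyr ?invr_neq0 ?gt_eqF //.
  by rewrite addey ?leey // gt_eqF // (lt_le_trans (ltNyr 0)) ?enorm_ge0.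
have uvoo : (modular p w (u + v)%R < +oo)%E.
  apply: (le_lt_trans (modularD_le u v ltr01 ltr01)).
  by rewrite lte_add_pinfty // lte_mul_pinfty ?lee_fin //
    !mulr_ge0 ?invr_ge0 ?powR_ge0.
rewrite (enormE uoo) (enormE voo) (enormE uvoo) -EFinD lee_fin.
apply: root_triangle; rewrite ?fine_ge0 ?modular_ge0 // => A B A0 B0.
rewrite -lee_fin EFinD !(EFinM _ (fine _)).
by rewrite !fineK ?ge0_fin_numE ?modular_ge0 // modularD_le.
Qed.

End Weight.

Section Potential.
Variables (w : V -> R) (w0 : forall x, 0 <= w x).

Lemma potential_energyZ (c : R) u :
  potential_energy p w (c *: u) = ((`|c| `^ p)%:E * potential_energy p w u)%E.
Proof.
rewrite -ge0_nnintZ ?powR_ge0 //; last by move=> x; rewrite mulr_ge0 ?powR_ge0.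
congr nnint; apply/funext => x.
by rewrite fctE normrM powRM // mulrCA.
Qed.

Lemma potential_energyD_lty u v :
  (potential_energy p w u < +oo)%E -> (potential_energy p w v < +oo)%E ->
  (potential_energy p w (u + v)%R < +oo)%E.
Proof.
move=> uoo voo; pose k : R := (1 + 1) `^ p * (1 / (1 + 1) * (1 `^ p)^-1).
have k0 : 0 <= k by rewrite !mulr_ge0 ?invr_ge0 ?powR_ge0.
apply: (@le_lt_trans _ _
  (k%:E * potential_energy p w u + k%:E * potential_energy p w v)%E); last first.
  by rewrite lte_add_pinfty // lte_mul_pinfty ?lee_fin.
have pos f x : 0 <= w x * `|f x| `^ p by rewrite mulr_ge0 ?powR_ge0.
rewrite /potential_energy -!ge0_nnintZ // -nnintD; first last.
- by move=> x; rewrite mulr_ge0.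
- by move=> x; rewrite mulr_ge0.
apply: le_nnint => x.
have h := @powR_seminorm_le (fun f => `|f x|) 1 1 u v
  (fun f => normr_ge0 (f x)) (ler_normD (u x) (v x)) ltr01 ltr01.
by have := ler_wpM2l (w0 x) h; rewrite mulrDr !(mulrCA (w x)).
Qed.

Lemma potential_energy_cst0 : potential_energy p w 0 = 0%E.
Proof.
rewrite /potential_energy /nnint esum1 // => x _.
by rewrite (_ : (0 : V -> R) x = 0) // normr0 powR0 ?gt_eqF // mulr0 mul0r.
Qed.

Lemma modular_lty u : (modular p (cst 1)%R u < +oo)%E ->
  (potential_energy p w u < +oo)%E -> (modular p w u < +oo)%E.
Proof.
move=> uoo voo; apply: le_lt_trans (lte_add_pinfty uoo voo).
rewrite /modular /potential_energy -nnintD; first last.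
- by move=> x; rewrite mulr_ge0 ?powR_ge0.
- by move=> x; rewrite addr_ge0 ?mulr_ge0 ?powR_ge0.
apply: le_nnint => x; rewrite lerD2r lerDl.
by rewrite mulr_ge0 ?powR_ge0.
Qed.

End Potential.

Let one_ge0 (x : V) : 0 <= (cst 1 x : R). Proof. exact: ler01. Qed.

Lemma W1pD u v : W1p p u -> W1p p v -> W1p p (u + v).
Proof.
move=> [uoo uC] [voo vC]; split.
  exact: le_lt_trans (enormD one_ge0 u v) (lte_add_pinfty uoo voo).
move=> e e0; have e20 : 0 < e / 2 by rewrite divr_gt0.
have [f fC fe] := uC _ e20; have [g gC ge] := vC _ e20.
exists (f + g).
  apply: (@sub_finite_set _ _ ([set x | f x != 0] `|` [set x | g x != 0])).
    move=> x /=; rewrite !fctE; have [->|] := eqVneq (f x) 0; last by left.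
    by rewrite add0r; right.
  by rewrite finite_setU.
have -> : u + v - (f + g) = (u - f) + (v - g) by rewrite opprD addrACA.
apply: (le_lt_trans (enormD one_ge0 _ _)).
by rewrite [e]splitr EFinD lteD.
Qed.

Lemma W1pZ (c : R) u : W1p p u -> W1p p (c *: u).
Proof.
move=> [uoo uC]; split.
  by rewrite (enormZ one_ge0) lte_mul_pinfty ?lee_fin.
move=> e e0; have c0 : 0 < `|c| + 1 by rewrite ltr_wpDl.
have [|f fC fe] := uC (e / (`|c| + 1)); first by rewrite divr_gt0.
exists (c *: f).
  apply: sub_finite_set fC => x /=; rewrite fctE.
  by apply: contra => /eqP ->; rewrite scaler0.
rewrite -scalerBr (enormZ one_ge0).
apply: (@le_lt_trans _ _ ((`|c| + 1)%:E * enorm p (cst 1)%R (u - f)%R)%E).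
  by rewrite lee_wpmul2r ?enorm_ge0 // lee_fin lerDl.
by move: fe; rewrite EFinM muleC -lte_pdivlMl ?invr_gt0 // invrK.
Qed.

Lemma W1p0 : W1p p 0.
Proof.
have E : enorm p (cst 1)%R (0 : V -> R) = 0%E.
  by rewrite /enorm modular_cst0 // poweR0r // invr_neq0 // gt_eqF.
split; first by rewrite E ltry.
move=> e e0; exists 0; last by rewrite subr0 E lte_fin.
rewrite /Cc /= (_ : mkset _ = set0) //; apply/seteqP; split => // x /=.
by rewrite (_ : (0 : V -> R) x = 0) // eqxx.
Qed.

End Power.
End Calculus.

Section Space.
Context {R : realType} {V : choiceType} (G : weighted_graph R V).
Variables (p : R) (p1 : 1 <= p) (a : V -> R) (a_gt0 : forall x, 0 < a x).

Let p_gt0 : 0 < p. Proof. exact: lt_le_trans p1. Qed.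
Let a_ge0 x : 0 <= a x. Proof. exact: ltW. Qed.

(* p1 and a_gt0 are only there to make the normed space structure inferable. *)
Definition weighted_pred of 1 <= p & (forall x, 0 < a x) : {pred V -> R} :=
  fun u => `[< W1p G p u /\ (potential_energy G p a u < +oo)%E >].

Record weighted_space := WeightedSpace {
  weighted_fun :> V -> R;
  weighted_funP : weighted_fun \in weighted_pred p1 a_gt0
}.

HB.instance Definition _ := [isSub for weighted_fun].
HB.instance Definition _ := [Choice of weighted_space by <:].

Lemma weighted_submod_closed : submod_closed (weighted_pred p1 a_gt0).
Proof.
split.
  apply/asboolP; split; first exact: W1p0.
  by rewrite potential_energy_cst0 ?ltry.
move=> c u v /asboolP[u1 u2] /asboolP[v1 v2]; apply/asboolP; split.
  exact: W1pD (W1pZ _ _ _) _.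
apply: potential_energyD_lty => //.
by rewrite potential_energyZ // lte_mul_pinfty ?lee_fin ?powR_ge0.
Qed.

HB.instance Definition _ := GRing.isSubmodClosed.Build R (V -> R)
  (weighted_pred p1 a_gt0) weighted_submod_closed.

HB.instance Definition _ := [SubChoice_isSubLmodule of weighted_space by <:].

Definition weighted_norm (u : weighted_space) : R := fine (enorm G p a u).

Lemma weighted_enorm_lty (u : weighted_space) : (enorm G p a u < +oo)%E.
Proof.
have /asboolP[[u1 _] u2] := weighted_funP u.
by rewrite enorm_lty // modular_lty // -enorm_lty.
Qed.

Lemma weighted_normE (u : weighted_space) :
  (weighted_norm u)%:E = enorm G p a u.
Proof. by rewrite fineK // ge0_fin_numE ?enorm_ge0 ?weighted_enorm_lty. Qed.

Lemma ler_weighted_normD u v :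
  weighted_norm (u + v) <= weighted_norm u + weighted_norm v.
Proof. by rewrite -lee_fin EFinD !weighted_normE enormD. Qed.

Lemma weighted_normZ (c : R) u : weighted_norm (c *: u) = `|c| * weighted_norm u.
Proof. by apply: EFin_inj; rewrite EFinM !weighted_normE enormZ. Qed.

Lemma weighted_norm0_eq0 u : weighted_norm u = 0 -> u = 0.
Proof.
move=> u0; have : enorm G p a u = 0%E by rewrite -weighted_normE u0.
move/(poweR_eq0_eq0 (modular_ge0 _ _ a_ge0 _)) => m0.
apply/val_inj/funext => x /=; apply/eqP/negPn/negP => ux.
suff : (0 < modular G p a u)%E by rewrite m0 ltxx.
have t0 y : 0 <= grad G u y `^ p + a y * `|u y| `^ p.
  by rewrite addr_ge0 ?mulr_ge0 ?powR_ge0.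
rewrite /modular /nnint.
apply: (@lt_le_trans _ _ ((grad G u x `^ p + a x * `|u x| `^ p) * mu G x)%:E).
  rewrite lte_fin mulr_gt0 ?mu_gt0 // ltr_wpDl ?powR_ge0 //.
  by rewrite mulr_gt0 // powR_gt0 // normr_gt0.
rewrite -(@esum_set1 _ _ x
  (fun y => ((grad G u y `^ p + a y * `|u y| `^ p) * mu G y)%:E)); last first.
  by rewrite lee_fin mulr_ge0 // ltW ?mu_gt0.
apply: esum_ge; exists [set x]; first by split.
by rewrite esum_set1 ?fsbig_set1 // lee_fin mulr_ge0 // ltW ?mu_gt0.
Qed.

HB.instance Definition _ := @Lmodule_isNormed.Build R weighted_space
  weighted_norm ler_weighted_normD weighted_normZ weighted_norm0_eq0.

End Space.

(* The product normed module of the library carries the max norm. *)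
Section SumNorm.
Context {R : realType}.
Variables (U W : normedModType R).

Definition sum_prod : Type := (U * W)%type.

HB.instance Definition _ := GRing.Lmodule.copy sum_prod (U * W)%type.

Definition sum_norm (x : sum_prod) : R := `|x.1| + `|x.2|.

Lemma ler_sum_normD (x y : sum_prod) : sum_norm (x + y) <= sum_norm x + sum_norm y.
Proof. by rewrite /sum_norm addrACA lerD // ler_normD. Qed.

Lemma sum_normZ (c : R) (x : sum_prod) : sum_norm (c *: x) = `|c| * sum_norm x.
Proof. by rewrite /sum_norm !normrZ mulrDr. Qed.

Lemma sum_norm0_eq0 (x : sum_prod) : sum_norm x = 0 -> x = 0.
Proof.
move=> /eqP; rewrite paddr_eq0 // !normr_eq0 => /andP[/eqP x1 /eqP x2].
by case: x x1 x2 => x y /= -> ->.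
Qed.

HB.instance Definition _ := @Lmodule_isNormed.Build R sum_prod
  sum_norm ler_sum_normD sum_normZ sum_norm0_eq0.

Lemma sum_prod_normE (x : sum_prod) : `|x| = `|x.1| + `|x.2|.
Proof. by []. Qed.

End SumNorm.

(* Sup over [0, 1] stands for max in the definition of the level: for a
   continuous path and a continuous functional the sup is attained. Extended
   reals make inf and sup meaningful without boundedness side conditions. *)
Section Variational.
Context {R : realType} {H : normedModType R}.
Implicit Types (J : H -> R) (w e : H) (r : R).

Definition critical_point J w : Prop :=
  differentiable J w /\ forall h, 'd J w h = 0.

Definition paths e : set (R -> H) := [set gamma : R -> H |
  [/\ {within `[0, 1], continuous gamma}, gamma 0 = 0 & gamma 1 = e]].

Definition mountain_pass_level J e : \bar R :=
  ereal_inf [set ereal_sup [set (J (gamma t))%:E | t in `[0, 1]]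
            | gamma in paths e].

Definition mountain_pass_geometry J e r : Prop :=
  [/\ 0 < r, r < `|e|,
      ((J 0)%R%:E < ereal_inf [set (J w)%:E | w in [set w | (`|w| = r)%R]])%E
    & J e <= J 0].

Definition mountain_pass_solution J w : Prop :=
  critical_point J w /\
  exists e r, mountain_pass_geometry J e r /\
    (J w)%:E = mountain_pass_level J e.

Definition nehari J : set H :=
  [set w | [/\ w != 0, differentiable J w & 'd J w w = 0]].

Definition ground_state_solution J w : Prop :=
  nehari J w /\ (J w)%:E = ereal_inf [set (J z)%:E | z in nehari J].

End Variational.

Section System.
Context {R : realType} {V : choiceType} (G : weighted_graph R V).
Variables (p : R) (a b : V -> R).
Implicit Types u v : V -> R.

Definition bounded_below_potentials : Prop :=
  exists2 V0 : R, 0 < V0 & forall x, V0 <= a x /\ V0 <= b x.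

Definition sublevel (c : V -> R) (M : R) : set V := [set x | c x <= M].

Definition integrable_inverse_potentials : Prop :=
  exists2 M0 : R, 0 < M0 &
    [/\ L1 G (~` sublevel a M0) (fun x => (a x)^-1),
        L1 G (~` sublevel b M0) (fun x => (b x)^-1),
        (volume G (sublevel a M0) < +oo)%E
      & (volume G (sublevel b M0) < +oo)%E].

(* ln 0 = 0, and 0 `^ s = 0 for s != 0, so every term vanishes where it should. *)
Definition equation (c : V -> R) u v (x : V) : Prop :=
  - plap G p u x + c x * `|u x| `^ (p - 2) * u x =
    (p - 2) / p * `|u x| `^ (p - 4) * u x * (v x ^+ 2 * ln (v x ^+ 2))
    + 2 / p * `|v x| `^ (p - 2) * u x * ln (u x ^+ 2)
    + 2 / p * `|v x| `^ (p - 2) * u x.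

Definition solves_system u v : Prop :=
  forall x, equation a u v x /\ equation b v u x.

Definition log_term u v : R :=
  gint G (fun x => `|u x| `^ (p - 2) * (v x ^+ 2 * ln (v x ^+ 2))).

Hypotheses (p_gt4 : 4 < p) (ab_bounded : bounded_below_potentials).

Lemma exponent_ge1 : 1 <= p. Proof. by apply/ltW/(lt_trans _ p_gt4); rewrite ltr1n. Qed.

Lemma potential_gt0_l x : 0 < a x.
Proof. by have [c c0 /(_ x) [ca _]] := ab_bounded; exact: lt_le_trans ca. Qed.

Lemma potential_gt0_r x : 0 < b x.
Proof. by have [c c0 /(_ x) [_ cb]] := ab_bounded; exact: lt_le_trans cb. Qed.

Definition energy_space : normedModType R :=
  sum_prod (weighted_space G exponent_ge1 potential_gt0_l)
           (weighted_space G exponent_ge1 potential_gt0_r).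

Lemma energy_space_normE (w : energy_space) :
  `|w| = fine (enorm G p a w.1) + fine (enorm G p b w.2).
Proof. by []. Qed.

Definition energy (w : energy_space) : R :=
  p^-1 * (`|w.1| `^ p + `|w.2| `^ p)
  - p^-1 * log_term w.1 w.2 - p^-1 * log_term w.2 w.1.

End System.

Arguments energy {R V} G {p a b} p_gt4 ab_bounded w.

(* Main.v *)
(** The energy is [J = A / p], where [A (t w) = t ^ p (A w - 2 ln t * B w)] for [t > 0] and
    [B (u, v)] is the integral of [|u| ^ (p - 2) v ^ 2 + |v| ^ (p - 2) u ^ 2]. Hence the Nehari
    manifold is [A = (2 / p) B], [w <> 0], each ray with [B > 0] meets it exactly once, at the
    maximum of [J] along the ray, and [A / B + (2 / p) ln B] is 0-homogeneous. The latter is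
    minimised by the direct method on [B = 1]: there [A] is coercive because the logarithm of
    [|v|] grows slower than the norm, and since [1 / a] and [1 / b] are integrable the
    functionals [int |u| ^ (p - 2) g(v)] are continuous for pointwise convergence on bounded
    sets. The minimiser, rescaled onto the Nehari manifold, is a critical point of [J] of least
    energy. Near 0 the logarithms are negative, so that [A - (2 / p) B > 0] there; any path from
    0 to a point where [A < (2 / p) B] thus crosses the Nehari manifold, while the straight path
    through the minimiser stays below its energy, which identifies the mountain pass level. *)

From HB Require Import structures.
Require Import Defs.
From mathcomp Require Import all_boot all_order all_algebra.
From mathcomp Require Import all_classical all_reals all_analysis.
From mathcomp Require Import ring lra finmap.
Import Order.TTheory GRing.Theory Num.Theory.
Import numFieldNormedType.Exports.
Local Open Scope classical_set_scope.
Local Open Scope ring_scope.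

Set Implicit Arguments.
Unset Strict Implicit.
Unset Printing Implicit Defensive.

(** * Differentiability of first-order approximable functions *)

(** The functionals are infinite sums over [V], so neither continuity nor differentiability can be
    read off term by term. Throughout, finitely many terms are left to one-variable calculus and the
    rest to a tail estimate uniform over bounded sets. The coupling terms grow like the power
    [p - 1]; with a weight [c] below both potentials, [M ^ (p - 1) <= n * c * M ^ p + C(n) / c],
    where the first term is small by the choice of [n] and the second has small tails since [1 / c]
    is summable. For differentiability the tail must be small relative to the size [t] of the
    increment [h]: one bounds it by [t] times an expression in [h / t], which stays in a fixed ball.
    The constant [2 / p] appears because [t ^ p (A - 2 ln t * B)] has derivative [p A - 2 B] at
    [t = 1]. Minimising a 0-homogeneous quotient, defined on the open set [B > 0], makes criticality
    a plain first-order condition without a Lagrange multiplier, so no manifold structure is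
    used. *)

Section DiffApprox.
Context {R : realType} {H : normedModType R}.
Implicit Types (F g : H -> R) (w h : H).

Lemma littleo_of_eps (f : H -> R) :
  (forall e : R, 0 < e -> exists2 d : R, 0 < d &
     forall h, `|h| <= d -> `|f h| <= e * `|h|) -> f =o_ (0 : H) id.
Proof.
move=> fe; apply/eqoP => e /= e0.
have [d d0 fd] := fe _ e0.
near=> h; apply: fd.
near: h; apply/nbhs_normP; exists d => //= h; rewrite /= sub0r normrN; exact: ltW.
Unshelve. all: by end_near. Qed.

Lemma differentiable_of_eps F (L : {linear H -> R}) w :
  continuous L ->
  (forall e : R, 0 < e -> exists2 d : R, 0 < d &
     forall h, `|h| <= d -> `|F (w + h) - F w - L h| <= e * `|h|) ->
  differentiable F w.
Proof.
move=> Lc FL.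
have FE : F \o shift w = cst (F w) + L +o_ 0 id.
  apply/eqaddoP; apply/eqoP; apply: littleo_of_eps => e e0.
  have [d d0 Fd] := FL _ e0; exists d => // h /Fd.
  by rewrite !fctE /= (addrC h) opprD addrA.
by apply/diff_locallyP; rewrite (diff_unique Lc FE).
Qed.

Lemma differentiable_eps F w : differentiable F w ->
  forall e : R, 0 < e -> exists2 d : R, 0 < d &
     forall h, `|h| <= d -> `|F (w + h) - F w - 'd F w h| <= e * `|h|.
Proof.
move=> /diff_locally /eqaddoP Fo e e0.
have /nbhs_normP[d /= d0 Fd] := Fo _ e0.
exists (d / 2); first by rewrite divr_gt0.
move=> h hd; have := Fd h; rewrite /= sub0r normrN !fctE /= (addrC h).
rewrite opprD addrA; apply; apply: (le_lt_trans hd).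
by rewrite ltr_pdivrMr // mulr_natr mulr2n ltrDl.
Qed.

Lemma linear_continuous_of_bound (L : {linear H -> R}) (c : R) :
  (forall h, `|L h| <= c * `|h|) -> continuous L.
Proof.
move=> Lc; apply/linear_bounded_continuous.
apply/linear_boundedP; near=> M => x; apply: (le_trans (Lc x)).
by rewrite ler_wpM2r //; near: M; apply: nbhs_pinfty_ge; rewrite num_real.
Unshelve. all: by end_near. Qed.

(* The differentials of the approximants are Cauchy in operator norm. *)
Lemma differentiable_approx F w :
  (forall e : R, 0 < e -> exists2 g, differentiable g w & exists2 d : R, 0 < d &
     forall h, `|h| <= d -> `|(F (w + h) - F w) - (g (w + h) - g w)| <= e * `|h|) ->
  differentiable F w.
Proof.
move=> Fg.
pose en n : R := n.+1%:R^-1.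
have en0 n : 0 < en n by rewrite invr_gt0.
have /choice[g gP] n : exists g, differentiable g w /\ exists2 d : R, 0 < d &
     forall h, `|h| <= d -> `|(F (w + h) - F w) - (g (w + h) - g w)| <= en n * `|h|.
  by have [g gw gd] := Fg _ (en0 n); exists g.
have Fdg e n : 0 < e -> exists2 d : R, 0 < d & forall h, `|h| <= d ->
    `|F (w + h) - F w - 'd (g n) w h| <= (en n + e) * `|h|.
  move=> e0; have [gw [d1 d10 H1]] := gP n.
  have [d2 d20 H2] := differentiable_eps gw e0.
  exists (Num.min d1 d2) => [|h]; first by rewrite lt_min d10.
  rewrite le_min => /andP[/H1 h1 /H2 h2]; rewrite mulrDl.
  apply: le_trans (lerD h1 h2); apply: le_trans (ler_normD _ _).
  by rewrite addrA subrK.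
have dg m n h : `|'d (g m) w h - 'd (g n) w h| <= (en m + en n) * `|h|.
  apply/ler_addgt0Pr => e e0.
  have [->|h0] := eqVneq h 0; first by rewrite !(raddf0 ('d _ w)) subr0 !normr0 mulr0 add0r ltW.
  have nh0 : 0 < `|h| by rewrite normr_gt0.
  have e'0 : 0 < e / (2 * `|h|) by rewrite divr_gt0 // mulr_gt0.
  have [d1 d10 H1] := Fdg _ m e'0; have [d2 d20 H2] := Fdg _ n e'0.
  (* Both expansions hold only near 0, but the difference of differentials is homogeneous: [h] is
     shrunk into the common ball and [s] cancelled. *)
  pose s := Num.min d1 d2 / `|h|.
  have s0 : 0 < s by rewrite divr_gt0 // lt_min d10.
  have ns : `|s *: h| = Num.min d1 d2.
    by rewrite normrZ gtr0_norm // /s divfK // gt_eqF.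
  clearbody s; have : `|s *: h| <= d1 by rewrite ns ge_min lexx.
  have : `|s *: h| <= d2 by rewrite ns ge_min lexx orbT.
  move=> /H2 h2 /H1; rewrite distrC => h1.
  have := le_trans (ler_distD _ _ _) (lerD h1 h2).
  have E k : 'd (g k) w (s *: h) = s * 'd (g k) w h by rewrite linearZ.
  rewrite !E -mulrBr normrM normrZ (gtr0_norm s0).
  have -> : (en m + e / (2 * `|h|)) * (s * `|h|) + (en n + e / (2 * `|h|)) * (s * `|h|)
     = s * ((en m + en n) * `|h| + e) by field; rewrite gt_eqF.
  by rewrite (ler_pM2l s0).
have en_small e : 0 < e -> exists n, en n <= e.
  move=> e0; have [n _ nP] := near_infty_natSinv_lt (PosNum e0).
  by exists n; apply/ltW/(nP n) => /=.
have cvgL h : cvgn (fun n => 'd (g n) w h).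
  apply/cauchy_cvgP/cauchy_exP => e e0.
  have h0 : 0 < `|h| + 1 by rewrite ltr_wpDl.
  have e'0 : 0 < e / (2 * (`|h| + 1)) by rewrite divr_gt0 // mulr_gt0.
  have [m me] := en_small _ e'0; exists ('d (g m) w h).
  suff : \forall n \near \oo, `|'d (g m) w h - 'd (g n) w h| < e by [].
  near=> n.
  apply: (le_lt_trans (dg _ _ _)).
  apply: (@le_lt_trans _ _ ((en m + en n) * (`|h| + 1))).
    by rewrite ler_wpM2l ?addr_ge0 ?ltW // ltrDl.
  rewrite -ltr_pdivlMr // (_ : e / (`|h| + 1) = e / (2 * (`|h| + 1)) + e / (2 * (`|h| + 1))).
    rewrite ler_ltD //; near: n; exact: (near_infty_natSinv_lt (PosNum e'0)).
  by field; rewrite gt_eqF.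
pose L h : R := limn (fun n => 'd (g n) w h).
have Llin : linear L.
  move=> c x y; apply/cvg_lim => //.
  under eq_fun do rewrite linearP.
  by apply: cvgD; [apply: cvgZl_tmp|]; exact: cvgL.
have Lg n h : `|L h - 'd (g n) w h| <= en n * `|h|.
  have c1 : (fun m => `|'d (g m) w h - 'd (g n) w h|) @ \oo --> `|L h - 'd (g n) w h|.
    by apply: cvg_norm; apply: cvgB; [exact: cvgL|exact: cvg_cst].
  apply/ler_addgt0Pr => e e0.
  have h0 : 0 < `|h| + 1 by rewrite ltr_wpDl.
  have e'0 : 0 < e / (`|h| + 1) by rewrite divr_gt0.
  rewrite -(cvg_lim _ c1) //; apply: limr_le; first by apply/cvg_ex; eexists; exact: c1.
  near=> m; apply: (le_trans (dg _ _ _)).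
  rewrite mulrDl addrC lerD2l.
  apply: (@le_trans _ _ (en m * (`|h| + 1))); first by rewrite ler_wpM2l ?lerDl // ltW.
  rewrite -ler_pdivlMr // ltW //; near: m.
  exact: (near_infty_natSinv_lt (PosNum e'0)).
pose HL := GRing.isLinear.Build _ _ _ _ L Llin.
pose LL : {linear H -> R} := HB.pack L HL.
have F1 e : 0 < e -> exists2 d : R, 0 < d & forall h, `|h| <= d ->
    `|F (w + h) - F w - LL h| <= e * `|h|.
  move=> e0; have e3 : 0 < e / 3 by rewrite divr_gt0.
  have [n ne] := en_small _ e3.
  have [d d0 Fd] := Fdg _ n e3; exists d => // h /Fd H1.
  have Lgn := Lg n h; rewrite distrC in Lgn.
  apply: le_trans (ler_distD _ _ _) _; apply: (le_trans (lerD H1 Lgn)).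
  rewrite -mulrDl ler_wpM2r //.
  have <- : e / 3 + e / 3 + e / 3 = e by field.
  by move: (en n) ne => x; lra.
apply: (@differentiable_of_eps F LL w) => //.
(* The limit functional is continuous because it differs from the bounded functional ['d (g 0) w] by
   at most [en 0 * |h|]. *)
have [g0w [d0 d00 H0]] := gP 0%N.
have /linear_boundedP : bounded_near ('d (g 0%N) w) (nbhs (0 : H)).
  by apply: continuous_linear_bounded; apply: diff_continuous.
move=> bd; near +oo_R => M.
apply: (@linear_continuous_of_bound _ (M + en 0%N)) => h.
rewrite -[LL h](subrK ('d (g 0%N) w h)) mulrDl addrC.
rewrite (le_trans (ler_normD _ _)) // lerD ?Lg //.
by move: h; near: M.
Unshelve. all: by end_near. Qed.
End DiffApprox.

(** * Calculus of one real variable *)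

Section ScalarCalculus.
Context {R : realType}.
Implicit Types (x y s t q L M : R) (g : R -> R).

Lemma is_derive_of_eps g s (l : R) :
  (forall e : R, 0 < e -> exists2 d : R, 0 < d &
     forall h, `|h| <= d -> `|g (s + h) - g s - h * l| <= e * `|h|) ->
  is_derive s 1 g l.
Proof.
move=> gl; suff cv : h^-1 *: ((g \o shift s) (h *: (1 : R)) - g s) @[h --> 0^'] --> l.
  by apply: DeriveDef; [apply/cvg_ex; exists l|exact: cvg_lim cv].
apply/cvgrPdist_le => e e0; have [d d0 gd] := gl _ e0.
near=> h; have h0 : h != 0 by near: h; exact: nbhs_dnbhs_neq.
have nh0 : 0 < `|h| by rewrite normr_gt0.
rewrite -(ler_pM2l nh0) -normrM mulrBr distrC (mulrC `|h| e).
have -> : h * (h^-1 *: ((g \o shift s) (h *: (1:R)) - g s)) - h * l = g (s + h) - g s - h * l.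
  by rewrite /= /GRing.scale /= mulr1 mulVKf // (addrC h).
apply: gd; near: h; apply: dnbhs0_le => //.
Unshelve. all: by end_near. Qed.

Lemma lipschitz_of_derive g (g' : R -> R) M L : (forall x, is_derive x 1 g (g' x)) ->
  (forall x, `|x| <= M -> `|g' x| <= L) ->
  forall x y, `|x| <= M -> `|y| <= M -> `|g x - g y| <= L * `|x - y|.
Proof.
move=> dg gL; suff H x y : `|x| <= M -> `|y| <= M -> x <= y -> `|g y - g x| <= L * `|y - x|.
  move=> x y xM yM; case: (leP x y) => [/H|/ltW/H]; last by apply.
  by rewrite distrC (distrC x); apply.
move=> xM yM xy.
have gc : continuous g by move=> z; apply: differentiable_continuous; apply/derivable1_diffP.
have [|c cxy ->] := @MVT_segment R g g' x y xy (fun z _ => dg z).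
  exact: continuous_subspaceT.
rewrite normrM ler_wpM2r // gL // ler_norml.
move: cxy xM yM; rewrite in_itv /= !ler_norml => /andP[xc cy] /andP[Mx _] /andP[_ yM].
by rewrite (le_trans Mx xc) (le_trans cy yM).
Qed.

Lemma is_derive_normr_powR q s : 1 < q ->
  is_derive s 1 (fun x => `|x| `^ q) (q * `|s| `^ (q - 2) * s).
Proof.
move=> q1; have q10 : 0 < q - 1 by rewrite subr_gt0.
have q0 : q != 0 by rewrite gt_eqF // (lt_trans ltr01).
have [s0|s0|->] := ltgtP s 0.
- have ns : 0 < - s by rewrite oppr_gt0.
  have E : q * `|s| `^ (q - 2) * s = q * (- s) `^ (q - 1) * (-1).
    rewrite ltr0_norm // -(mulr_powRB1 (ltW ns) q10) (_ : q - 1 - 1 = q - 2); ring.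
  rewrite E.
  apply: (@near_eq_is_derive _ _ _ (fun x => (- x) `^ q)).
    near=> x; rewrite ltr0_norm //; near: x; exact: lt_nbhsl.
  by apply: (@is_derive1_comp _ (fun x => x `^ q) -%R); exact: is_derive1_powR.
- have E : q * `|s| `^ (q - 2) * s = q * s `^ (q - 1).
    rewrite gtr0_norm // -(mulr_powRB1 (ltW s0) q10) (_ : q - 1 - 1 = q - 2); ring.
  rewrite E; apply: (@near_eq_is_derive _ _ _ (fun x => x `^ q)).
    near=> x; rewrite gtr0_norm //; near: x; exact: lt_nbhsr.
  exact: is_derive1_powR.
(* At 0 the increment is [|h| ^ (q - 1) * |h|], and this radius makes [|h| ^ (q - 1) <= e]. *)
- apply: is_derive_of_eps => e e0; exists (e `^ (q - 1)^-1); first by rewrite powR_gt0.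
  move=> h he; rewrite add0r normr0 powR0 // mulr0 mulr0 !subr0 ger0_norm ?powR_ge0 //.
  have [->|h0] := eqVneq h 0; first by rewrite normr0 powR0 // mulr0.
  rewrite -(mulr_powRB1 (normr_ge0 h)) ?(lt_trans ltr01) // mulrC ler_wpM2r //.
  have : `|h| `^ (q - 1) <= (e `^ (q - 1)^-1) `^ (q - 1).
    by rewrite ge0_ler_powR ?nnegrE ?powR_ge0 // ltW.
  by rewrite -powRrM mulVf ?gt_eqF // powRr1 //; exact: ltW.
Unshelve. all: by end_near. Qed.

Lemma is_deriveMf (f g : R -> R) s df dg : is_derive s 1 f df -> is_derive s 1 g dg ->
  is_derive s 1 (fun x => f x * g x) (df * g s + f s * dg).
Proof.
move=> fs gs; have := is_deriveM fs gs.
by rewrite /GRing.scale /= (mulrC (g s)) addrC.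
Qed.

Lemma is_deriveDf (f g : R -> R) s df dg : is_derive s 1 f df -> is_derive s 1 g dg ->
  is_derive s 1 (fun x => f x + g x) (df + dg).
Proof. by move=> fs gs; exact: is_deriveD fs gs. Qed.

Lemma is_deriveZf (f : R -> R) s k df : is_derive s 1 f df ->
  is_derive s 1 (fun x => k * f x) (k * df).
Proof. by move=> fs; exact: is_deriveZ fs. Qed.

Lemma is_derive_sqr s : is_derive s 1 (fun x => x ^+ 2) (2 * s).
Proof.
have := is_deriveMf (is_derive_id s 1) (is_derive_id s 1).
by rewrite mul1r mulr1 -mulr2n mulr_natl.
Qed.

Lemma ln_le_sub1 x : 0 < x -> ln x <= x - 1.
Proof.
move=> x0; have E : x = 1 + (x - 1) by ring.
by rewrite {1}E; apply: le_ln1Dx; lra.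
Qed.

Lemma normr_ln_le x : 0 < x -> x <= 1 -> `|x * ln x| <= 1.
Proof.
move=> x0 x1; rewrite normrM gtr0_norm // ler0_norm ?ln_le0 //.
have xV : 0 < x^-1 by rewrite invr_gt0.
have := ln_le_sub1 xV; rewrite lnV ?posrE // => H.
by rewrite -ler_pdivlMl // mulr1; lra.
Qed.

Definition sqln x := x ^+ 2 * ln (x ^+ 2).

Lemma is_derive_sqln s : is_derive s 1 sqln (2 * s * ln (s ^+ 2) + 2 * s).
Proof.
have [->|s0] := eqVneq s 0.
  apply: is_derive_of_eps => e e0.
  exists (Num.min 1 ((e / 4) ^+ 2)); first by rewrite lt_min ltr01 exprn_gt0 // divr_gt0.
  move=> h; rewrite le_min => /andP[h1 h2].
  rewrite add0r /sqln expr0n /= mulr0 !mul0r add0r mulr0 !subr0.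
  have [->|h0] := eqVneq h 0; first by rewrite expr0n /= mul0r normr0 mulr0.
  have nh : 0 < `|h| by rewrite normr_gt0.
  (* With [|h| = r ^ 2] the increment is [4 r * (r ln r) * r ^ 2]. Since [|r ln r| <= 1], it is at
     most [4 r * |h|], and the radius [(e / 4) ^ 2] gives [4 r <= e]. *)
  pose r := Num.sqrt `|h|.
  have r0 : 0 < r by rewrite sqrtr_gt0.
  have hr : `|h| = r ^+ 2 by rewrite sqr_sqrtr.
  have r1 : r <= 1 by rewrite -sqrtr1 ler_sqrt.
  have re : r <= e / 4.
    by rewrite -(@ler_pXn2r _ 2) ?nnegrE ?(ltW r0) ?divr_ge0 ?(ltW e0) // -hr.
  rewrite -(real_normK (num_real h)) hr -exprM lnXn ?posrE //.
  have -> : r ^+ 4 * (ln r *+ 4) = (4 * r) * (r * ln r) * r ^+ 2 by rewrite -mulr_natl; ring.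
  rewrite normrM (ger0_norm (exprn_ge0 2 (ltW r0))) ler_wpM2r ?exprn_ge0 ?(ltW r0) //.
  rewrite normrM ger0_norm ?mulr_ge0 ?(ltW r0) //.
  have := normr_ln_le r0 r1; have := normr_ge0 (r * ln r).
  by nra.
have s20 : 0 < s ^+ 2 by rewrite exprn_even_gt0.
rewrite /sqln; have dl := is_derive1_ln s20.
have dX := is_derive_sqr s.
have dc : is_derive s 1 (fun x => ln (x ^+ 2)) ((s ^+ 2)^-1 * (2 * s)) :=
  @is_derive1_comp _ (@ln R) (fun x => x ^+ 2) s _ _ dl dX.
have -> : 2 * s * ln (s ^+ 2) + 2 * s =
    2 * s * ln (s ^+ 2) + s ^+ 2 * ((s ^+ 2)^-1 * (2 * s)) by field.
exact: is_deriveMf.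
Qed.

Lemma powRB2 q x : 0 <= x -> 1 < q -> x `^ (q - 2) * x = x `^ (q - 1).
Proof.
move=> x0 q1; rewrite -(@mulr_powRB1 _ x (q - 1)) ?subr_gt0 // mulrC.
by congr (_ * _ `^ _); ring.
Qed.

(** The midpoint is at most the larger of the two numbers. *)
Lemma powR_midpoint_le q x y : 0 < q -> 0 <= x -> 0 <= y ->
  ((x + y) / 2) `^ q <= x `^ q + y `^ q.
Proof.
move=> q0 x0 y0.
have mono (z s : R) : 0 <= z -> z <= s -> z `^ q <= s `^ q.
  by move=> z0 zs; rewrite ge0_ler_powR ?nnegrE ?(ltW q0) // (le_trans z0).
have xy0 : 0 <= (x + y) / 2 by lra.
have [xy|/ltW xy] := leP x y.
  apply: (@le_trans _ _ (y `^ q)); last by rewrite lerDr powR_ge0.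
  by apply: mono => //; lra.
apply: (@le_trans _ _ (x `^ q)); last by rewrite lerDl powR_ge0.
by apply: mono => //; lra.
Qed.

Lemma powR_div q x t : 0 <= x -> 0 < t -> (x / t) `^ q = x `^ q / t `^ q.
Proof.
move=> x0 t0; rewrite powRM ?invr_ge0 ?(ltW t0) //; congr (_ * _).
by rewrite -powR_inv1 ?(ltW t0) // -powRrM mulN1r powRN.
Qed.

Lemma normr_powR_lipschitz q M x y : 1 < q -> `|x| <= M -> `|y| <= M ->
  `| `|x| `^ q - `|y| `^ q | <= q * M `^ (q - 1) * `|x - y|.
Proof.
move=> q1; have q0 : 0 < q := lt_trans ltr01 q1.
apply: (@lipschitz_of_derive (fun x => `|x| `^ q) (fun s => q * `|s| `^ (q - 2) * s)).
  by move=> z; exact: is_derive_normr_powR.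
move=> z zM; rewrite !normrM (ger0_norm (powR_ge0 _ _)) (gtr0_norm q0) -mulrA powRB2 //.
rewrite ler_wpM2l ?(ltW q0) // ge0_ler_powR ?nnegrE //; first by rewrite subr_ge0 ltW.
exact: le_trans zM.
Qed.

(** What the integrals of [|u| ^ (p - 2) g(v)] ask of [g]: differences are controlled on bounded
    sets, and [g 0 = 0] turns this into the linear bound [|g s| <= L |s|]. *)
Definition locally_lipschitz g := g 0 = 0 /\ forall M, exists2 L, 0 <= L &
  forall x y, `|x| <= M -> `|y| <= M -> `|g x - g y| <= L * `|x - y|.

Lemma locally_lipschitz_sqr : locally_lipschitz (fun x => x ^+ 2).
Proof.
split; first by rewrite expr0n.
move=> M; exists (2 * `|M|) => [|x y xM yM]; first by rewrite mulr_ge0.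
apply: (@lipschitz_of_derive (fun x => x ^+ 2) (fun x => 2 * x) M) => //.
  exact: is_derive_sqr.
move=> z zM; rewrite normrM ger0_norm // ler_wpM2l //.
exact: le_trans (ler_norm _).
Qed.

Lemma locally_lipschitz_sqln : locally_lipschitz sqln.
Proof.
split; first by rewrite /sqln expr0n /= mul0r.
(* The derivative is [4 z ln |z| + 2 z]; here [|z ln |z||] is at most 1 if [|z| <= 1] and at most
   [z ^ 2] otherwise. *)
move=> M; exists (4 + 4 * M ^+ 2 + 2 * `|M|) => [|x y xM yM].
  by have := sqr_ge0 M; have := normr_ge0 M; lra.
apply: (@lipschitz_of_derive sqln (fun s => 2 * s * ln (s ^+ 2) + 2 * s) M) => //; first exact: is_derive_sqln.
move=> z zM; apply: (le_trans (ler_normD _ _)); apply: lerD; last first.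
  by rewrite normrM ger0_norm // ler_wpM2l //; exact: le_trans (ler_norm _).
have [->|z0] := eqVneq z 0; first by rewrite mulr0 mul0r normr0; have := sqr_ge0 M; lra.
have nz : 0 < `|z| by rewrite normr_gt0.
rewrite -(real_normK (num_real z)) lnXn ?posrE // !normrM ger0_norm // normrMn.
have -> : 2 * `|z| * (`|ln `|z| | *+ 2) = 4 * `| `|z| * ln `|z| |.
  by rewrite normrM normr_id -mulr_natl; ring.
have M2 := sqr_ge0 M.
case: (leP `|z| 1) => z1; first by have := normr_ln_le nz z1; lra.
rewrite normrM normr_id (ger0_norm (ln_ge0 (ltW z1))).
have := ln_le_sub1 nz; have := ln_ge0 (ltW z1); nra.
Qed.

(* Split according to whether [Y <= X / k] or not. *)
Lemma young_powR p k t X Y : 1 < p -> 0 < k -> 0 <= t -> t <= k -> 0 <= X -> 0 <= Y ->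
  (X + t * Y) `^ (p - 1) * Y <=
  2 `^ (p - 1) / k * X `^ p + (2 * k) `^ (p - 1) * Y `^ p.
Proof.
move=> p1 k0 t0 tk X0 Y0; have p0 : 0 < p := lt_trans ltr01 p1.
have p10 : 0 <= p - 1 by rewrite subr_ge0 ltW.
have pM Z W r : 0 <= Z -> Z <= W -> Z `^ (p - 1) <= W `^ (p - 1).
  by move=> Z0 ZW; rewrite ge0_ler_powR ?nnegrE // (le_trans Z0).
have P1 : 0 <= 2 `^ (p - 1) / k * X `^ p by rewrite !mulr_ge0 ?powR_ge0 // invr_ge0 ltW.
have P2 : 0 <= (2 * k) `^ (p - 1) * Y `^ p by rewrite mulr_ge0 ?powR_ge0.
have XY0 : 0 <= X + t * Y by rewrite addr_ge0 ?mulr_ge0.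
have [YX|YX] := leP (k * Y) X.
  apply: le_trans (_ : _ <= 2 `^ (p - 1) / k * X `^ p) _; last by rewrite lerDl.
  have H : (X + t * Y) `^ (p - 1) <= (2 * X) `^ (p - 1).
    by apply: pM => //; rewrite mulr_natl mulr2n lerD2l; apply: le_trans YX; rewrite ler_wpM2r.
  have Yk : Y <= X / k by rewrite ler_pdivlMr // mulrC.
  apply: (le_trans (ler_pM (powR_ge0 _ _) Y0 H Yk)).
  rewrite powRM // -(mulr_powRB1 X0 p0) le_eqVlt; apply/orP; left; apply/eqP; ring.
apply: le_trans (_ : _ <= (2 * k) `^ (p - 1) * Y `^ p) _; last by rewrite lerDr.
have H : (X + t * Y) `^ (p - 1) <= (2 * k * Y) `^ (p - 1).
  apply: pM => //; rewrite -mulrA mulr_natl mulr2n lerD ?(ltW YX) //.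
  by rewrite ler_wpM2r.
apply: (le_trans (ler_wpM2r Y0 H)).
rewrite powRM ?mulr_ge0 ?(ltW k0) // -(mulr_powRB1 Y0 p0) le_eqVlt.
by apply/orP; left; apply/eqP; ring.
Qed.

(** If [M >= 1 / (n c)], one factor [n c M >= 1] can be inserted. Otherwise
    [M ^ (p - 1) <= (n c) ^ (1 - p)], where one factor [1 / c] is kept for summability and the
    remaining [c ^ (2 - p)] is bounded by [c0 ^ (2 - p)] since [p > 2]. *)
Lemma powR_absorb p c0 n c M : 2 < p -> 0 < c0 -> c0 <= c -> 0 < n -> 0 <= M ->
  M `^ (p - 1) <= n * (c * M `^ p) + n `^ (1 - p) * c0 `^ (2 - p) * c^-1.
Proof.
move=> p2 c00 cc n0 M0; have c_gt0 : 0 < c := lt_le_trans c00 cc.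
have p0 : 0 < p by lra.
have nc : 0 < n * c by rewrite mulr_gt0.
have P1 : 0 <= n * (c * M `^ p) by rewrite !mulr_ge0 ?powR_ge0 // ltW.
have P2 : 0 <= n `^ (1 - p) * c0 `^ (2 - p) * c^-1.
  by rewrite !mulr_ge0 ?powR_ge0 // invr_ge0 ltW.
have [h|h] := leP (n * c)^-1 M.
  apply: le_trans (_ : _ <= n * (c * M `^ p)) _; last by rewrite lerDl.
  rewrite -(mulr_powRB1 M0 p0) !mulrA ler_peMl ?powR_ge0 //.
  by rewrite -(mulVf (lt0r_neq0 nc)) mulrC ler_wpM2l // ltW.
apply: le_trans (_ : _ <= n `^ (1 - p) * c0 `^ (2 - p) * c^-1) _; last by rewrite lerDr.
apply: le_trans (_ : _ <= (n * c)^-1 `^ (p - 1)) _.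
  by rewrite ge0_ler_powR ?nnegrE ?invr_ge0 ?(ltW h) ?(ltW nc) //; lra.
have -> : (n * c)^-1 `^ (p - 1) = n `^ (1 - p) * (c `^ (2 - p) * c^-1).
  rewrite -powR_inv1 ?(ltW nc) // -powRrM mulN1r opprB powRM ?(ltW n0) ?(ltW c_gt0) //.
  rewrite -powR_inv1 ?(ltW c_gt0) // -powRD; last by rewrite implybE (gt_eqF c_gt0) orbT.
  by congr (_ * _ `^ _); ring.
rewrite -mulrA ler_wpM2l ?powR_ge0 // ler_wpM2r ?invr_ge0 ?(ltW c_gt0) //.
have -> : 2 - p = - (p - 2) by ring.
rewrite !powRN lef_pV2 ?posrE ?powR_gt0 //.
by rewrite ge0_ler_powR ?nnegrE ?(ltW c00) ?(ltW c_gt0) //; lra.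
Qed.
End ScalarCalculus.

(** * Unconditional sums *)

Section HasSum.
Context {R : realType} {V : choiceType}.
Implicit Types (c : V -> R) (A B T : {fset V}) (s e M : R).

(** Convergence along the net of finite subsets, with real values: unlike [\esum] it is meaningful
    for signed families and linear without side conditions. *)
Definition has_sum c s : Prop := forall e, 0 < e ->
  exists A, forall B, (A `<=` B)%fset -> `|\sum_(x <- B) c x - s| <= e.

Lemma has_sum_unique c s s' : has_sum c s -> has_sum c s' -> s = s'.
Proof.
move=> cs cs'; apply/eqP; rewrite -subr_eq0 -normr_le0.
apply/ler_addgt0Pr => e e0; rewrite add0r.
have e20 : 0 < e / 2 by rewrite divr_gt0.
have [A As] := cs _ e20; have [A' As'] := cs' _ e20.
have h1 := As _ (fsubsetUl A A'); have h2 := As' _ (fsubsetUr A A').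
rewrite distrC in h1; apply: le_trans (ler_distD _ _ _) _.
by apply: (le_trans (lerD h1 h2)); rewrite -splitr.
Qed.

Lemma has_sumD c c' s s' : has_sum c s -> has_sum c' s' ->
  has_sum (fun x => c x + c' x) (s + s').
Proof.
move=> cs cs' e e0; have e20 : 0 < e / 2 by rewrite divr_gt0.
have [A As] := cs _ e20; have [A' As'] := cs' _ e20.
exists (A `|` A')%fset => B AB.
have h1 := As _ (fsubset_trans (fsubsetUl A A') AB).
have h2 := As' _ (fsubset_trans (fsubsetUr A A') AB).
rewrite big_split /= opprD addrACA (splitr e).
exact: le_trans (ler_normD _ _) (lerD h1 h2).
Qed.

Lemma has_sumZ c s k : has_sum c s -> has_sum (fun x => k * c x) (k * s).
Proof.
move=> cs e e0; have k0 : 0 < `|k| + 1 by rewrite ltr_wpDl.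
have [|A As] := cs (e / (`|k| + 1)); first by rewrite divr_gt0.
exists A => B /As h; rewrite -mulr_sumr -mulrBr normrM.
apply: (@le_trans _ _ ((`|k| + 1) * (e / (`|k| + 1)))).
  by rewrite ler_pM // lerDl.
by rewrite mulrC divfK // gt_eqF.
Qed.

Lemma eq_has_sum c c' s : c =1 c' -> has_sum c s -> has_sum c' s.
Proof. by move=> /funext ->. Qed.

Lemma has_sumN c s : has_sum c s -> has_sum (fun x => - c x) (- s).
Proof.
by move=> /(has_sumZ (-1)); rewrite mulN1r; apply: eq_has_sum => x; rewrite mulN1r.
Qed.

Lemma has_sumB c c' s s' : has_sum c s -> has_sum c' s' ->
  has_sum (fun x => c x - c' x) (s - s').
Proof. by move=> cs /has_sumN; exact: has_sumD. Qed.

Lemma has_sum_finite c A : (forall x, x \notin A -> c x = 0) ->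
  has_sum c (\sum_(x <- A) c x).
Proof.
move=> cA e e0; exists A => B AB.
rewrite -(big_fset_incl _ AB) ?subrr ?normr0 ?ltW // => x _ xA.
by rewrite cA.
Qed.

Lemma has_sum_ge0 c s : (forall x, 0 <= c x) -> has_sum c s -> 0 <= s.
Proof.
move=> c0 cs; apply/ler_addgt0Pr => e e0; have [A /(_ A)] := cs _ e0.
rewrite fsubset_refl => /(_ isT); rewrite ler_norml => /andP[_].
rewrite lerBlDl; apply: le_trans; exact: sumr_ge0.
Qed.

Lemma has_sum_le c c' s s' : (forall x, c x <= c' x) ->
  has_sum c s -> has_sum c' s' -> s <= s'.
Proof.
move=> cc' cs cs'; rewrite -subr_ge0.
by apply: (has_sum_ge0 _ (has_sumB cs' cs)) => x; rewrite subr_ge0.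
Qed.

Lemma ler_sum_fset c c' A : (forall x, c x <= c' x) ->
  \sum_(x <- A) c x <= \sum_(x <- A) c' x.
Proof. by move=> cc'; apply: ler_sum => x _. Qed.

Lemma sum_fsetD c A B : (A `<=` B)%fset ->
  \sum_(x <- B) c x = \sum_(x <- A) c x + \sum_(x <- (B `\` A)%fset) c x.
Proof.
move=> AB; rewrite (big_fsetID _ (mem A) B) /=; congr (_ + _); apply: eq_fbigl => x.
  rewrite !inE /= andbC; case: (boolP (x \in A)) => //= xA.
  by rewrite (fsubsetP AB).
by rewrite !inE /= andbC.
Qed.

Lemma fdisjoint_sub_setD A B : [disjoint (B `\` A) & A]%fset.
Proof. by apply/fdisjointP => x; rewrite inE => /andP[]. Qed.

Lemma ler_sum_subset c A B : (forall x, 0 <= c x) -> (A `<=` B)%fset ->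
  \sum_(x <- A) c x <= \sum_(x <- B) c x.
Proof. by move=> c0 /sum_fsetD ->; rewrite lerDl sumr_ge0. Qed.

Lemma ler_fset_has_sum c s A : (forall x, 0 <= c x) -> has_sum c s ->
  \sum_(x <- A) c x <= s.
Proof.
move=> c0 cs; apply/ler_addgt0Pr => e e0; have [B Bs] := cs _ e0.
apply: (le_trans (ler_sum_subset c0 (fsubsetUl A B))).
have := Bs _ (fsubsetUr A B); rewrite ler_norml => /andP[_].
by rewrite lerBlDl addrC.
Qed.

Lemma bounded_has_sum c M : (forall x, 0 <= c x) ->
  (forall A, \sum_(x <- A) c x <= M) -> exists2 s, has_sum c s & s <= M.
Proof.
move=> c0 cM; pose E : set R := [set \sum_(x <- A) c x | A in [set: {fset V}]].
have E0 : E !=set0 by exists (\sum_(x <- fset0) c x), fset0.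
have EM : ubound E M by move=> _ [A _ <-].
have Es : has_sup E by split => //; exists M.
exists (sup E); last exact: ge_sup.
move=> e e0; have [_ [A _ <-] Ae] := sup_adherent e0 Es.
exists A => B AB; rewrite distrC ger0_norm.
  by have := ler_sum_subset c0 AB; lra.
by rewrite subr_ge0; apply: ub_le_sup; [exists M|exists B].
Qed.

(** The family [c' + c] is nonnegative with partial sums at most twice those of [c']; subtract [c']
    again. *)
Lemma dominated_has_sum c c' s' : (forall x, `|c x| <= c' x) -> has_sum c' s' ->
  exists s, has_sum c s.
Proof.
move=> cc' cs'; pose d x := c' x + c x.
have d0 x : 0 <= d x by have := cc' x; rewrite ler_norml /d => /andP[]; lra.
have [|s ds _] := @bounded_has_sum d (2 * s') d0.
  move=> A; have c'0 x : 0 <= c' x := le_trans (normr_ge0 _) (cc' x).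
  apply: (@le_trans _ _ (2 * \sum_(x <- A) c' x)); last first.
    by rewrite ler_pM2l // ler_fset_has_sum.
  rewrite mulr_sumr; apply: ler_sum_fset => x.
  by have := cc' x; rewrite ler_norml /d => /andP[]; lra.
exists (s - s'); apply: eq_has_sum (has_sumB ds cs') => x; rewrite /d; lra.
Qed.

(** The Cauchy criterion: the sums over [A] and over [A] joined with [T] are both within [e / 2] of
    [s]. *)
Lemma has_sum_tail c s e : has_sum c s -> 0 < e ->
  exists A, forall T, [disjoint T & A]%fset -> `|\sum_(x <- T) c x| <= e.
Proof.
move=> cs e0; have e20 : 0 < e / 2 by rewrite divr_gt0.
have [A As] := cs _ e20; exists A => T TA.
have h1 := As _ (fsubset_refl A); have h2 := As _ (fsubsetUl A T).
rewrite (sum_fsetD c (fsubsetUl A T)) in h2.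
have E : ((A `|` T) `\` A = T)%fset.
  apply/fsetP => x; rewrite !inE; have [xT|] := boolP (x \in T).
    by rewrite orbT andbT; exact: (fdisjointP TA).
  by case: (x \in A).
rewrite E in h2.
rewrite distrC in h1; have := le_trans (ler_normD _ _) (lerD h1 h2).
by rewrite -splitr; congr (`|_| <= _); lra.
Qed.

Lemma has_sum_approx c s A e : has_sum c s ->
  (forall T, [disjoint T & A]%fset -> `|\sum_(x <- T) c x| <= e) ->
  `|s - \sum_(x <- A) c x| <= e.
Proof.
move=> cs Te; apply/ler_addgt0Pr => d d0; have [B Bs] := cs _ d0.
have h1 := Bs _ (fsubsetUr A B); rewrite distrC in h1.
have h2 := Te _ (fdisjoint_sub_setD A (A `|` B)%fset).
rewrite (sum_fsetD c (fsubsetUl A B)) in h1.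
have := le_trans (ler_normD _ _) (lerD h1 h2).
by rewrite (addrC d e); congr (`|_| <= _); lra.
Qed.

Lemma esum_has_sum c s : (forall x, 0 <= c x) -> has_sum c s ->
  \esum_(x in [set: V]) (c x)%:E = s%:E.
Proof.
move=> c0 cs; apply/eqP; rewrite eq_le; apply/andP; split.
  apply: ge_ereal_sup => _ [F [Ff _] <-].
  rewrite fsumEFin // lee_fin fsbig_finite //=; exact: ler_fset_has_sum.
apply/lee_addgt0Pr => e e0; have [A /(_ _ (fsubset_refl _)) As] := cs _ e0.
apply: (@le_trans _ _ ((\sum_(x <- A) c x)%:E + e%:E)%E).
  by rewrite -EFinD lee_fin; move: As; rewrite ler_norml => /andP[]; lra.
rewrite leeD2r //; apply: ereal_sup_ubound; exists [set` A]; first by split.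
by rewrite fsumEFin ?finite_fset //; congr EFin; rewrite fsbig_finite //= set_fsetK.
Qed.

Lemma has_sum_esum c : (forall x, 0 <= c x) ->
  (\esum_(x in [set: V]) (c x)%:E < +oo)%E ->
  has_sum c (fine (\esum_(x in [set: V]) (c x)%:E)).
Proof.
move=> c0 coo.
have c00 : (0 <= \esum_(x in [set: V]) (c x)%:E)%E.
  by apply: esum_ge0 => x _; rewrite lee_fin.
have [|s cs _] := @bounded_has_sum c (fine (\esum_(x in [set: V]) (c x)%:E)) c0.
  move=> A; rewrite -lee_fin fineK ?ge0_fin_numE //.
  apply: ereal_sup_ubound; exists [set` A]; first by split.
  by rewrite fsumEFin ?finite_fset //; congr EFin; rewrite fsbig_finite //= set_fsetK.
by rewrite (esum_has_sum c0 cs).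
Qed.

End HasSum.

(** Domination makes both halves of [gint] finite, so that [fine] returns the true difference and
    not a default value. *)
Lemma gint_has_sum (R : realType) (V : choiceType) (G : weighted_graph R V)
    (f c : V -> R) (s : R) :
  (forall x, `|f x * mu G x| <= c x) -> has_sum c s ->
  has_sum (fun x => f x * mu G x) (gint G f).
Proof.
move=> fc cs; set g := fun x => f x * mu G x.
have [|sp hp] := @dominated_has_sum _ _ (fun x => Num.max (g x) 0) c s _ cs.
  move=> x; apply: le_trans (fc x); rewrite -/(g x).
  by case: (leP (g x) 0) => [|/ltW] h; rewrite ?normr0.
have [|sn hn] := @dominated_has_sum _ _ (fun x => Num.max (- g x) 0) c s _ cs.
  move=> x; apply: le_trans (fc x); rewrite -/(g x) -(normrN (g x)).
  by case: (leP (- g x) 0) => [|/ltW] h; rewrite ?normr0.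
have -> : gint G f = sp - sn.
  rewrite /gint -[sp - sn]/(fine (sp%:E - sn%:E)%E); congr fine; congr (_ - _)%E.
    rewrite -(esum_has_sum _ hp); last by move=> x; rewrite le_max lexx orbT.
    by apply: eq_esum => x _; rewrite funeposE EFin_max.
  rewrite -(esum_has_sum _ hn); last by move=> x; rewrite le_max lexx orbT.
  by apply: eq_esum => x _; rewrite funenegE EFin_max EFinN.
apply: eq_has_sum (has_sumB hp hn) => x /=.
case: (leP (g x) 0) => h; case: (leP (- g x) 0) => h' //=; rewrite -/(g x); lra.
Qed.

(** * The Dirichlet energy *)

Section Energy.
Context {R : realType} {V : choiceType} (G : weighted_graph R V).
Variables (p : R) (p1 : 1 < p).
Implicit Types (u v h : V -> R) (x y : V) (w : V -> R).

Let p0 : 0 < p. Proof. exact: lt_trans p1. Qed.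

Definition density w u x := grad G u x `^ p + w x * `|u x| `^ p.

Definition finite_energy w u : Prop := (modular G p w u < +oo)%E.

Definition total w u : R := fine (modular G p w u).

Lemma grad_dist u h x : `|grad G (u + h) x - grad G u x| <= grad G h x.
Proof.
rewrite ler_norml; apply/andP; split; last by rewrite lerBlDl gradD.
have := gradD G x (u + h) ((-1) *: h).
by rewrite gradZ normrN1 mul1r scaleN1r addrK; lra.
Qed.

Section Weight.
Variables (w : V -> R) (w0 : forall x, 0 <= w x).

Lemma density_ge0 u x : 0 <= density w u x.
Proof. exact: modularE_ge0. Qed.

Lemma density_mu_ge0 u x : 0 <= density w u x * mu G x.
Proof. by rewrite mulr_ge0 ?density_ge0 ?ltW ?mu_gt0. Qed.

Lemma total_has_sum u : finite_energy w u ->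
  has_sum (fun x => density w u x * mu G x) (total w u).
Proof. exact: has_sum_esum (density_mu_ge0 u). Qed.

Lemma finite_energy_has_sum u s : has_sum (fun x => density w u x * mu G x) s ->
  finite_energy w u.
Proof.
move=> /(esum_has_sum (density_mu_ge0 u)) E.
by rewrite /finite_energy /modular /nnint E ltry.
Qed.

(** Serves as Fatou's lemma: bounds on finite sums survive pointwise limits. *)
Lemma finite_energy_bounded u M : (forall A : {fset V}, \sum_(x <- A) density w u x * mu G x <= M) ->
  finite_energy w u /\ total w u <= M.
Proof.
move=> /(bounded_has_sum (density_mu_ge0 u))[s us sM].
have uf := finite_energy_has_sum us; split => //.
by rewrite (has_sum_unique (total_has_sum uf) us).
Qed.

Lemma ler_sum_total u (A : {fset V}) : finite_energy w u ->
  \sum_(x <- A) density w u x * mu G x <= total w u.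
Proof. by move=> /total_has_sum; apply: ler_fset_has_sum; exact: density_mu_ge0. Qed.

Lemma total_ge0 u : 0 <= total w u.
Proof. by apply: fine_ge0; apply: modular_ge0. Qed.

Lemma densityZ k u x : density w (k *: u) x = `|k| `^ p * density w u x.
Proof.
rewrite /density gradZ powRM ?normr_ge0 ?grad_ge0 //.
by rewrite fctE /GRing.scale /= normrM powRM ?normr_ge0 // mulrDr mulrCA.
Qed.

Lemma finite_energyZ k u : finite_energy w u -> finite_energy w (k *: u).
Proof.
move=> /total_has_sum /(has_sumZ (`|k| `^ p)) us; apply: (@finite_energy_has_sum _ (`|k| `^ p * total w u)).
by apply: eq_has_sum us => x; rewrite densityZ mulrA.
Qed.

Lemma totalZ k u : finite_energy w u -> total w (k *: u) = `|k| `^ p * total w u.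
Proof.
move=> uf; have us := has_sumZ (`|k| `^ p) (total_has_sum uf).
apply: has_sum_unique (total_has_sum (finite_energyZ k uf)) _.
by apply: eq_has_sum us => x; rewrite densityZ mulrA.
Qed.

(** The mean value bound [p (X + Y) ^ (p - 1) Y] with [Y = t (Y / t)], split by [young_powR]. A
    small [k] makes the coefficient of the normalised density of [h] small; the density of [u] then
    gets a large coefficient, harmless where its tail is small. *)
Lemma density_dist u h x t k : 0 < k -> 0 < t -> t <= k ->
  `|density w (u + h) x - density w u x| <=
  p * t * (2 `^ (p - 1) / k * density w u x + (2 * k) `^ (p - 1) * (density w h x / t `^ p)).
Proof.
move=> k0 t0 tk.
have key (X Y Z : R) : 0 <= X -> 0 <= Y -> 0 <= Z -> `|Z - X| <= Y ->
  `|Z `^ p - X `^ p| <= p * t * (2 `^ (p - 1) / k * X `^ p + (2 * k) `^ (p - 1) * (Y `^ p / t `^ p)).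
  move=> X0 Y0 Z0 ZX; have Yt : Y = t * (Y / t) by rewrite mulrC divfK // gt_eqF.
  have Yt0 : 0 <= Y / t by rewrite divr_ge0 // ltW.
  rewrite -powR_div //.
  have ZXY : Z <= X + Y by move: ZX; rewrite ler_norml => /andP[]; lra.
  have := @normr_powR_lipschitz _ p (X + Y) Z X p1.
  rewrite (ger0_norm Z0) (ger0_norm X0) => /(_ ZXY); rewrite lerDl => /(_ Y0)/le_trans; apply.
  apply: (@le_trans _ _ (p * (X + Y) `^ (p - 1) * Y)).
    by rewrite ler_wpM2l // mulr_ge0 ?powR_ge0 ?(ltW p0).
  rewrite {1 2}Yt (_ : _ * _ * (t * _) = p * t * ((X + t * (Y / t)) `^ (p - 1) * (Y / t))).
    by rewrite ler_wpM2l ?mulr_ge0 ?(ltW p0) ?(ltW t0) // young_powR // ltW.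
  by ring.
have h1 := key _ _ _ (grad_ge0 G x u) (grad_ge0 G x h) (grad_ge0 G x (u + h)) (grad_dist u h x).
have h2 := key `|u x| `|h x| `|(u + h) x| (normr_ge0 _) (normr_ge0 _) (normr_ge0 _).
have {}h2 := ler_wpM2l (w0 x) (h2 _).
rewrite /density.
have -> (A B C D : R) : A + w x * B - (C + w x * D) = (A - C) + w x * (B - D) by ring.
apply: (le_trans (ler_normD _ _)); rewrite normrM (ger0_norm (w0 x)).
have -> (c1 c2 c3 A B C D E : R) : c1 * (c2 * (A + w x * B) + c3 * ((C + w x * D) / E)) =
  c1 * (c2 * A + c3 * (C / E)) + w x * (c1 * (c2 * B + c3 * (D / E))) by ring.
apply: lerD h1 (h2 _).
apply: le_trans (ler_dist_dist _ _) _.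
by rewrite fctE (addrC (u x)) addrK.
Qed.

Lemma total_tail u e : finite_energy w u -> 0 < e ->
  exists A : {fset V}, exists2 d, 0 < d & forall h t, finite_energy w h -> 0 < t ->
    t <= d -> total w h <= t `^ p -> forall T, [disjoint T & A]%fset ->
    `|\sum_(x <- T) (density w (u + h) x * mu G x - density w u x * mu G x)| <= e * t.
Proof.
move=> uf e0.
(* [k] is tuned so that the coefficient of the [h] part is [r], and [A] so that the [u] part is at
   most [r]; together [p * t * (r + r) = e * t]. *)
pose r := e / (2 * p); have r0 : 0 < r by rewrite divr_gt0 // mulr_gt0.
pose k := r `^ (p - 1)^-1 / 2; have k0 : 0 < k by rewrite divr_gt0 // powR_gt0.
have kr : (2 * k) `^ (p - 1) = r.
  rewrite /k mulrC divfK // -powRrM mulVf ?powRr1 ?(ltW r0) //.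
  by rewrite gt_eqF // subr_gt0.
pose C := 2 `^ (p - 1) / k; have C0 : 0 < C by rewrite divr_gt0 // powR_gt0.
have [|A AT] := has_sum_tail (total_has_sum uf) (e := r / C); first by rewrite divr_gt0.
exists A, k => // h t hf t0 tk ht T TA.
have tp : 0 < t `^ p by rewrite powR_gt0.
apply: (le_trans (ler_norm_sum _ _ _)).
apply: (@le_trans _ _ (p * t * (C * (\sum_(x <- T) density w u x * mu G x) +
    r * ((\sum_(x <- T) density w h x * mu G x) / t `^ p)))).
  rewrite mulr_suml !mulr_sumr -big_split /= mulr_sumr; apply: ler_sum => x _.
  rewrite -mulrBl normrM (gtr0_norm (mu_gt0 G x)).
  apply: (le_trans (ler_wpM2r (ltW (mu_gt0 G x)) (density_dist u h x k0 t0 tk))).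
  by rewrite kr -/C le_eqVlt; apply/orP; left; apply/eqP; ring.
have h1 : C * (\sum_(x <- T) density w u x * mu G x) <= r.
  by rewrite mulrC -ler_pdivlMr //; exact: le_trans (ler_norm _) (AT _ TA).
have h2 : r * ((\sum_(x <- T) density w h x * mu G x) / t `^ p) <= r.
  rewrite -[leRHS]mulr1 ler_wpM2l ?(ltW r0) // ler_pdivrMr // mul1r.
  exact: le_trans (ler_sum_total _ hf) ht.
apply: (le_trans (ler_wpM2l _ (lerD h1 h2))).
  by rewrite mulr_ge0 ?(ltW t0) ?(ltW p0).
by rewrite le_eqVlt; apply/orP; left; apply/eqP; rewrite /r; field; rewrite gt_eqF.
Qed.

End Weight.
End Energy.

(** * The coupling terms *)

Section Coupling.
Context {R : realType} {V : choiceType} (G : weighted_graph R V).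
Variables (p : R) (p4 : 4 < p).
Implicit Types (u v h k M : V -> R) (g : R -> R) (K e t : R) (A T : {fset V}).

Definition coupling g u v : R := gint G (fun x => `|u x| `^ (p - 2) * g (v x)).

Variables (c : V -> R) (c0 m0 S : R).
Hypotheses (c0_gt0 : 0 < c0) (c_ge : forall x, c0 <= c x).
Hypotheses (m0_gt0 : 0 < m0) (mu_ge : forall x, m0 <= mu G x).
Hypothesis inv_has_sum : has_sum (fun x => (c x)^-1 * mu G x) S.

Let p0 : 0 < p. Proof. by move: p4; lra. Qed.
Let c_gt0 x : 0 < c x. Proof. exact: lt_le_trans (c_ge x). Qed.
Let mu_ge0 x : 0 <= mu G x. Proof. exact/ltW/mu_gt0. Qed.
Let inv_ge0 x : 0 <= (c x)^-1 * mu G x.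
Proof. by rewrite mulr_ge0 ?invr_ge0 // ltW. Qed.

(** Bounding all finite sums needs no finiteness proof and passes to pointwise limits. Later [c] is
    the minimum of the two potentials, so that both components obey bounds in one weight. *)
Definition Lp_bounded K u := forall A, \sum_(x <- A) c x * `|u x| `^ p * mu G x <= K.

Lemma Lp_bounded_finite_energy w u K : (forall x, c x <= w x) ->
  finite_energy G p w u -> total G p w u <= K -> Lp_bounded K u.
Proof.
move=> cw uf uK A; apply: le_trans uK.
have w0 x : 0 <= w x := le_trans (ltW (c_gt0 x)) (cw x).
apply: le_trans (ler_sum_total w0 _ uf); apply: ler_sum => x _.
rewrite ler_wpM2r //; apply: (@le_trans _ _ (w x * `|u x| `^ p)).
  by rewrite ler_wpM2r ?powR_ge0.
by rewrite lerDr powR_ge0.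
Qed.

(** A single point already contributes at least [c0 * m0 * |u x| ^ p]: the lower bounds on potential
    and measure embed the space into bounded functions. *)
Lemma Lp_bounded_powR K u x : Lp_bounded K u -> `|u x| `^ p <= K / (c0 * m0).
Proof.
move=> /(_ [fset x]%fset); rewrite big_seq_fset1 => h.
have cm : 0 < c0 * m0 by rewrite mulr_gt0.
rewrite ler_pdivlMr //; apply: le_trans h; rewrite [leLHS]mulrC [leRHS]mulrAC.
by rewrite ler_wpM2r ?powR_ge0 // ler_pM // ltW.
Qed.

Lemma Lp_bounded_sup K u x : Lp_bounded K u -> `|u x| <= (K / (c0 * m0)) `^ p^-1.
Proof.
move=> /(Lp_bounded_powR x) h.
rewrite -[leLHS](@powRr1 _ `|u x|) // -(mulfV (lt0r_neq0 p0)) powRrM.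
rewrite ge0_ler_powR ?nnegrE ?powR_ge0 ?invr_ge0 ?(ltW p0) //.
exact: le_trans h.
Qed.

Lemma powRD_le (x y : R) : 0 <= x -> 0 <= y -> (x + y) `^ p <= 2 `^ p * (x `^ p + y `^ p).
Proof.
move=> x0 y0; have pM (z w : R) : 0 <= z -> z <= w -> z `^ p <= w `^ p.
  by move=> z0 zw; rewrite ge0_ler_powR ?nnegrE ?(ltW p0) // (le_trans z0).
have [xy|/ltW xy] := leP x y.
  apply: (@le_trans _ _ ((2 * y) `^ p)); first by apply: pM; [rewrite addr_ge0|lra].
  by rewrite powRM // ler_wpM2l ?powR_ge0 // lerDr powR_ge0.
apply: (@le_trans _ _ ((2 * x) `^ p)); first by apply: pM; [rewrite addr_ge0|lra].
by rewrite powRM // ler_wpM2l ?powR_ge0 // lerDl powR_ge0.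
Qed.

Lemma Lp_boundedD K K' u v : Lp_bounded K u -> Lp_bounded K' v ->
  Lp_bounded (2 `^ p * (K + K')) (fun x => `|u x| + `|v x|).
Proof.
move=> uK vK A.
apply: (@le_trans _ _ (2 `^ p * (\sum_(x <- A) c x * `|u x| `^ p * mu G x +
                                \sum_(x <- A) c x * `|v x| `^ p * mu G x))).
  rewrite -big_split mulr_sumr /=; apply: ler_sum => x _.
  rewrite -mulrDl -mulrDr mulrA ler_wpM2r // mulrCA ler_wpM2l ?(ltW (c_gt0 x)) //.
  by rewrite ger0_norm ?addr_ge0 // powRD_le.
by rewrite ler_wpM2l ?powR_ge0 // lerD.
Qed.

Lemma Lp_boundedZ t h : 0 < t -> Lp_bounded (t `^ p) h -> Lp_bounded 1 (fun x => h x / t).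
Proof.
move=> t0 hK A; have tp : 0 < t `^ p by rewrite powR_gt0.
rewrite -(ler_pM2l tp) mulr1; apply: le_trans (hK A); rewrite mulr_sumr.
apply: ler_sum => x _; rewrite normrM normfV (gtr0_norm t0) powR_div //.
by rewrite le_eqVlt; apply/orP; left; apply/eqP; field; rewrite gt_eqF.
Qed.

(** [powR_absorb] summed over [A], with [n] so small that [n K <= e]. The constant [C] does not
    depend on [M], which is the point. *)
Lemma Lp_bounded_subcritical K e : 0 < e ->
  exists2 C, 0 <= C & forall M A, (forall x, 0 <= M x) -> Lp_bounded K M ->
  \sum_(x <- A) M x `^ (p - 1) * mu G x <= e + C * \sum_(x <- A) (c x)^-1 * mu G x.
Proof.
move=> e0; pose n := e / (`|K| + 1).
have n0 : 0 < n by rewrite divr_gt0 // ltr_wpDl.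
exists (n `^ (1 - p) * c0 `^ (2 - p)); first by rewrite mulr_ge0 ?powR_ge0.
move=> M A M0 MK.
apply: (@le_trans _ _ (n * \sum_(x <- A) c x * `|M x| `^ p * mu G x +
   n `^ (1 - p) * c0 `^ (2 - p) * \sum_(x <- A) (c x)^-1 * mu G x)).
  rewrite !mulr_sumr -big_split /=; apply: ler_sum => x _.
  rewrite mulrA (mulrA (_ * _) _ (mu G x)) -mulrDl ler_wpM2r // (ger0_norm (M0 x)).
  by apply: powR_absorb => //; move: p4; lra.
rewrite lerD2r; apply: (@le_trans _ _ (n * (`|K| + 1))).
  rewrite ler_wpM2l ?(ltW n0) //; apply: (le_trans (MK A)).
  by apply: (le_trans (ler_norm K)); rewrite lerDl.
by rewrite /n divfK // gt_eqF // ltr_wpDl.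
Qed.

(** Equi-integrability on bounded sets: one [A], dictated by the tail of [1 / c], serves all [M]. *)
Lemma Lp_bounded_subcritical_tail K e : 0 < e ->
  exists A, forall M T, (forall x, 0 <= M x) -> Lp_bounded K M -> [disjoint T & A]%fset ->
  \sum_(x <- T) M x `^ (p - 1) * mu G x <= e.
Proof.
move=> e0; have e20 : 0 < e / 2 by rewrite divr_gt0.
have [C C0 CM] := Lp_bounded_subcritical K e20.
have C1 : 0 < C + 1 by rewrite ltr_wpDl.
have [|A AT] := has_sum_tail inv_has_sum (e := e / 2 / (C + 1)); first by rewrite divr_gt0.
exists A => M T M0 MK TA; rewrite [leRHS]splitr; apply: (le_trans (CM _ T M0 MK)).
rewrite lerD2l; apply: (@le_trans _ _ ((C + 1) * \sum_(x <- T) (c x)^-1 * mu G x)).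
  by rewrite ler_wpM2r ?lerDl // sumr_ge0.
by rewrite mulrC -ler_pdivlMr //; exact: le_trans (ler_norm _) (AT _ TA).
Qed.

Section Lipschitz.
Variables (g : R -> R) (gL : locally_lipschitz g).

(** On the range allowed by the sup bound [g] grows at most linearly, so the term has total degree
    [p - 1]. *)
Lemma coupling_term_bound K : exists2 L, 0 <= L & forall u v x,
  Lp_bounded K v -> `| `|u x| `^ (p - 2) * g (v x)| <= L * (`|u x| + `|v x|) `^ (p - 1).
Proof.
have [g0 /(_ ((K / (c0 * m0)) `^ p^-1))[L L0 gLK]] := gL.
exists L => // u v x vK; have vx := Lp_bounded_sup x vK.
have := gLK (v x) 0 vx; rewrite normr0 powR_ge0 => /(_ isT); rewrite g0 !subr0 => gv.
rewrite normrM (ger0_norm (powR_ge0 _ _)).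
have uv0 : 0 <= `|u x| + `|v x| by rewrite addr_ge0.
rewrite -powRB2 //; last by move: p4; lra.
rewrite mulrCA; apply: ler_pM; rewrite ?powR_ge0 //.
  by rewrite ge0_ler_powR ?nnegrE ?lerDl //; move: p4; lra.
by apply: (le_trans gv); rewrite ler_wpM2l // lerDr.
Qed.

Lemma coupling_tail K e : 0 < e -> exists A, forall u v T,
  Lp_bounded K u -> Lp_bounded K v -> [disjoint T & A]%fset ->
  `|\sum_(x <- T) `|u x| `^ (p - 2) * g (v x) * mu G x| <= e.
Proof.
move=> e0; have [L L0 LK] := coupling_term_bound K.
have L1 : 0 < L + 1 by rewrite ltr_wpDl.
have [|A AM] := Lp_bounded_subcritical_tail (2 `^ p * (K + K)) (e := e / (L + 1)).
  by rewrite divr_gt0.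
exists A => u v T uK vK TA.
have M0 x : 0 <= `|u x| + `|v x| by rewrite addr_ge0.
have := AM _ T M0 (Lp_boundedD uK vK) TA.
rewrite ler_pdivlMr // mulrC mulr_sumr; apply: le_trans.
apply: (le_trans (ler_norm_sum _ _ _)); apply: ler_sum => x _.
rewrite normrM (ger0_norm (mu_ge0 x)) mulrA ler_wpM2r //.
by apply: (le_trans (LK u v x vK)); rewrite ler_wpM2r ?powR_ge0 // lerDl.
Qed.

Lemma coupling_has_sum K u v : Lp_bounded K u -> Lp_bounded K v ->
  has_sum (fun x => `|u x| `^ (p - 2) * g (v x) * mu G x) (coupling g u v).
Proof.
move=> uK vK; have [L L0 LK] := coupling_term_bound K.
have M0 x : 0 <= `|u x| + `|v x| by rewrite addr_ge0.
have t0 x : 0 <= (`|u x| + `|v x|) `^ (p - 1) * mu G x by rewrite mulr_ge0 ?powR_ge0.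
have [C C0 CM] := Lp_bounded_subcritical (2 `^ p * (K + K)) ltr01.
have [|s ss _] := @bounded_has_sum _ _ _ (1 + C * S) t0.
  move=> A; apply: (le_trans (CM _ A M0 (Lp_boundedD uK vK))).
  by rewrite lerD2l ler_wpM2l // ler_fset_has_sum.
apply: (gint_has_sum _ (has_sumZ L ss)) => x.
by rewrite normrM (ger0_norm (mu_ge0 x)) mulrA ler_wpM2r // LK.
Qed.

(** Each increment is [t] times a function in the unit ball. In the product rule for differences one
    factor gains [t] by its Lipschitz bound, and all else is dominated by [M ^ (p - 1)], with [M]
    the sum of the four absolute values. *)
Lemma coupling_diff_tail K u v e : Lp_bounded K u -> Lp_bounded K v -> 0 < e ->
  exists A, forall h k t T, 0 < t -> t <= 1 ->
  Lp_bounded (t `^ p) h -> Lp_bounded (t `^ p) k -> [disjoint T & A]%fset ->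
  `|\sum_(x <- T) (`|u x + h x| `^ (p - 2) * g (v x + k x) * mu G x
                   - `|u x| `^ (p - 2) * g (v x) * mu G x)| <= e * t.
Proof.
move=> uK vK e0.
have q1 : 1 < p - 2 by move: p4; lra.
have q2 : 1 < p by move: p4; lra.
have q0 : 0 <= p - 2 := ltW (lt_trans ltr01 q1).
have q3 : p - 3 = p - 2 - 1 by ring.
pose r := (K / (c0 * m0)) `^ p^-1; pose r1 := (1 / (c0 * m0)) `^ p^-1.
have [g0 /(_ (r + r1))[L L0 gLK]] := gL.
pose D := (2 * (p - 2) + 2) * L + 1.
have D0 : 0 < D by rewrite ltr_wpDl // mulr_ge0 //; move: p4; lra.
pose KM := 2 `^ p * (2 `^ p * (K + K) + 2 `^ p * (1 + 1)).
have [|A AM] := Lp_bounded_subcritical_tail KM (e := e / D); first by rewrite divr_gt0.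
exists A => h k t T t0 t1 hK kK TA.
have h'K := Lp_boundedZ t0 hK; have k'K := Lp_boundedZ t0 kK.
(* The nested absolute values are the form produced by iterating [Lp_boundedD]. *)
pose M x := `| `|u x| + `|v x| | + `| `|h x / t| + `|k x / t| |.
have M0 x : 0 <= M x by rewrite addr_ge0.
have := AM _ T M0 (Lp_boundedD (Lp_boundedD uK vK) (Lp_boundedD h'K k'K)) TA.
rewrite ler_pdivlMr // mulrC -(ler_pM2r t0) => H; apply: le_trans H.
rewrite mulr_sumr mulr_suml.
apply: (le_trans (ler_norm_sum _ _ _)); apply: ler_sum => x _.
rewrite -mulrBl normrM (ger0_norm (mu_ge0 x)) mulrAC mulrA ler_wpM2r //.
have ME : M x = `|u x| + `|v x| + `|h x / t| + `|k x / t|.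
  by rewrite /M (ger0_norm (addr_ge0 (normr_ge0 (u x)) (normr_ge0 (v x))))
    (ger0_norm (addr_ge0 (normr_ge0 _) (normr_ge0 _))) !addrA.
have [hx kx] : `|h x| = t * `|h x / t| /\ `|k x| = t * `|k x / t|.
  by split; rewrite normrM normfV (gtr0_norm t0) mulrC divfK // gt_eqF.
have vr := Lp_bounded_sup x vK; rewrite -/r in vr.
have kr : `|k x| <= r1.
  by have := Lp_bounded_sup x k'K; rewrite -/r1 kx; move: (normr_ge0 (k x / t)); nra.
have nu := normr_ge0 (u x); have nv := normr_ge0 (v x).
have nh := normr_ge0 (h x / t); have nk := normr_ge0 (k x / t).
have uh : `|u x + h x| <= M x.
  by apply: (le_trans (ler_normD _ _)); rewrite ME hx; nra.
have vk : `|v x + k x| <= M x.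
  by apply: (le_trans (ler_normD _ _)); rewrite ME kx; nra.
have uM : `|u x| <= M x by rewrite ME; lra.
have vkr : `|v x + k x| <= r + r1.
  by apply: (le_trans (ler_normD _ _)); rewrite lerD.
have r1_0 : 0 <= r1 by exact: powR_ge0.
have vr' : `|v x| <= r + r1 by lra.
have d1 := normr_powR_lipschitz q1 uh uM.
have d2 := gLK _ _ vkr vr'.
have := gLK (v x + k x) 0 vkr; rewrite normr0 g0 !subr0 addr_ge0 ?powR_ge0 // => /(_ isT) d3.
have d4 : `|u x| `^ (p - 2) <= M x `^ (p - 2) by rewrite ge0_ler_powR ?nnegrE.
have -> (a1 a2 b1 b2 : R) : a1 * b1 - a2 * b2 = (a1 - a2) * b1 + a2 * (b1 - b2) by ring.
apply: (le_trans (ler_normD _ _)); rewrite !normrM (ger0_norm (powR_ge0 _ (p - 2))).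
have Mp2 : M x `^ (p - 3) * M x = M x `^ (p - 2).
  by rewrite q3 mulrC (mulr_powRB1 (M0 x) (lt_trans ltr01 q1)).
have Mp : M x `^ (p - 3) * M x * M x = M x `^ (p - 1) by rewrite Mp2 powRB2.
have e1 : `| `|u x + h x| `^ (p - 2) - `|u x| `^ (p - 2)| * `|g (v x + k x)| <=
   (p - 2) * L * t * M x `^ (p - 1).
  apply: (le_trans (ler_pM (normr_ge0 _) (normr_ge0 _) d1 d3)).
  rewrite (_ : u x + h x - u x = h x); last by ring.
  rewrite -Mp (_ : (p - 2) * L * t * (M x `^ (p - 3) * M x * M x) =
    ((p - 2) * M x `^ (p - 3)) * (t * M x) * (L * M x)); last by ring.
  rewrite -q3.
  apply: ler_pM; rewrite ?mulr_ge0 ?powR_ge0 //.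
    by rewrite ler_wpM2l ?mulr_ge0 ?powR_ge0 // hx ler_wpM2l ?(ltW t0) // ME; lra.
  by rewrite ler_wpM2l.
have e2 : `|u x| `^ (p - 2) * `|g (v x + k x) - g (v x)| <= L * t * M x `^ (p - 1).
  apply: (le_trans (ler_pM (powR_ge0 _ _) (normr_ge0 _) d4 d2)).
  rewrite -Mp (_ : v x + k x - v x = k x); last by ring.
  have -> : L * t * (M x `^ (p - 3) * M x * M x) = M x `^ (p - 2) * (L * (t * M x)).
    by rewrite -Mp2; ring.
  rewrite ler_wpM2l ?powR_ge0 // ler_wpM2l // kx ler_wpM2l ?(ltW t0) // ME; lra.
apply: (le_trans (lerD e1 e2)); rewrite -subr_ge0 /D.
rewrite (_ : _ - _ = ((p - 2) * L + L + 1) * M x `^ (p - 1) * t); last by ring.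
by rewrite mulr_ge0 ?(ltW t0) // mulr_ge0 ?powR_ge0 // !addr_ge0 // mulr_ge0.
Qed.

End Lipschitz.
End Coupling.

(** * Density of finitely supported functions *)

Section Density.
Context {R : realType} {V : choiceType} (G : weighted_graph R V).
Implicit Types (u v f g : V -> R) (x y : V) (e : R).

Lemma ler_fsum (S : set V) f g : finite_set S -> (forall y, f y <= g y) ->
  \sum_(y \in S) f y <= \sum_(y \in S) g y.
Proof. by move=> Sf fg; rewrite !fsbig_finite //=; apply: ler_sum => y _. Qed.

Lemma ler_grad u v x : (forall y, `|u y - u x| <= `|v y - v x|) ->
  grad G u x <= grad G v x.
Proof.
move=> uv; apply: ler_wsqrtr; rewrite /Gamma ler_wpM2l //.
  by rewrite invr_ge0 mulr_ge0 // ltW ?mu_gt0.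
apply: ler_fsum => [|y]; first exact: adj_finite.
by rewrite -!expr2 -(real_normK (num_real (u y - u x))) -(real_normK (num_real (v y - v x)))
  lerXn2r ?nnegrE.
Qed.

Lemma grad_bounded x : exists2 K, 0 <= K & forall u e, 0 <= e ->
  (forall y, `|u y| <= e) -> grad G u x <= e * K.
Proof.
pose D := (2 * mu G x)^-1 * \sum_(y \in [set y | adj G x y]) (4 : R).
have m0 : 0 <= (2 * mu G x)^-1 by rewrite invr_ge0 mulr_ge0 // ltW ?mu_gt0.
exists (Num.sqrt D) => [|u e e0 ue]; first exact: sqrtr_ge0.
have -> : e * Num.sqrt D = Num.sqrt (e ^+ 2 * D).
  by rewrite (@sqrtrM _ (e ^+ 2)) ?sqr_ge0 // sqrtr_sqr ger0_norm.
apply: ler_wsqrtr; rewrite /Gamma /D mulrCA ler_wpM2l // mulr_fsumr.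
apply: ler_fsum => [|y]; first exact: adj_finite.
rewrite -expr2 -real_normK ?num_real //.
apply: (@le_trans _ _ ((e + e) ^+ 2)); last by rewrite le_eqVlt; apply/orP; left; apply/eqP; ring.
rewrite lerXn2r ?nnegrE ?addr_ge0 //.
by apply: (le_trans (ler_normB _ _)); rewrite lerD.
Qed.

Variables (p : R) (p1 : 1 < p).
Let p0 : 0 < p. Proof. exact: lt_trans p1. Qed.

Lemma grad_eq0 u x : (forall y, adj G x y -> u y = u x) -> grad G u x = 0.
Proof.
move=> ux; rewrite /grad /Gamma fsbig1 ?mulr0 ?sqrtr0 // => y /ux ->.
by rewrite subrr mulr0.
Qed.

Lemma Cc_density_finite_support w u : Cc u ->
  exists A : {fset V}, forall x, x \notin A -> density G p w u x = 0.
Proof.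
move=> uC; set S := [set x | u x != 0] in uC.
have Nf : finite_set (S `|` \bigcup_(y in S) [set x | adj G y x]).
  by rewrite finite_setU; split => //; apply: bigcup_finite => // y _; exact: adj_finite.
exists (fset_set (S `|` \bigcup_(y in S) [set x | adj G y x])) => x.
rewrite in_fset_set // => /negP xN.
have ux : u x = 0.
  by apply/eqP/negPn/negP => ux; apply: xN; apply/mem_set; left.
rewrite /density ux normr0 powR0 ?gt_eqF // mulr0 addr0 grad_eq0 ?powR0 ?gt_eqF //.
move=> y xy; rewrite ux; apply/eqP/negPn/negP => uy; apply: xN; apply/mem_set; right.
by exists y => //=; rewrite adj_sym.
Qed.

Lemma Cc_finite_energy w u : (forall x, 0 <= w x) -> Cc u -> finite_energy G p w u.
Proof.
move=> w0 /(Cc_density_finite_support w)[A uA].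
apply: (finite_energy_has_sum w0 (s := \sum_(x <- A) density G p w u x * mu G x)).
by apply: has_sum_finite => x /uA ->; rewrite mul0r.
Qed.

Definition clamp e (s : R) := Num.max (- e) (Num.min s e).

Lemma clamp_bound e s : 0 <= e -> `|clamp e s| <= e.
Proof.
move=> e0; rewrite /clamp ler_norml; apply/andP; split; first by rewrite le_max lexx.
by rewrite ge_max ge_min lexx orbT andbT; lra.
Qed.

Lemma clamp_dist e s t : 0 <= e -> `|clamp e s - clamp e t| <= `|s - t|.
Proof.
move=> e0; have := ler_norm (s - t); have := ler_norm (t - s); rewrite (distrC t) /clamp.
move: `|s - t| => d h1 h2; rewrite ler_norml.
by case: (leP s e) => ?; case: (leP t e) => ?; case: (leP (- e) s) => ?;
  case: (leP (- e) t) => ?; case: (leP (- e) e) => ?; apply/andP; split; lra.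
Qed.

Lemma clampE e s : `|s| <= e -> clamp e s = s.
Proof. by rewrite ler_norml /clamp => /andP[h1 h2]; rewrite min_l // max_r. Qed.

Variables (m0 : R) (m0_gt0 : 0 < m0) (mu_ge : forall x, m0 <= mu G x).

Let one_ge0 x : 0 <= (cst 1 x : R). Proof. exact: ler01. Qed.

(* [mu >= m0] makes [{|u| > e}] finite, so that subtracting [clamp e \o u] truncates
   [u] to a finitely supported function. *)
Lemma finite_energy_W1p u : finite_energy G p (cst 1) u -> W1p G p u.
Proof.
move=> uf; have p1' := ltW p1; split; first by rewrite (enorm_lty _ p1').
(* The clamped function will cost at most [E] on [A], where it is uniformly small, and at most [E]
   elsewhere, where its density is below that of [u]. Three thirds make the final inequality
   strict. *)
move=> eps eps0; pose E := eps `^ p / 3.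
have E0 : 0 < E by rewrite divr_gt0 ?powR_gt0.
have [A AT] := has_sum_tail (total_has_sum one_ge0 uf) E0.
have [C C0 CA] : exists2 C, 0 <= C & forall f e, 0 <= e -> (forall y, `|f y| <= e) ->
    \sum_(x <- A) density G p (cst 1) f x * mu G x <= e `^ p * C.
  have /choice[K KP] : forall x, exists K, 0 <= K /\ forall f e, 0 <= e ->
      (forall y, `|f y| <= e) -> grad G f x <= e * K.
    by move=> x; have [K K0 KP] := grad_bounded x; exists K.
  exists (\sum_(x <- A) (K x `^ p + 1) * mu G x).
    by apply: sumr_ge0 => x _; rewrite mulr_ge0 ?addr_ge0 ?powR_ge0 // ltW ?mu_gt0.
  move=> f e e0 fe; rewrite mulr_sumr; apply: ler_sum => x _.
  rewrite mulrA ler_wpM2r ?(ltW (mu_gt0 G x)) // /density mul1r mulrDr mulr1.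
  have [K0 /(_ f e e0 fe) gK] := KP x.
  rewrite -powRM // lerD // ge0_ler_powR ?nnegrE ?(ltW p0) ?grad_ge0 ?mulr_ge0 //.
(* The clamping height for which the cost [e ^ p * C] on [A] stays below [E]. *)
pose e := (E / (C + 1)) `^ p^-1.
have C1 : 0 < C + 1 by rewrite ltr_wpDl.
have e0 : 0 < e by rewrite powR_gt0 // divr_gt0.
have ep : e `^ p = E / (C + 1).
  by rewrite /e -powRrM mulVf ?gt_eqF // powRr1 // ltW // divr_gt0.
pose f x := clamp e (u x).
have fe x : `|f x| <= e by apply: clamp_bound; exact: ltW.
have fu y : `|f y| <= `|u y|.
  have := clamp_dist (u y) 0 (ltW e0).
  by rewrite (@clampE e 0) ?normr0 ?(ltW e0) // !subr0.
have dens_le x : density G p (cst 1) f x <= density G p (cst 1) u x.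
  rewrite /density !mul1r lerD // ge0_ler_powR ?nnegrE ?(ltW p0) ?grad_ge0 ?fu //.
  by apply: ler_grad => y; apply: clamp_dist; exact: ltW.
have [|ff fE] := @finite_energy_bounded _ _ G p (cst 1) one_ge0 f (E + E).
  move=> B; apply: le_trans (ler_sum_subset _ (fsubsetUl B A)) _.
    by move=> x; exact: density_mu_ge0.
  rewrite (sum_fsetD _ (fsubsetUr B A)); apply: lerD.
    apply: (le_trans (CA _ _ (ltW e0) fe)); rewrite ep mulrAC ler_pdivrMr //.
    by rewrite ler_wpM2l ?(ltW E0) // lerDl.
  apply: le_trans (AT _ (fdisjoint_sub_setD A (B `|` A)%fset)).
  apply: le_trans (ler_norm _); apply: ler_sum => x _.
  by rewrite ler_wpM2r ?(ltW (mu_gt0 G x)).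
exists (u - f).
  (* A point with [|u| > e] alone contributes at least [e ^ p * m0], too much for the tail outside
     [B]. *)
  have [|B BT] := has_sum_tail (total_has_sum one_ge0 uf) (e := e `^ p * m0 / 2).
    by rewrite divr_gt0 // mulr_gt0 // powR_gt0.
  apply: (@sub_finite_set _ _ [set` B]); last exact: finite_fset.
  move=> x /= ufx; apply/negPn/negP => xB.
  have := BT [fset x]%fset; rewrite big_seq_fset1.
  have -> : [disjoint [fset x] & B]%fset by rewrite fdisjoint1X.
  move=> /(_ isT); rewrite ger0_norm ?density_mu_ge0 // leNgt => /negP; apply.
  have ux : e < `|u x|.
    rewrite ltNge; apply/negP => ux; move: ufx; rewrite !fctE /f clampE //.
    by rewrite subrr eqxx.
  apply: (@lt_le_trans _ _ (e `^ p * m0)).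
    have : 0 < e `^ p * m0 by rewrite mulr_gt0 // powR_gt0.
    by lra.
  apply: ler_pM; rewrite ?powR_ge0 ?(ltW m0_gt0) // /density mul1r.
  apply: (@le_trans _ _ (`|u x| `^ p)); last by rewrite lerDr powR_ge0.
  by rewrite ge0_ler_powR ?nnegrE ?(ltW p0) ?(ltW e0) ?(ltW ux).
have -> : u - (u - f) = f by rewrite opprB addrC subrK.
rewrite (enormE one_ge0 ff) lte_fin -/(total G p (cst 1) f).
have tf : total G p (cst 1) f < eps `^ p.
  apply: (le_lt_trans fE); have : eps `^ p = E + E + E by rewrite /E; field.
  by lra.
have -> : eps = (eps `^ p) `^ p^-1.
  by rewrite -powRrM mulfV ?gt_eqF // powRr1 // ltW.
by rewrite gt0_ltr_powR ?nnegrE ?powR_ge0 ?invr_gt0 ?total_ge0.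
Qed.

(** Pointwise limits come with an energy bound but without approximating finitely supported
    functions; this makes them elements of the space. As [w >= c0], the energy with weight 1 is at
    most [1 + 1 / c0] times the weighted one. *)
Lemma finite_energy_weighted w (c0 : R) (w_gt0 : forall x, 0 < w x) (p1' : 1 <= p) u :
  0 < c0 -> (forall x, c0 <= w x) ->
  (u \in weighted_pred G p1' w_gt0) = `[< finite_energy G p w u >].
Proof.
move=> c00 cw; have w0 x : 0 <= w x := ltW (w_gt0 x).
rewrite /in_mem /=; apply/asboolP/asboolP => [[uW uP]|uf].
  by apply: modular_lty => //; rewrite -(enorm_lty _ p1') //; case: uW.
split.
  apply: finite_energy_W1p; pose D := 1 + c0^-1.
  have D0 : 0 <= D by rewrite addr_ge0 // invr_ge0 ltW.
  have [|//] := @finite_energy_bounded _ _ G p (cst 1) one_ge0 u (D * total G p w u).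
  move=> B; apply: (@le_trans _ _ (D * \sum_(x <- B) density G p w u x * mu G x)).
    rewrite mulr_sumr; apply: ler_sum => x _; rewrite mulrA ler_wpM2r ?(ltW (mu_gt0 G x)) //.
    rewrite /density mulrDr lerD //.
      by rewrite ler_peMl ?powR_ge0 // /D lerDl invr_ge0 ltW.
    rewrite mulrA ler_wpM2r ?powR_ge0 // /D mulrDl mul1r.
    apply: (@le_trans _ _ (c0^-1 * w x)); last by rewrite lerDr.
    by rewrite mulrC ler_pdivlMr // mul1r.
  by rewrite ler_wpM2l // ler_sum_total.
apply: le_lt_trans uf; apply: le_nnint => x.
by rewrite lerDr powR_ge0.
Qed.
End Density.

(** * Differentiability of the functionals *)

Section DifferentiableSums.
Context {R : realType} {V : choiceType} {H : normedModType R}.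
Implicit Types (w h : H) (e : R).

Lemma differentiable_sum_seq (I : Type) (r : seq I) (f : I -> H -> R) w :
  (forall i, differentiable (f i) w) -> differentiable (fun z => \sum_(i <- r) f i z) w.
Proof.
move=> fd; elim: r => [|i r IH].
  by under eq_fun do rewrite big_nil; exact: differentiable_cst.
by under eq_fun do rewrite big_cons; apply: differentiableD.
Qed.

(** The finite sums over [A] are the approximants of [differentiable_approx]; the tail hypothesis
    bounds the error of their increments. *)
Lemma differentiable_has_sum (f : V -> H -> R) (F : H -> R) w :
  (forall z, has_sum (f ^~ z) (F z)) -> (forall x, differentiable (f x) w) ->
  (forall e, 0 < e -> exists A : {fset V}, exists2 d : R, 0 < d &
     forall h T, h != 0 -> `|h| <= d -> [disjoint T & A]%fset ->
     `|\sum_(x <- T) (f x (w + h) - f x w)| <= e * `|h|) ->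
  differentiable F w.
Proof.
move=> fF fd ft; apply: differentiable_approx => e e0.
have [A [d d0 AT]] := ft _ e0; exists (fun z => \sum_(x <- A) f x z).
  exact: differentiable_sum_seq.
exists d => // h hd; have [->|h0] := eqVneq h 0.
  by rewrite addr0 !subrr !normr0 mulr0.
rewrite -sumrB; apply: (has_sum_approx (has_sumB (fF (w + h)) (fF w))) => T TA.
exact: AT.
Qed.

Lemma differentiable_comp_is_derive (f : H -> R) (g : R -> R) (dg : R) w :
  differentiable f w -> is_derive (f w) 1 g dg -> differentiable (g \o f) w.
Proof. by move=> fw [gd _]; apply: differentiable_comp => //; apply/derivable1_diffP. Qed.

End DifferentiableSums.

(** * Differentiability of the norm and coupling terms along linear maps into function spaces *)

Section EnergyMaps.
Context {R : realType} {V : choiceType} (G : weighted_graph R V) {H : normedModType R}.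
Variables (p : R) (p4 : 4 < p).
Implicit Types (w h : H) (e : R) (x : V).

(** Abstracts a component projection of the product space, so that the analysis runs over an
    arbitrary normed space [H]. *)
Definition energy_map (wt : V -> R) (U : H -> V -> R) : Prop :=
  [/\ forall w h, U (w + h) = U w + U h, forall k w, U (k *: w) = k *: U w,
      forall w, finite_energy G p wt (U w) & forall w, total G p wt (U w) <= `|w| `^ p].

Variables (c : V -> R) (c0 m0 S : R).
Hypotheses (c0_gt0 : 0 < c0) (c_ge : forall x, c0 <= c x).
Hypotheses (m0_gt0 : 0 < m0) (mu_ge : forall x, m0 <= mu G x).
Hypothesis inv_has_sum : has_sum (fun x => (c x)^-1 * mu G x) S.

Let p1 : 1 < p. Proof. by move: p4; lra. Qed.
Let p0 : 0 < p. Proof. by move: p4; lra. Qed.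
Let c_gt0 x : 0 < c x. Proof. exact: lt_le_trans (c_ge x). Qed.

Section OneMap.
Variables (wt : V -> R) (U : H -> V -> R).
Hypotheses (c_le : forall x, c x <= wt x) (UE : energy_map wt U).

Let wt_ge0 x : 0 <= wt x. Proof. exact: le_trans (ltW (c_gt0 x)) (c_le x). Qed.

Lemma energy_map_Lp w : Lp_bounded G p c (`|w| `^ p) (U w).
Proof. by have [_ _ Uf UN] := UE; apply: (Lp_bounded_finite_energy c0_gt0 c_ge c_le). Qed.

Lemma energy_map_sup w x : `|U w x| <= (c0 * m0)^-1 `^ p^-1 * `|w|.
Proof.
have := Lp_bounded_sup p4 c0_gt0 c_ge m0_gt0 mu_ge x (energy_map_Lp w).
rewrite powRM ?powR_ge0 ?invr_ge0 ?mulr_ge0 ?(ltW c0_gt0) ?(ltW m0_gt0) //.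
by rewrite -powRrM mulfV ?gt_eqF // powRr1 // mulrC.
Qed.

Lemma differentiable_eval x w : differentiable (fun z => U z x) w.
Proof.
have [UD UZ _ _] := UE; pose L z := U z x.
have Llin : linear L by move=> k y z; rewrite /L UD UZ.
pose HL := GRing.isLinear.Build _ _ _ _ L Llin.
pose LL : {linear H -> R} := HB.pack L HL.
apply: (@linear_differentiable _ _ _ LL).
apply: (linear_continuous_of_bound (c := (c0 * m0)^-1 `^ p^-1)) => h.
exact: energy_map_sup.
Qed.

Lemma differentiable_density x w : differentiable (fun z => density G p wt (U z) x) w.
Proof.
apply: differentiableD.
  (* The square root in [grad] is not differentiable where [Gamma] vanishes; the power [p / 2 > 1]
     of the quadratic form [Gamma] is. *)
  have -> : (fun z => grad G (U z) x `^ p) =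
      (fun s => `|s| `^ (p / 2)) \o (fun z => Gamma G (U z) (U z) x).
    apply/funext => z /=; rewrite ger0_norm ?Gamma_ge0 // -grad_sqr.
    by rewrite -powR_mulrn ?grad_ge0 // -powRrM mulrC divfK.
  have ph : 1 < p / 2 by move: p4; lra.
  apply: differentiable_comp_is_derive (is_derive_normr_powR _ ph).
  apply: differentiableM; first exact: differentiable_cst.
  under eq_fun do rewrite (fsbig_finite _ _ (adj_finite G x)) /=.
  apply: differentiable_sum_seq => y.
  have dd : differentiable (fun z => U z y - U z x) w.
    by apply: differentiableB; exact: differentiable_eval.
  exact: differentiableM.
apply: differentiableM; first exact: differentiable_cst.
exact: (differentiable_comp_is_derive (differentiable_eval x w) (is_derive_normr_powR _ p1)).
Qed.

Lemma differentiable_total w : differentiable (fun z => total G p wt (U z)) w.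
Proof.
have [UD UZ Uf UN] := UE.
apply: (differentiable_has_sum (f := fun x z => density G p wt (U z) x * mu G x)).
- by move=> z; exact: total_has_sum.
- by move=> x; apply: differentiableM; [exact: differentiable_density|exact: differentiable_cst].
move=> e e0; have [A [d d0 Ad]] := total_tail p1 wt_ge0 (Uf w) e0.
exists A, d => // h T h0 hd TA; rewrite UD.
by apply: Ad => //; rewrite normr_gt0.
Qed.

End OneMap.

Lemma differentiable_coupling (g dg : R -> R) (wt wt' : V -> R) (U U' : H -> V -> R) w :
  locally_lipschitz g -> (forall s : R, is_derive s 1 g (dg s)) ->
  (forall x, c x <= wt x) -> (forall x, c x <= wt' x) ->
  energy_map wt U -> energy_map wt' U' ->
  differentiable (fun z => coupling G p g (U z) (U' z)) w.
Proof.
move=> gL gd cwt cwt' UE UE'.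
have [UD UZ Uf UN] := UE; have [U'D U'Z U'f U'N] := UE'.
have UK z := energy_map_Lp cwt UE z; have U'K z := energy_map_Lp cwt' UE' z.
apply: (differentiable_has_sum (f := fun x z => `|U z x| `^ (p - 2) * g (U' z x) * mu G x)).
- by move=> z; exact: (coupling_has_sum p4 c0_gt0 c_ge m0_gt0 mu_ge inv_has_sum gL (UK z) (U'K z)).
- move=> x; apply: differentiableM; last exact: differentiable_cst.
  have ph : 1 < p - 2 by move: p4; lra.
  apply: differentiableM.
    exact: (differentiable_comp_is_derive (differentiable_eval cwt UE x w) (is_derive_normr_powR _ ph)).
  exact: (differentiable_comp_is_derive (differentiable_eval cwt' UE' x w) (gd _)).
move=> e e0.
have [A Ad] := coupling_diff_tail p4 c0_gt0 c_ge m0_gt0 mu_ge inv_has_sum gL (UK w) (U'K w) e0.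
exists A, 1 => // h T h0 hd TA; rewrite UD U'D.
by apply: (Ad (U h) (U' h)) => //; rewrite ?normr_gt0.
Qed.

End EnergyMaps.

(** * Pointwise limits and comparison *)

Section PointwiseLimits.
Context {R : realType} {V : choiceType} (G : weighted_graph R V).
Context {T : Type} {F : set_system T} {FF : ProperFilter F}.
Variables (p : R) (p4 : 4 < p).
Implicit Types (x : V) (A : {fset V}).

Lemma cvg_sum_seq (I : Type) (r : seq I) (f : I -> T -> R) (l : I -> R) :
  (forall i, f i t @[t --> F] --> l i) ->
  \sum_(i <- r) f i t @[t --> F] --> \sum_(i <- r) l i.
Proof.
move=> fl; elim: r => [|i r IH].
  by under eq_fun do rewrite big_nil; rewrite big_nil; exact: cvg_cst.
by under eq_fun do rewrite big_cons; rewrite big_cons; apply: cvgD.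
Qed.

Lemma cvg_comp_is_derive (f : T -> R) (l : R) (g dg : R -> R) :
  (forall s : R, is_derive s 1 g (dg s)) -> f t @[t --> F] --> l ->
  g (f t) @[t --> F] --> g l.
Proof.
move=> gd fl; apply: continuous_cvg => //.
by apply: differentiable_continuous; apply/derivable1_diffP.
Qed.

Lemma cvg_normr_powR (f : T -> R) (l q : R) : 1 < q -> f t @[t --> F] --> l ->
  `|f t| `^ q @[t --> F] --> `|l| `^ q.
Proof.
move=> q1; apply: (cvg_comp_is_derive (g := fun s => `|s| `^ q)
  (dg := fun s => q * `|s| `^ (q - 2) * s)) => s.
exact: is_derive_normr_powR.
Qed.

Lemma cvg_Gamma (f : T -> V -> R) u x : (forall y, f t y @[t --> F] --> u y) ->
  Gamma G (f t) (f t) x @[t --> F] --> Gamma G u u x.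
Proof.
move=> fu; rewrite /Gamma.
under eq_fun do rewrite (fsbig_finite _ _ (adj_finite G x)) /=.
rewrite (fsbig_finite _ _ (adj_finite G x)) /=.
apply: cvgMl_tmp; apply: cvg_sum_seq => y.
by apply: cvgM; apply: cvgB.
Qed.

Lemma density_GammaE w u x :
  density G p w u x = `|Gamma G u u x| `^ (p / 2) + w x * `|u x| `^ p.
Proof.
rewrite /density (ger0_norm (Gamma_ge0 G x u)) -grad_sqr -powR_mulrn ?grad_ge0 //.
by rewrite -powRrM (mulrC 2) divfK.
Qed.

Lemma cvg_density w (f : T -> V -> R) u x : (forall y, f t y @[t --> F] --> u y) ->
  density G p w (f t) x @[t --> F] --> density G p w u x.
Proof.
move=> fu; rewrite density_GammaE; under eq_fun do rewrite density_GammaE.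
apply: cvgD.
  by apply: cvg_normr_powR; [move: p4; lra|exact: cvg_Gamma].
by apply: cvgMl_tmp; apply: cvg_normr_powR; [move: p4; lra|exact: fu].
Qed.

Variables (c : V -> R) (c0 m0 S : R).
Hypotheses (c0_gt0 : 0 < c0) (c_ge : forall x, c0 <= c x).
Hypotheses (m0_gt0 : 0 < m0) (mu_ge : forall x, m0 <= mu G x).
Hypothesis inv_has_sum : has_sum (fun x => (c x)^-1 * mu G x) S.

(** Outside one finite set all the sums are uniformly below [e / 3]; on it pointwise convergence
    suffices. *)
Lemma cvg_coupling K (g dg : R -> R) (f f' : T -> V -> R) u v :
  locally_lipschitz g -> (forall s : R, is_derive s 1 g (dg s)) ->
  (forall t, Lp_bounded G p c K (f t)) -> (forall t, Lp_bounded G p c K (f' t)) ->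
  Lp_bounded G p c K u -> Lp_bounded G p c K v ->
  (forall y, f t y @[t --> F] --> u y) -> (forall y, f' t y @[t --> F] --> v y) ->
  coupling G p g (f t) (f' t) @[t --> F] --> coupling G p g u v.
Proof.
move=> gL gd fK f'K uK vK fu fv; apply/cvgrPdist_le => e e0.
have e30 : 0 < e / 3 by rewrite divr_gt0.
have [A AT] := coupling_tail p4 c0_gt0 c_ge m0_gt0 mu_ge inv_has_sum gL K e30.
have cs u' v' uK' vK' := coupling_has_sum p4 c0_gt0 c_ge m0_gt0 mu_ge inv_has_sum gL
  (K := K) (u := u') (v := v') uK' vK'.
have As u' v' uK' vK' := has_sum_approx (cs u' v' uK' vK') (fun T TA => AT u' v' T uK' vK' TA).
have : \sum_(x <- A) `|f t x| `^ (p - 2) * g (f' t x) * mu G x @[t --> F] -->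
       \sum_(x <- A) `|u x| `^ (p - 2) * g (v x) * mu G x.
  apply: cvg_sum_seq => x; apply: cvgMr_tmp; apply: cvgM.
    by apply: cvg_normr_powR; [move: p4; lra|exact: fu].
  exact: cvg_comp_is_derive gd (fv x).
move=> /cvgrPdist_le/(_ _ e30); apply: filterS => t h.
have h1 := As u v uK vK; have h2 := As _ _ (fK t) (f'K t).
rewrite distrC in h2.
have h3 := le_trans (ler_distD _ _ _) (lerD h h2).
apply: (le_trans (le_trans (ler_distD _ _ _) (lerD h1 h3))).
by rewrite le_eqVlt; apply/orP; left; apply/eqP; field.
Qed.

End PointwiseLimits.

(** * Sign, comparison and scaling of the coupling terms *)

Section Comparison.
Context {R : realType} {V : choiceType} (G : weighted_graph R V).
Variables (p : R) (p4 : 4 < p).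
Variables (c : V -> R) (c0 m0 S : R).
Hypotheses (c0_gt0 : 0 < c0) (c_ge : forall x, c0 <= c x).
Hypotheses (m0_gt0 : 0 < m0) (mu_ge : forall x, m0 <= mu G x).
Hypothesis inv_has_sum : has_sum (fun x => (c x)^-1 * mu G x) S.
Implicit Types (u v : V -> R) (K L t : R).

Let sqr (s : R) := s ^+ 2.
Let cs g gL K u v := @coupling_has_sum _ _ G p p4 c c0 m0 S c0_gt0 c_ge m0_gt0 mu_ge
  inv_has_sum g gL K u v.

Let mu_ge0 x : 0 <= mu G x. Proof. exact/ltW/mu_gt0. Qed.

Lemma coupling_sqr_ge0 K u v : Lp_bounded G p c K u -> Lp_bounded G p c K v ->
  0 <= coupling G p sqr u v.
Proof.
move=> uK vK; have h := cs (@locally_lipschitz_sqr R) uK vK.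
apply: (has_sum_ge0 _ h) => x.
by rewrite mulr_ge0 // mulr_ge0 ?powR_ge0 //; exact: sqr_ge0.
Qed.

(** A vanishing sum of nonnegative terms makes [u] or [v] vanish at each point, which kills the
    logarithmic term there too. *)
Lemma coupling_sqln_eq0 K u v : Lp_bounded G p c K u -> Lp_bounded G p c K v ->
  coupling G p sqr u v = 0 -> coupling G p (@sqln R) u v = 0.
Proof.
move=> uK vK uv0; apply: has_sum_unique (cs (@locally_lipschitz_sqln R) uK vK) _.
suff E x : `|u x| `^ (p - 2) * sqln (v x) * mu G x = 0.
  have := @has_sum_finite R V (fun=> 0) fset0 (fun _ _ => erefl).
  by rewrite big_nil; apply: eq_has_sum => x; rewrite E.
have h := cs (@locally_lipschitz_sqr R) uK vK; rewrite uv0 in h.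
have t0 y : 0 <= `|u y| `^ (p - 2) * sqr (v y) * mu G y.
  by rewrite mulr_ge0 // mulr_ge0 ?powR_ge0 //; exact: sqr_ge0.
have := ler_fset_has_sum [fset x]%fset t0 h; rewrite big_seq_fset1 => h1.
have /eqP : `|u x| `^ (p - 2) * sqr (v x) * mu G x = 0 by apply/eqP; rewrite eq_le h1 t0.
rewrite mulf_eq0 (gt_eqF (mu_gt0 G x)) orbF mulf_eq0 => /orP[/eqP ->|/eqP vx].
  by rewrite !mul0r.
by move: vx; rewrite /sqr /sqln => ->; rewrite mul0r mulr0 mul0r.
Qed.

Lemma coupling_sqln_le K L u v : Lp_bounded G p c K u -> Lp_bounded G p c K v ->
  (forall x, v x != 0 -> ln (v x ^+ 2) <= L) ->
  coupling G p (@sqln R) u v <= L * coupling G p sqr u v.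
Proof.
move=> uK vK vL.
apply: (has_sum_le _ (cs (@locally_lipschitz_sqln R) uK vK)
  (has_sumZ L (cs (@locally_lipschitz_sqr R) uK vK))) => x.
rewrite [leRHS]mulrA ler_wpM2r // [leRHS]mulrCA ler_wpM2l ?powR_ge0 // /sqln mulrC.
have [->|/vL vx] := eqVneq (v x) 0; first by rewrite /sqr expr0n /= !mulr0.
by rewrite ler_wpM2r ?sqr_ge0.
Qed.

Lemma Lp_bounded_scale K t u : 0 < t -> Lp_bounded G p c K u ->
  Lp_bounded G p c (t `^ p * K) (t *: u).
Proof.
move=> t0 uK A; apply: le_trans (ler_wpM2l (powR_ge0 t p) (uK A)).
rewrite mulr_sumr; apply: ler_sum => x _.
rewrite fctE /GRing.scale /= normrM (gtr0_norm t0) powRM ?(ltW t0) //.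
by rewrite le_eqVlt; apply/orP; left; apply/eqP; ring.
Qed.

Let powR_sqr t : 0 < t -> t `^ (p - 2) * t ^+ 2 = t `^ p.
Proof.
move=> t0; rewrite -powR_mulrn ?(ltW t0) // -powRD ?subrK //.
by rewrite implybE (gt_eqF t0) orbT.
Qed.

Lemma couplingZ_sqr K t u v : 0 < t -> Lp_bounded G p c K u -> Lp_bounded G p c K v ->
  coupling G p sqr (t *: u) (t *: v) = t `^ p * coupling G p sqr u v.
Proof.
move=> t0 uK vK; have h := cs (@locally_lipschitz_sqr R) (Lp_bounded_scale t0 uK) (Lp_bounded_scale t0 vK).
apply: has_sum_unique h _.
apply: eq_has_sum (has_sumZ (t `^ p) (cs (@locally_lipschitz_sqr R) uK vK)) => x.
rewrite !fctE /GRing.scale /= normrM (gtr0_norm t0) powRM ?(ltW t0) // /sqr -(powR_sqr t0).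
ring.
Qed.

Lemma couplingZ_sqln K t u v : 0 < t -> Lp_bounded G p c K u -> Lp_bounded G p c K v ->
  coupling G p (@sqln R) (t *: u) (t *: v) =
  t `^ p * (coupling G p (@sqln R) u v + ln (t ^+ 2) * coupling G p sqr u v).
Proof.
move=> t0 uK vK; have h := cs (@locally_lipschitz_sqln R) (Lp_bounded_scale t0 uK) (Lp_bounded_scale t0 vK).
apply: has_sum_unique h _.
apply: eq_has_sum (has_sumZ (t `^ p) (has_sumD (cs (@locally_lipschitz_sqln R) uK vK)
   (has_sumZ (ln (t ^+ 2)) (cs (@locally_lipschitz_sqr R) uK vK)))) => x.
rewrite !fctE /GRing.scale /= normrM (gtr0_norm t0) powRM ?(ltW t0) // /sqr -(powR_sqr t0).
rewrite /sqln; have [->|vx] := eqVneq (v x) 0; first by rewrite mulr0 expr0n /=; ring.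
rewrite exprMn (@lnM _ (t ^+ 2)) ?posrE ?(exprn_gt0 2 t0) ?exprn_even_gt0 //=.
ring.
Qed.

End Comparison.

(** * Derivatives along lines, first-order condition at a minimum, limits along ultrafilters *)

Section DirectionalDerivatives.
Context {R : realType}.

Lemma is_derive_along (H : normedModType R) (f : H -> R) (w h : H) :
  differentiable f w -> is_derive (0 : R) 1 (fun s => f (w + s *: h)) ('d f w h).
Proof.
move=> fw; apply: is_derive_of_eps => e e0.
have h0 : 0 < `|h| + 1 by rewrite ltr_wpDl.
have [|d d0 fd] := differentiable_eps fw (e := e / (`|h| + 1)); first by rewrite divr_gt0.
exists (d / (`|h| + 1)) => [|s]; first by rewrite divr_gt0.
rewrite ler_pdivlMr // add0r scale0r addr0 => sd.
have -> : s * 'd f w h = 'd f w (s *: h) by rewrite linearZ.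
have sh : `|s *: h| <= `|s| * (`|h| + 1) by rewrite normrZ ler_wpM2l // lerDl.
apply: (le_trans (fd _ (le_trans sh sd))).
apply: (@le_trans _ _ (e / (`|h| + 1) * (`|s| * (`|h| + 1)))).
  by rewrite ler_wpM2l // ltW // divr_gt0.
by rewrite le_eqVlt; apply/orP; left; apply/eqP; field; rewrite gt_eqF.
Qed.

Lemma is_derive_unique (f : R -> R) (s l l' : R) :
  is_derive s 1 f l -> is_derive s 1 f l' -> l = l'.
Proof. by move=> [_ <-] [_ <-]. Qed.

Lemma is_derive_addl (k s : R) : is_derive s 1 (fun x : R => k + x : R) (1 : R).
Proof.
have h1 : is_derive s 1 (fun=> k) (0 : R) := is_derive_cst k s (1 : R).
have h2 : is_derive s 1 (fun x : R => x) (1 : R) := is_derive_id s (1 : R).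
by rewrite -[X in is_derive _ _ _ X]add0r; exact: is_deriveDf h1 h2.
Qed.

Lemma is_derive_min_eq0 (f : R -> R) (l d : R) : is_derive (0 : R) 1 f l -> 0 < d ->
  (forall s, `|s| <= d -> f 0 <= f s) -> l = 0.
Proof.
move=> fl d0 fmin; have /derivable1_diffP fd : derivable f 0 1 by case: fl.
have El : 'd f 0 1 = l.
  by rewrite -deriveE //; case: fl.
apply/eqP; rewrite -normr_le0; apply/ler_addgt0Pr => e e0; rewrite add0r.
have [d' d'0 fe] := differentiable_eps fd e0.
(* A step against the slope: to first order the function would drop by [|s| * |l|], so minimality
   forces [|l| <= e]. *)
pose s := - (Num.sg l * Num.min d d').
have m0 : 0 < Num.min d d' by rewrite lt_min d0.
have [->|l0] := eqVneq l 0; first by rewrite normr0 ltW.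
have ns : `|s| = Num.min d d' by rewrite normrN normrM normr_sg l0 mul1r gtr0_norm.
have := fe s; rewrite ns ge_min lexx orbT add0r => /(_ isT).
have -> : 'd f 0 s = s * l by rewrite -{1}(mulr1 s) -/(s *: 1) linearZ El.
have := fmin s; rewrite ns ge_min lexx => /(_ isT) fs.
rewrite ler_norml => /andP[_].
have -> : s * l = - (Num.min d d' * `|l|) by rewrite /s normrEsg; ring.
by move=> le; rewrite -(ler_pM2l m0); lra.
Qed.

(** One ultrafilter serves all points of [V] simultaneously, which replaces the diagonal extraction
    of a subsequence. *)
Lemma ultra_bounded_cvg (T : Type) (F : set_system T) (f : T -> R) (M : R) :
  UltraFilter F -> (forall t, `|f t| <= M) -> exists l : R, f t @[t --> F] --> l.
Proof.
move=> FU fM; have := @segment_compact R (- M) M; rewrite compact_ultra.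
have fFU : UltraFilter (f @ F).
  have FP : ProperFilter F by exact: ultra_proper.
   apply: Build_UltraFilter => G GP FG; apply/seteqP; split => // A GA.
  have [//|FnA] := in_ultra_setVsetC (f @^-1` A) FU.
  have /FG GnA : (f @ F) (~` A) by [].
  by have [x []] := @filter_ex _ _ GP _ (filterI GA GnA).
move=> /(_ _ fFU)[|l [_ fl]]; last by exists l.
suff : F (f @^-1` `[- M, M]) by [].
by apply: filterE => t /=; rewrite in_itv /= -ler_norml.
Qed.

End DirectionalDerivatives.

(** * The pointwise equation *)

Section PointwiseEquation.
Context {R : realType} {V : choiceType} (G : weighted_graph R V).
Variables (p : R) (p4 : 4 < p).
Implicit Types (u v : V -> R) (x y z : V).

Let p0 : 0 < p. Proof. by move: p4; lra. Qed.

Definition indicator x : V -> R := fun y => (y == x)%:R.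

Definition nbhd x : {fset V} := fset_set [set y | adj G x y].

Lemma mem_nbhd x y : (y \in nbhd x) = adj G x y.
Proof.
rewrite in_fset_set; last exact: adj_finite.
by apply/idP/idP => [/set_mem|] //; exact: mem_set.
Qed.

Lemma GammaE u v x : Gamma G u v x =
  (2 * mu G x)^-1 * \sum_(y <- nbhd x) (u y - u x) * (v y - v x).
Proof. by rewrite /Gamma (fsbig_finite _ _ (adj_finite G x)). Qed.

Lemma sum_fset1_eq0 (A : {fset V}) (f : V -> R) x : f x = 0 ->
  \sum_(y <- A) f y = \sum_(y <- (A `\ x)%fset) f y.
Proof.
move=> fx; have [xA|xA] := boolP (x \in A).
  by rewrite (big_fsetD1 x xA) /= fx add0r.
by rewrite mem_fsetD1.
Qed.

Lemma Gamma_indicator u x y : y != x ->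
  Gamma G u (indicator x) y * mu G y = if adj G x y then 2^-1 * (u x - u y) else 0.
Proof.
move=> yx; have m0 := mu_gt0 G y.
have E z : (u z - u y) * (indicator x z - indicator x y) = (u z - u y) * indicator x z.
  by rewrite /indicator (negbTE yx) subr0.
rewrite GammaE; under eq_bigr do rewrite E.
have E0 (A : {fset V}) : x \notin A -> \sum_(z <- A) (u z - u y) * indicator x z = 0.
  move=> xA; rewrite big_seq big1 // => z zA; rewrite /indicator.
  by have [zx|] := eqVneq z x; [move: xA; rewrite -zx zA|rewrite mulr0].
case: ifP => xy.
  have xN : x \in nbhd y by rewrite mem_nbhd adj_sym.
  rewrite (big_fsetD1 x xN) /= E0 ?inE ?eqxx // addr0 /indicator eqxx mulr1.
  by field; rewrite gt_eqF.
by rewrite E0 ?mulr0 ?mul0r // mem_nbhd adj_sym xy.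
Qed.

Lemma Gamma_indicator_self u x :
  Gamma G u (indicator x) x * mu G x = - (2^-1 * \sum_(y <- nbhd x) (u y - u x)).
Proof.
have m0 := mu_gt0 G x; rewrite GammaE.
have -> : \sum_(y <- nbhd x) (u y - u x) * (indicator x y - indicator x x) =
    - \sum_(y <- nbhd x) (u y - u x).
  rewrite -sumrN; apply: eq_bigr => y _; rewrite /indicator eqxx.
  by have [->|_] := eqVneq y x; rewrite ?subrr ?mul0r ?oppr0 // sub0r mulrN1.
by field; rewrite gt_eqF.
Qed.

(** Discrete integration by parts against the indicator of [x]: the point [x] yields the weight
    [grad u x ^ (p - 2)] on each edge, the neighbour [y] yields [grad u y ^ (p - 2)], and the two
    add up to the symmetric weight of [plap]. *)
Lemma sum_grad_Gamma_indicator u x :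
  \sum_(y <- (x |` nbhd x)%fset) grad G u y `^ (p - 2) * (Gamma G u (indicator x) y * mu G y) =
  - (mu G x * plap G p u x).
Proof.
have m0 := mu_gt0 G x.
rewrite (big_fsetD1 x) ?inE ?eqxx //= Gamma_indicator_self.
have -> : ((x |` nbhd x) `\ x = nbhd x `\ x)%fset.
  by apply/fsetP => y; rewrite !inE; case: eqP.
have -> : \sum_(y <- (nbhd x `\ x)%fset) grad G u y `^ (p - 2) * (Gamma G u (indicator x) y * mu G y) =
   - (2^-1 * \sum_(y <- nbhd x) grad G u y `^ (p - 2) * (u y - u x)).
  (* With a loop [x] is its own neighbour, but its term in the sum is zero. *)
  rewrite (@sum_fset1_eq0 (nbhd x) _ x) ?subrr ?mulr0 // mulr_sumr -sumrN.
  apply: eq_big_seq => y; rewrite !inE => /andP[yx yN].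
  by rewrite Gamma_indicator // -mem_nbhd yN; ring.
rewrite /plap (fsbig_finite _ _ (adj_finite G x)) -/(nbhd x).
under [in RHS]eq_bigr do rewrite mulrDl.
rewrite [in RHS]big_split /= -mulr_sumr; field; rewrite gt_eqF //.
Qed.

Lemma is_derive_sum_seq (I : Type) (r : seq I) (f : I -> R -> R) (d : I -> R) (s : R) :
  (forall i, is_derive s 1 (f i) (d i)) ->
  is_derive s 1 (fun t => \sum_(i <- r) f i t) (\sum_(i <- r) d i).
Proof.
move=> fd; elim: r => [|i r IH].
  by rewrite big_nil; under eq_fun do rewrite big_nil; exact: is_derive_cst.
by rewrite big_cons; under eq_fun do rewrite big_cons; exact: is_deriveDf.
Qed.

(** The contribution of [y] to [p] times the energy, without the norm of [v], which does not change
    when only [u] varies. *)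
Definition local_energy (w : V -> R) u v y :=
  (density G p w u y - `|u y| `^ (p - 2) * sqln (v y) - `|v y| `^ (p - 2) * sqln (u y)) * mu G y.

Definition local_derivative (w : V -> R) u v x y :=
  p * (grad G u y `^ (p - 2) * (Gamma G u (indicator x) y * mu G y)) +
  (w y * (p * `|u y| `^ (p - 2) * u y)
   - (p - 2) * `|u y| `^ (p - 4) * u y * sqln (v y)
   - `|v y| `^ (p - 2) * (2 * u y * ln (u y ^+ 2) + 2 * u y)) * indicator x y * mu G y.

Lemma is_derive_local_energy w u v x y :
  is_derive (0 : R) 1 (fun s : R => local_energy w (u + s *: indicator x) v y)
    (local_derivative w u v x y).
Proof.
have dU : is_derive (0 : R) 1 (fun s : R => u y + indicator x y * s : R) (indicator x y).
  have h := is_deriveZf (indicator x y) (is_derive_id (0 : R) (1 : R)).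
  have := is_deriveDf (is_derive_cst (u y) (0 : R) (1 : R)) h.
  by rewrite mulr1 add0r.
have U0 : u y + indicator x y * 0 = u y by rewrite mulr0 addr0.
have comp (g dg : R -> R) : (forall s : R, is_derive s 1 g (dg s)) ->
    is_derive (0 : R) 1 (fun s : R => g (u y + indicator x y * s) : R) (dg (u y) * indicator x y).
  by move=> gd; rewrite -{2}U0; exact: (is_derive1_comp (f := g) (gd _) dU).
have dpow q (q1 : 1 < q) := comp (fun s => `|s| `^ q) _ (fun s => is_derive_normr_powR s q1).
have dln := comp _ _ (@is_derive_sqln R).
have p2 : 1 < p - 2 by move: p4; lra.
have ph : 1 < p / 2 by move: p4; lra.
have p1 : 1 < p by move: p4; lra.
have uE s : (u + s *: indicator x) y = u y + indicator x y * s.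
  by rewrite fctE /GRing.scale /= mulrC.
(* Along the line [Gamma] is a quadratic polynomial in [s], so [grad ^ p] is differentiated as its
   power [p / 2]. *)
pose Q (s : R) := Gamma G u u y + (2 * Gamma G u (indicator x) y * s + Gamma G (indicator x) (indicator x) y * s ^+ 2).
have QE s : Gamma G (u + s *: indicator x) (u + s *: indicator x) y = Q s.
  by have := GammaDD G y u (indicator x) 1 s; rewrite !scale1r => ->; rewrite /Q; ring.
have dQ : is_derive (0 : R) 1 Q (2 * Gamma G u (indicator x) y).
  have h1 := is_deriveZf (2 * Gamma G u (indicator x) y) (is_derive_id (0 : R) (1 : R)).
  have h2 := is_deriveZf (Gamma G (indicator x) (indicator x) y) (is_derive_sqr (0 : R)).
  have := is_deriveDf (is_derive_cst (Gamma G u u y) (0 : R) (1 : R)) (is_deriveDf h1 h2).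
  by rewrite !mulr0 add0r addr0 mulr1.
have Q0 : Q 0 = Gamma G u u y by rewrite /Q expr0n /= !mulr0 !addr0.
have dG : is_derive (0 : R) 1 (fun s : R => `|Q s| `^ (p / 2) : R)
    (p * (grad G u y `^ (p - 2) * Gamma G u (indicator x) y)).
  have := is_derive1_comp (f := fun s : R => `|s| `^ (p / 2) : R) (is_derive_normr_powR (Q 0) ph) dQ.
  rewrite Q0 (_ : p / 2 * _ * _ * _ = p * (grad G u y `^ (p - 2) * Gamma G u (indicator x) y)) //.
  rewrite (ger0_norm (Gamma_ge0 G y u)).
  rewrite (_ : p / 2 * _ * _ * _ = p * (Gamma G u u y `^ (p / 2 - 2) * Gamma G u u y * Gamma G u (indicator x) y)); last by field.
  rewrite powRB2 ?Gamma_ge0 // -grad_sqr -powR_mulrn ?grad_ge0 // -powRrM.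
  by congr (_ * (_ `^ _ * _)); field.
have E s : local_energy w (u + s *: indicator x) v y =
  mu G y * ((`|Q s| `^ (p / 2) + w y * `|u y + indicator x y * s| `^ p) +
  (- sqln (v y) * `|u y + indicator x y * s| `^ (p - 2) +
   - `|v y| `^ (p - 2) * sqln (u y + indicator x y * s))).
  by rewrite /local_energy density_GammaE uE QE; ring.
under eq_fun do rewrite E.
have := is_deriveZf (mu G y) (is_deriveDf (is_deriveDf dG (is_deriveZf (w y) (dpow _ p1)))
  (is_deriveDf (is_deriveZf (- sqln (v y)) (dpow _ p2)) (is_deriveZf (- `|v y| `^ (p - 2)) dln))).
rewrite (_ : p - 2 - 2 = p - 4); last by ring.
congr (is_derive _ _ _ _); rewrite /local_derivative; ring.
Qed.

Lemma local_energy_eq w u v x y (s : R) : y \notin (x |` nbhd x)%fset ->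
  local_energy w (u + s *: indicator x) v y = local_energy w u v y.
Proof.
rewrite !inE negb_or mem_nbhd => /andP[yx xy].
have uE z : z != x -> (u + s *: indicator x) z = u z.
  move=> zx; have -> : (u + s *: indicator x) z = u z + s * indicator x z by [].
  by rewrite /indicator (negbTE zx) mulr0 addr0.
move: (u + s *: indicator x) uE => u' uE.
have gE : grad G u' y = grad G u y.
  rewrite /grad !GammaE; congr (Num.sqrt (_ * _)); apply: eq_big_seq => z.
  rewrite mem_nbhd => yz; have zx : z != x.
    by apply: contra xy => /eqP <-; rewrite adj_sym.
  by rewrite (uE z zx) (uE y yx).
by rewrite /local_energy /density gE (uE y yx).
Qed.

(* Testing criticality against the indicator of [x] only involves [x] and its neighbours. *)
Lemma equation_of_critical w u v x (phi : R -> R) :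
  (forall s, has_sum (local_energy w (u + s *: indicator x) v) (phi s)) ->
  is_derive (0 : R) 1 phi 0 -> equation G p w u v x.
Proof.
move=> phiE dphi; pose A := (x |` nbhd x)%fset.
have phiA s : phi s = phi 0 - \sum_(y <- A) local_energy w u v y +
    \sum_(y <- A) local_energy w (u + s *: indicator x) v y.
  have h := has_sumB (phiE s) (phiE 0); rewrite scale0r addr0 in h.
  have hA y : y \notin A ->
      local_energy w (u + s *: indicator x) v y - local_energy w u v y = 0.
    by move=> yA; rewrite local_energy_eq // subrr.
  have := has_sum_unique h (has_sum_finite hA); rewrite sumrB => E.
  by rewrite -addrA (addrC (- _)) -E addrC subrK.
have d1 := is_derive_sum_seq A (is_derive_local_energy w u v x).
have := is_deriveDf (is_derive_cst (phi 0 - \sum_(y <- A) local_energy w u v y) (0 : R) (1 : R)) d1.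
rewrite add0r => d2.
have {}d2 : is_derive (0 : R) 1 phi (\sum_(y <- A) local_derivative w u v x y).
  have -> : phi = (fun s => cst (phi 0 - \sum_(y <- A) local_energy w u v y) s +
      \sum_(y <- A) local_energy w (u + s *: indicator x) v y) by apply/funext => s; exact: phiA.
  exact: d2.
have := is_derive_unique d2 dphi; rewrite big_split /= -mulr_sumr sum_grad_Gamma_indicator.
rewrite (big_fsetD1 x) ?inE ?eqxx //= big1_seq ?addr0; last first.
  move=> y /=; rewrite !inE => /andP[yx _].
  by rewrite /indicator (negbTE yx) mulr0 mul0r.
rewrite /indicator eqxx mulr1 => h.
have m0 := mu_gt0 G x; have pm : p * mu G x != 0 by rewrite gt_eqF // mulr_gt0.
(* The vanishing derivative is [p * mu x] times the difference of the two sides of the equation. *)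
apply: (mulfI pm); rewrite /equation; apply/eqP; rewrite -subr_eq0; apply/eqP.
rewrite -[RHS]h /sqln; field; rewrite gt_eqF //.
Qed.

End PointwiseEquation.

(** * The variational problem *)

Section Functional.
Context {R : realType} {V : choiceType} (G : weighted_graph R V) {H : normedModType R}.
Variables (p : R) (p4 : 4 < p).
Implicit Types (w h z : H) (e t : R) (x : V).
Variables (a b c : V -> R) (c0 m0 S : R).
Hypotheses (c0_gt0 : 0 < c0) (c_ge : forall x, c0 <= c x).
Hypotheses (c_a : forall x, c x <= a x) (c_b : forall x, c x <= b x).
Hypotheses (m0_gt0 : 0 < m0) (mu_ge : forall x, m0 <= mu G x).
Hypothesis inv_has_sum : has_sum (fun x => (c x)^-1 * mu G x) S.
Variables (U1 U2 : H -> V -> R).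
Hypotheses (U1E : energy_map G p a U1) (U2E : energy_map G p b U2).
Hypothesis normE : forall w,
  `|w| = total G p a (U1 w) `^ p^-1 + total G p b (U2 w) `^ p^-1.
Hypothesis surjective_pair : forall u v, finite_energy G p a u -> finite_energy G p b v ->
  exists w, U1 w = u /\ U2 w = v.

Local Opaque total coupling.

Let p0 : 0 < p. Proof. by move: p4; lra. Qed.
Let p1 : 1 < p. Proof. by move: p4; lra. Qed.
Let a_ge0 x : 0 <= a x.
Proof. by apply: le_trans (c_a x); apply: le_trans (c_ge x); exact: ltW. Qed.
Let b_ge0 x : 0 <= b x.
Proof. by apply: le_trans (c_b x); apply: le_trans (c_ge x); exact: ltW. Qed.
Let cm0 : 0 < c0 * m0. Proof. exact: mulr_gt0. Qed.

Definition norm_part w := total G p a (U1 w) + total G p b (U2 w).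

Definition log_part w := coupling G p (@sqln R) (U1 w) (U2 w) +
  coupling G p (@sqln R) (U2 w) (U1 w).

(** The [B] of the overview; [scaled_energy] below is its [A]. *)
Definition mass w := coupling G p (fun s => s ^+ 2) (U1 w) (U2 w) +
  coupling G p (fun s => s ^+ 2) (U2 w) (U1 w).

Definition scaled_energy w := norm_part w - log_part w.

Let U1K w : Lp_bounded G p c (`|w| `^ p) (U1 w).
Proof. exact: (energy_map_Lp c0_gt0 c_ge c_a U1E). Qed.
Let U2K w : Lp_bounded G p c (`|w| `^ p) (U2 w).
Proof. exact: (energy_map_Lp c0_gt0 c_ge c_b U2E). Qed.

Let U1f w : finite_energy G p a (U1 w). Proof. by case: U1E. Qed.
Let U2f w : finite_energy G p b (U2 w). Proof. by case: U2E. Qed.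

Lemma norm_part_ge0 w : 0 <= norm_part w.
Proof. by rewrite addr_ge0 // total_ge0. Qed.

Lemma norm_part_Lp w : Lp_bounded G p c (norm_part w) (U1 w) /\ Lp_bounded G p c (norm_part w) (U2 w).
Proof.
split; [apply: (Lp_bounded_finite_energy c0_gt0 c_ge c_a) => //
       |apply: (Lp_bounded_finite_energy c0_gt0 c_ge c_b) => //].
  by rewrite lerDl total_ge0.
by rewrite lerDr total_ge0.
Qed.

(** [|w|] is the sum of the [p]-th roots of the two totals, so [|w| / 2] is their midpoint. *)
Lemma norm_part_ge w : (`|w| / 2) `^ p <= norm_part w.
Proof.
have root (s : R) : 0 <= s -> (s `^ p^-1) `^ p = s.
  by move=> s0; rewrite -powRrM mulVf ?gt_eqF // powRr1.
rewrite normE; apply: le_trans (powR_midpoint_le p0 (powR_ge0 _ _) (powR_ge0 _ _)) _.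
have sa := total_ge0 G p a_ge0 (U1 w); have sb := total_ge0 G p b_ge0 (U2 w).
rewrite /norm_part; move: sa sb; generalize (total G p a (U1 w)) (total G p b (U2 w)).
by move=> s s' s0 s'0; rewrite (root _ s0) (root _ s'0).
Qed.

Lemma norm_part_gt0 w : w != 0 -> 0 < norm_part w.
Proof.
by move=> w0; apply: lt_le_trans (norm_part_ge w); rewrite powR_gt0 // divr_gt0 // normr_gt0.
Qed.

Lemma scaled_energy_differentiable w : differentiable scaled_energy w.
Proof.
apply: differentiableB; apply: differentiableD.
- exact: (differentiable_total p4 c0_gt0 c_ge m0_gt0 mu_ge c_a U1E).
- exact: (differentiable_total p4 c0_gt0 c_ge m0_gt0 mu_ge c_b U2E).
- exact: (differentiable_coupling p4 c0_gt0 c_ge m0_gt0 mu_ge inv_has_sum w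
    (@locally_lipschitz_sqln R) (@is_derive_sqln R) c_a c_b U1E U2E).
- exact: (differentiable_coupling p4 c0_gt0 c_ge m0_gt0 mu_ge inv_has_sum w
    (@locally_lipschitz_sqln R) (@is_derive_sqln R) c_b c_a U2E U1E).
Qed.

Lemma mass_differentiable w : differentiable mass w.
Proof.
apply: differentiableD.
- exact: (differentiable_coupling p4 c0_gt0 c_ge m0_gt0 mu_ge inv_has_sum w
    (@locally_lipschitz_sqr R) (@is_derive_sqr R) c_a c_b U1E U2E).
- exact: (differentiable_coupling p4 c0_gt0 c_ge m0_gt0 mu_ge inv_has_sum w
    (@locally_lipschitz_sqr R) (@is_derive_sqr R) c_b c_a U2E U1E).
Qed.

Let pair_ge0 u v K uK vK :=
  @coupling_sqr_ge0 _ _ G p p4 c c0 m0 S c0_gt0 c_ge m0_gt0 mu_ge inv_has_sum K u v uK vK.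

Lemma mass_ge0 w : 0 <= mass w.
Proof. by rewrite addr_ge0 // (pair_ge0 (U1K w) (U2K w), pair_ge0 (U2K w) (U1K w)). Qed.

Lemma log_part_eq0 w : mass w = 0 -> log_part w = 0.
Proof.
move=> /eqP; rewrite paddr_eq0 ?(pair_ge0 (U1K w) (U2K w), pair_ge0 (U2K w) (U1K w)) //.
have E u v K uK vK := @coupling_sqln_eq0 _ _ G p p4 c c0 m0 S c0_gt0 c_ge m0_gt0 mu_ge
  inv_has_sum K u v uK vK.
move=> /andP[/eqP m1 /eqP m2]; rewrite /log_part.
by rewrite (E _ _ _ (U1K w) (U2K w)) // (E _ _ _ (U2K w) (U1K w)) // addr0.
Qed.

Lemma massZ t w : 0 < t -> mass (t *: w) = t `^ p * mass w.
Proof.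
move=> t0; have [_ U1Z _ _] := U1E; have [_ U2Z _ _] := U2E.
have E u v K uK vK := @couplingZ_sqr _ _ G p p4 c c0 m0 S c0_gt0 c_ge m0_gt0 mu_ge
  inv_has_sum K t u v t0 uK vK.
by rewrite /mass U1Z U2Z (E _ _ _ (U1K w) (U2K w)) (E _ _ _ (U2K w) (U1K w)) mulrDr.
Qed.

Lemma scaled_energyZ t w : 0 < t ->
  scaled_energy (t *: w) = t `^ p * (scaled_energy w - ln (t ^+ 2) * mass w).
Proof.
move=> t0; have [_ U1Z _ _] := U1E; have [_ U2Z _ _] := U2E.
have E u v K uK vK := @couplingZ_sqln _ _ G p p4 c c0 m0 S c0_gt0 c_ge m0_gt0 mu_ge
  inv_has_sum K t u v t0 uK vK.
rewrite /scaled_energy /norm_part /log_part /mass U1Z U2Z !totalZ // (gtr0_norm t0).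
rewrite (E _ _ _ (U1K w) (U2K w)) (E _ _ _ (U2K w) (U1K w)); ring.
Qed.

Lemma log_part_le L w : (forall x, U1 w x != 0 -> ln (U1 w x ^+ 2) <= L) ->
  (forall x, U2 w x != 0 -> ln (U2 w x ^+ 2) <= L) -> log_part w <= L * mass w.
Proof.
move=> L1 L2; rewrite /log_part /mass mulrDr.
have E u v K uK vK := @coupling_sqln_le _ _ G p p4 c c0 m0 S c0_gt0 c_ge m0_gt0 mu_ge
  inv_has_sum K L u v uK vK.
by apply: lerD; [exact: (E _ _ _ (U1K w) (U2K w)) | exact: (E _ _ _ (U2K w) (U1K w))].
Qed.

Lemma scaled_energy_coercive : exists2 C, 0 <= C &
  forall w, mass w = 1 -> norm_part w <= 2 * (scaled_energy w + C).
Proof.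
(* From [ln y <= k y - 1 - ln k] with [y = |u x| ^ p <= K / (c0 * m0)]: this [k] bounds
   [ln (u x ^ 2)] by [K / 2 + C], so on mass 1 the logarithmic part absorbs only half of the norm
   part. *)
pose k := p * (c0 * m0) / 4; have k0 : 0 < k by rewrite divr_gt0 // mulr_gt0.
pose C := `|2 / p * (1 + ln k)|; exists C => [|w w1]; first exact: normr_ge0.
have bound K u x : Lp_bounded G p c K u -> u x != 0 -> ln (u x ^+ 2) <= K / 2 + C.
  move=> uK ux; have nx : 0 < `|u x| by rewrite normr_gt0.
  have yK := Lp_bounded_powR c0_gt0 c_ge m0_gt0 mu_ge x uK.
  have y0 : 0 < `|u x| `^ p by rewrite powR_gt0.
  have -> : ln (u x ^+ 2) = 2 / p * ln (`|u x| `^ p).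
    rewrite ln_powR -(real_normK (num_real (u x))) lnXn ?posrE //.
    by rewrite mulrA divfK ?gt_eqF // mulr_natl.
  have ky0 : 0 < k * `|u x| `^ p by rewrite mulr_gt0.
  have := ln_le_sub1 ky0; rewrite lnM ?posrE // => lk.
  have l1 : ln (`|u x| `^ p) <= k * (K / (c0 * m0)) - (1 + ln k).
    have : k * `|u x| `^ p <= k * (K / (c0 * m0)) by rewrite ler_wpM2l // ltW.
    by lra.
  have tp : 0 <= 2 / p by rewrite divr_ge0 // ltW.
  apply: (le_trans (ler_wpM2l tp l1)).
  have -> : 2 / p * (k * (K / (c0 * m0)) - (1 + ln k)) = K / 2 - 2 / p * (1 + ln k).
    by rewrite /k; field; rewrite !gt_eqF.
  by rewrite lerD2l /C -normrN; exact: ler_norm.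
have [N1 N2] := norm_part_Lp w.
have := @log_part_le (norm_part w / 2 + C) w (fun x => bound _ _ x N1) (fun x => bound _ _ x N2).
by rewrite w1 mulr1 /scaled_energy; lra.
Qed.

Lemma scaled_energy_small : exists2 r, 0 < r & forall w, `|w| <= r ->
  norm_part w <= scaled_energy w - 2 / p * mass w.
Proof.
pose K := (c0 * m0)^-1 `^ p^-1; have K0 : 0 < K by rewrite powR_gt0 // invr_gt0.
(* In this ball both components are at most [1 / e] in absolute value, so [ln (u ^ 2) <= -2] and the
   logarithmic part is at most [-2 * mass], which leaves room for [2 / p <= 2]. *)
exists (expR (-1) / K) => [|w wr]; first by rewrite divr_gt0 ?expR_gt0.
have bound u x : `|u x| <= K * `|w| -> u x != 0 -> ln (u x ^+ 2) <= - 2.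
  move=> uw ux; have nx : 0 < `|u x| by rewrite normr_gt0.
  rewrite -(real_normK (num_real (u x))) lnXn ?posrE //.
  have : ln `|u x| <= -1.
    rewrite -(expRK (-1)) ler_ln ?posrE ?expR_gt0 //; apply: (le_trans uw).
    by rewrite mulrC -ler_pdivlMr.
  by rewrite -mulr_natl; lra.
have B1 x := bound _ x (energy_map_sup p4 c0_gt0 c_ge m0_gt0 mu_ge c_a U1E w x).
have B2 x := bound _ x (energy_map_sup p4 c0_gt0 c_ge m0_gt0 mu_ge c_b U2E w x).
have := log_part_le B1 B2; rewrite /scaled_energy.
have tp : 2 / p <= 2 by rewrite ler_pdivrMr //; move: p4; lra.
have := ler_wpM2r (mass_ge0 w) tp; lra.
Qed.

Lemma mass_one_minimizer : (exists w, mass w = 1) ->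
  exists2 w, mass w = 1 & forall z, mass z = 1 -> scaled_energy w <= scaled_energy z.
Proof.
move=> [w1 mw1]; have [C C0 coer] := scaled_energy_coercive.
pose E : set R := [set scaled_energy z | z in [set z | mass z = 1]].
have EN : E !=set0 by exists (scaled_energy w1), w1.
have Elb : has_lbound E.
  exists (- C) => _ [z mz <-]; have := coer z mz; have := norm_part_ge0 z; lra.
have Ei : has_inf E by split.
pose m := inf E.
have mE z : mass z = 1 -> m <= scaled_energy z by move=> mz; apply: ge_inf => //; exists z.
have /choice[W WP] (n : nat) : exists w, mass w = 1 /\ scaled_energy w <= m + harmonic n.
  have [_ [w mw <-] wm] := inf_adherent (harmonic_gt0 n) Ei.
  by exists w; split => //; exact: ltW.
(* Coercivity along the minimising sequence, whose energies are at most [m + 1]. *)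
pose K := 2 * (m + 1 + C).
have NK n : norm_part (W n) <= K.
  have [mW AW] := WP n; apply: (le_trans (coer _ mW)).
  have : harmonic n <= 1 :> R by rewrite invf_le1 ?ler1n // ltr0n.
  by rewrite /K; lra.
have [F [FU oF]] := @ultraFilterLemma nat \oo _.
have FP : ProperFilter F by exact: ultra_proper.
have sup_bound K' f x : Lp_bounded G p c K' f -> `|f x| <= (K' / (c0 * m0)) `^ p^-1.
  exact: (Lp_bounded_sup p4 c0_gt0 c_ge m0_gt0 mu_ge x).
have LpK f : Lp_bounded G p c K f -> forall x, `|f x| <= (K / (c0 * m0)) `^ p^-1.
  by move=> fK x; exact: sup_bound.
have W1K n : Lp_bounded G p c K (U1 (W n)).
  by move=> A; have [h _] := norm_part_Lp (W n); exact: le_trans (h A) (NK n).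
have W2K n : Lp_bounded G p c K (U2 (W n)).
  by move=> A; have [_ h] := norm_part_Lp (W n); exact: le_trans (h A) (NK n).
have /choice[u uP] x : exists l : R, U1 (W n) x @[n --> F] --> l.
  exact: (ultra_bounded_cvg FU (fun n => LpK _ (W1K n) x)).
have /choice[v vP] x : exists l : R, U2 (W n) x @[n --> F] --> l.
  exact: (ultra_bounded_cvg FU (fun n => LpK _ (W2K n) x)).
have cvgd wt f g A : (forall x, f n x @[n --> F] --> g x) ->
    \sum_(x <- A) density G p wt (f n) x * mu G x @[n --> F] -->
    \sum_(x <- A) density G p wt g x * mu G x.
  by move=> fg; apply: cvg_sum_seq => x; apply: cvgMr_tmp; apply: cvg_density.
have [uf uK] : finite_energy G p a u /\ total G p a u <= K.
  apply: finite_energy_bounded => // A.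
  apply: (ler_cvg_to (cvgd a _ _ A uP) (cvg_cst K)); apply: nearW => n.
  apply: (le_trans (ler_sum_total a_ge0 _ (U1f (W n)))); apply: le_trans (NK n).
  by rewrite lerDl total_ge0.
have [vf vK] : finite_energy G p b v /\ total G p b v <= K.
  apply: finite_energy_bounded => // A.
  apply: (ler_cvg_to (cvgd b _ _ A vP) (cvg_cst K)); apply: nearW => n.
  apply: (le_trans (ler_sum_total b_ge0 _ (U2f (W n)))); apply: le_trans (NK n).
  by rewrite lerDr total_ge0.
have uKL := Lp_bounded_finite_energy c0_gt0 c_ge c_a uf uK.
have vKL := Lp_bounded_finite_energy c0_gt0 c_ge c_b vf vK.
have [w [wu wv]] := surjective_pair uf vf.
have cc g dg gL gd f f' l l' := @cvg_coupling _ _ G nat F FP p p4 c c0 m0 S c0_gt0 c_ge m0_gt0 mu_ge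
  inv_has_sum K g dg f f' l l' gL gd.
have mcvg : mass (W n) @[n --> F] --> mass w.
  rewrite /mass wu wv; apply: cvgD.
    exact: (cc _ _ (@locally_lipschitz_sqr R) (@is_derive_sqr R) _ _ _ _ W1K W2K uKL vKL uP vP).
  exact: (cc _ _ (@locally_lipschitz_sqr R) (@is_derive_sqr R) _ _ _ _ W2K W1K vKL uKL vP uP).
have lcvg : log_part (W n) @[n --> F] --> log_part w.
  rewrite /log_part wu wv; apply: cvgD.
    exact: (cc _ _ (@locally_lipschitz_sqln R) (@is_derive_sqln R) _ _ _ _ W1K W2K uKL vKL uP vP).
  exact: (cc _ _ (@locally_lipschitz_sqln R) (@is_derive_sqln R) _ _ _ _ W2K W1K vKL uKL vP uP).
exists w.
  apply: cvg_unique mcvg _ => //.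
  have -> : (fun n => mass (W n)) = cst 1 by apply/funext => n; case: (WP n).
  exact: cvg_cst.
move=> z /mE; apply: le_trans; rewrite /scaled_energy lerBlDr.
(* Lower semicontinuity: each finite sum of the densities of [W n] is at most
   [m + harmonic n + log_part (W n)]. Since the logarithmic part converges, the limit obeys
   [norm_part w <= m + log_part w]. *)
have Dcvg : m + harmonic n + log_part (W n) @[n --> F] --> m + 0 + log_part w.
  apply: cvgD => //; apply: cvgD; first exact: cvg_cst.
  by move=> B /(@cvg_harmonic R); exact: oF.
have d0 x : 0 <= density G p a u x * mu G x + density G p b v x * mu G x.
  by rewrite addr_ge0 ?density_mu_ge0.
have [|s ds sm] := @bounded_has_sum _ _ _ (m + 0 + log_part w) d0.
  move=> A; rewrite big_split /=.
  apply: (ler_cvg_to (cvgD (cvgd a _ _ A uP) (cvgd b _ _ A vP)) Dcvg); apply: nearW => n.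
  have := lerD (ler_sum_total a_ge0 A (U1f (W n))) (ler_sum_total b_ge0 A (U2f (W n))).
  rewrite -/(norm_part (W n)) => /le_trans; apply.
  by have [_] := WP n; rewrite /scaled_energy lerBlDr.
have ds' := has_sumD (total_has_sum a_ge0 uf) (total_has_sum b_ge0 vf).
have nw : norm_part w = s.
  by rewrite /norm_part wu wv; exact: has_sum_unique ds' ds.
by rewrite nw; move: sm; rewrite addr0.
Qed.

(** Yields the values at 0 from the scaling laws, through [2 *: 0 = 0]. *)
Let powR2_fixpoint (y : R) : y = 2 `^ p * y -> y = 0.
Proof.
have h : (1 : R) `^ p < 2 `^ p by rewrite gt0_ltr_powR ?nnegrE // ltr1n.
rewrite powR1 in h.
move=> /eqP; rewrite -subr_eq0 -{1}(mul1r y) -mulrBl mulf_eq0 subr_eq0 lt_eqF //=.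
by move=> /eqP.
Qed.

Lemma mass_0 : mass 0 = 0.
Proof. by apply: powR2_fixpoint; rewrite -massZ ?scaler0. Qed.

Lemma scaled_energy_0 : scaled_energy 0 = 0.
Proof.
apply: powR2_fixpoint; have t20 : (0 : R) < 2 by [].
by have := scaled_energyZ 0 t20; rewrite scaler0 mass_0 mulr0 subr0.
Qed.

(** Zero mass would kill the logarithmic part, leaving [norm_part z = 0]. *)
Lemma nehari_mass_gt0 z : z != 0 -> scaled_energy z = 2 / p * mass z -> 0 < mass z.
Proof.
move=> z0 zN; rewrite lt_neqAle mass_ge0 andbT eq_sym; apply/eqP => m0'.
have := norm_part_gt0 z0; move: zN.
by rewrite /scaled_energy (log_part_eq0 m0') m0' subr0 mulr0 => ->; rewrite ltxx.
Qed.

(* [A / B + (2 / p) ln B] is the 0-homogeneous extension of the scaled energy [A] from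
   the unit sphere of the mass [B]; its minimisers, rescaled, solve the Nehari problem. *)
Lemma nehari_minimizer : (exists w, mass w = 1) -> exists w0,
  [/\ 0 < mass w0, scaled_energy w0 = 2 / p * mass w0 &
   forall z, 0 < mass z -> 2 / p + 2 / p * ln (mass w0) <=
     scaled_energy z / mass z + 2 / p * ln (mass z)].
Proof.
move=> /mass_one_minimizer[w mw wmin].
(* Solves [A w - ln (t ^ 2) = 2 / p], which is the Nehari equation for [t *: w] when [w] has mass
   1. *)
pose t := expR ((scaled_energy w - 2 / p) / 2); have t0 : 0 < t by exact: expR_gt0.
have lt : ln (t ^+ 2) = scaled_energy w - 2 / p.
  by rewrite lnXn ?posrE // expRK mulr2n -splitr.
have lnmass z : 0 < mass z -> ln ((mass z `^ p^-1) ^+ 2) = 2 / p * ln (mass z).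
  by move=> mz; rewrite lnXn ?posrE ?powR_gt0 // ln_powR mulr2n; ring.
have mt : mass (t *: w) = t `^ p by rewrite massZ // mw mulr1.
exists (t *: w); rewrite scaled_energyZ // mt mw mulr1 lt; split.
- by rewrite powR_gt0.
- by rewrite mulrC; congr (_ * _); ring.
move=> z mz; rewrite ln_powR.
have -> : 2 / p + 2 / p * (p * ln t) = scaled_energy w.
  rewrite mulrA divfK ?gt_eqF // (_ : 2 * ln t = ln (t ^+ 2)); last first.
    by rewrite lnXn ?posrE // mulr2n; ring.
  by rewrite lt; ring.
pose s := (mass z `^ p^-1)^-1.
have sp : s `^ p = (mass z)^-1.
  rewrite /s -[(_ `^ p^-1)^-1]div1r powR_div ?powR_gt0 // powR1 div1r.
  by rewrite -powRrM mulVf ?gt_eqF // powRr1 // ltW.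
have s0 : 0 < s by rewrite invr_gt0 powR_gt0.
have ms : mass (s *: z) = 1 by rewrite massZ // sp mulVf // gt_eqF.
apply: (le_trans (wmin _ ms)); rewrite scaled_energyZ // sp.
have -> : ln (s ^+ 2) = - (2 / p * ln (mass z)).
  by rewrite /s exprVn lnV ?posrE ?exprn_gt0 ?powR_gt0 // lnmass.
by rewrite le_eqVlt; apply/orP; left; apply/eqP; field; rewrite !gt_eqF.
Qed.

(** Differentiate [A ((1 + s) z)] at [s = 0] through the scaling law. The absolute value in
    [|1 + s| ^ p], harmless near 0, allows reuse of [is_derive_normr_powR]. *)
Lemma diff_scaled_energy_self z :
  'd scaled_energy z z = p * (scaled_energy z - 2 / p * mass z).
Proof.
have h := is_derive_along z (scaled_energy_differentiable z).
apply: (is_derive_unique h).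
apply: (@near_eq_is_derive _ _ _ (fun s : R =>
    `|1 + s| `^ p * (scaled_energy z - ln ((1 + s) ^+ 2) * mass z))).
  near=> s; have s0 : 0 < 1 + s.
    by rewrite -ltrBlDl sub0r; near: s; apply: lt_nbhsr; rewrite ltrN10.
  by rewrite gtr0_norm // -{3}(scale1r z) -scalerDl scaled_energyZ.
have d1 := is_derive_addl 1 (0 : R).
have d2 : is_derive (0 : R) 1 (fun s : R => `|1 + s| `^ p : R)
    (p * `|1 + 0| `^ (p - 2) * (1 + 0) * 1 : R).
  exact: (is_derive1_comp (f := fun x : R => `|x| `^ p : R) (is_derive_normr_powR (1 + 0) p1) d1).
have l1 : 0 < ((1 : R) + 0) ^+ 2 by rewrite addr0 expr1n.
have d3 : is_derive (0 : R) 1 (fun s : R => (1 + s) ^+ 2 : R) (2 * (1 + 0) * 1 : R).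
  exact: (is_derive1_comp (f := fun x : R => x ^+ 2 : R) (is_derive_sqr (1 + 0)) d1).
have {}d3 : is_derive (0 : R) 1 (fun s : R => ln ((1 + s) ^+ 2) : R)
    (((1 + 0) ^+ 2)^-1 * (2 * (1 + 0) * 1) : R).
  exact: (is_derive1_comp (f := @ln R) (g := fun s : R => (1 + s) ^+ 2 : R) (is_derive1_ln l1) d3).
have d4 := is_deriveDf (is_derive_cst (scaled_energy z) (0 : R) (1 : R)) (is_deriveZf (- mass z) d3).
have d5 := is_deriveMf d2 d4.
have -> : p * (scaled_energy z - 2 / p * mass z) =
  p * `|1 + 0| `^ (p - 2) * (1 + 0) * 1 *
  (scaled_energy z + - mass z * ln ((1 + 0) ^+ 2)) +
  `|1 + 0| `^ p * (0 + - mass z * (((1 + 0) ^+ 2)^-1 * (2 * (1 + 0) * 1))).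
  rewrite !addr0 !add0r normr1 !powR1 expr1n ln1 invr1; field; rewrite gt_eqF //.
suff -> : (fun s : R => `|1 + s| `^ p * (scaled_energy z - ln ((1 + s) ^+ 2) * mass z)) =
    (fun s : R => `|1 + s| `^ p * (cst (scaled_energy z) s + - mass z * ln ((1 + s) ^+ 2))) by exact: d5.
by apply/funext => s; rewrite mulNr (mulrC (mass z)).
Unshelve. all: by end_near. Qed.

(** Multiplied by [B > 0], minimality says that [A - D B + (2 / p) B ln B] is nonnegative along the
    line near [s = 0], with value 0 there. For [D = 2 / p + (2 / p) ln B(0)] the derivatives of [B]
    cancel, leaving that of [A]. *)
Lemma nehari_minimizer_critical w0 : 0 < mass w0 -> scaled_energy w0 = 2 / p * mass w0 ->
  (forall z, 0 < mass z -> 2 / p + 2 / p * ln (mass w0) <=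
     scaled_energy z / mass z + 2 / p * ln (mass z)) ->
  forall h, 'd scaled_energy w0 h = 0.
Proof.
move=> m0' wN wmin h.
pose D := 2 / p + 2 / p * ln (mass w0).
pose B (s : R) := mass (w0 + s *: h); pose A (s : R) := scaled_energy (w0 + s *: h).
have B0 : B 0 = mass w0 by rewrite /B scale0r addr0.
have A0 : A 0 = scaled_energy w0 by rewrite /A scale0r addr0.
have dA : is_derive (0 : R) 1 A ('d scaled_energy w0 h).
  exact: is_derive_along (scaled_energy_differentiable w0).
have dB : is_derive (0 : R) 1 B ('d mass w0 h).
  exact: is_derive_along (mass_differentiable w0).
have BP : 0 < B 0 by rewrite B0.
have dl : is_derive (0 : R) 1 (fun s => ln (B s)) ((B 0)^-1 * 'd mass w0 h).
  exact: (is_derive1_comp (f := @ln R) (g := B) (is_derive1_ln BP) dB).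
have d1 := is_deriveDf (is_deriveDf dA (is_deriveZf (- D) dB))
  (is_deriveZf (2 / p) (is_deriveMf dB dl)).
rewrite B0 in d1.
have [r r0 rB] : exists2 r : R, 0 < r & forall s, `|s| <= r -> 0 < B s.
  have /derivable1_diffP/differentiable_continuous : derivable B 0 1 by case: dB.
  move=> /cvgr_gt/(_ _ BP)/nbhs_normP[r /= r0 rB]; exists (r / 2); first by rewrite divr_gt0.
  move=> s sr; apply: rB; rewrite /= sub0r normrN; apply: (le_lt_trans sr).
  by rewrite ltr_pdivrMr // mulr_natr mulr2n ltrDl.
have := is_derive_min_eq0 d1 r0; rewrite /= B0 A0 => H0.
have alg (x y m l q : R) : m != 0 ->
  x = x + - (q + q * l) * y + q * (y * l + m * (m^-1 * y)).
  by move=> m_neq0; rewrite mulVKf //; ring.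
have -> : 'd scaled_energy w0 h = 'd scaled_energy w0 h + - D * 'd mass w0 h +
   2 / p * ('d mass w0 h * ln (mass w0) + mass w0 * ((mass w0)^-1 * 'd mass w0 h)).
  exact: alg (lt0r_neq0 m0').
apply: H0 => s sr; have Bs := rB s sr.
have := wmin _ Bs; rewrite -/(A s) -/(B s) -/D wN => /(ler_wpM2l (ltW Bs)).
rewrite [leRHS]mulrDr (mulrCA (B s) (A s)) mulfV ?gt_eqF // mulr1 => h1.
have -> : 2 / p * mass w0 + - D * mass w0 + 2 / p * (mass w0 * ln (mass w0)) = 0.
  by rewrite /D; ring.
by move: h1; rewrite -subr_ge0; congr (0 <= _); ring.
Qed.

(** Take the indicator of [x0] in both components: its mass is at least [mu x0 > 0] and can be
    rescaled to 1. *)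
Lemma exists_mass_one (x0 : V) : exists w, mass w = 1.
Proof.
pose d x : R := (x == x0)%:R.
have dC : Cc d.
  apply: (@sub_finite_set _ _ [set x0]); last exact: finite_set1.
  by move=> x; have [->|xx0] := eqVneq x x0; rewrite /= /d ?(negbTE xx0) ?eqxx.
have [w [w1 w2]] := surjective_pair (Cc_finite_energy G p1 a_ge0 dC) (Cc_finite_energy G p1 b_ge0 dC).
have mw : 0 < mass w.
  have W1 := U1K w; have W2 := U2K w; rewrite w1 in W1; rewrite w2 in W2.
  have cs := coupling_has_sum p4 c0_gt0 c_ge m0_gt0 mu_ge inv_has_sum (@locally_lipschitz_sqr R) W1 W2.
  have t0 x : 0 <= `|d x| `^ (p - 2) * d x ^+ 2 * mu G x.
    by rewrite mulr_ge0 ?(ltW (mu_gt0 G x)) // mulr_ge0 ?powR_ge0 // sqr_ge0.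
  have := ler_fset_has_sum [fset x0]%fset t0 cs.
  rewrite big_seq_fset1 {1 2}/d eqxx normr1 powR1 expr1n !mul1r => h.
  rewrite /mass w1 w2; apply: (@lt_le_trans _ _ (mu G x0)); first exact: mu_gt0.
  by apply: (le_trans h); rewrite lerDl (le_trans _ h) // ltW // mu_gt0.
pose s := (mass w `^ p^-1)^-1; exists (s *: w).
have mp : 0 < mass w `^ p^-1 by rewrite powR_gt0.
rewrite massZ ?invr_gt0 // /s -[(_ `^ p^-1)^-1]div1r powR_div // powR1 div1r.
by rewrite -powRrM mulVf ?gt_eqF // powRr1 ?(ltW mw) // mulVf // gt_eqF.
Qed.

Definition functional w := p^-1 * scaled_energy w.

Lemma functional_differentiable w : differentiable functional w.
Proof. exact: differentiableZ (scaled_energy_differentiable w). Qed.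

Lemma diff_functional w h : 'd functional w h = p^-1 * 'd scaled_energy w h.
Proof.
apply: is_derive_unique (is_derive_along h (functional_differentiable w)) _.
exact: is_deriveZf (is_derive_along h (scaled_energy_differentiable w)).
Qed.

Lemma functionalZ w0 s : scaled_energy w0 = 2 / p * mass w0 -> 0 < s ->
  functional (s *: w0) = s `^ p * (mass w0 * p^-1 * (2 / p - ln (s ^+ 2))).
Proof. by move=> w0N s0; rewrite /functional scaled_energyZ // w0N; ring. Qed.

(** With [y = s ^ p] the energy on the ray is [y (1 - ln y)] times its value at [w0], and
    [1 - ln y <= 1 / y]. *)
Lemma functional_ray_le w0 s : 0 < mass w0 -> scaled_energy w0 = 2 / p * mass w0 -> 0 <= s ->
  functional (s *: w0) <= functional w0.
Proof.
move=> m0' w0N; rewrite le_eqVlt => /orP[/eqP <-|s0].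
  rewrite scale0r /functional scaled_energy_0 mulr0 w0N.
  by rewrite !mulr_ge0 ?invr_ge0 ?(ltW m0') ?(ltW p0).
rewrite (functionalZ w0N s0) /functional w0N.
pose y := s `^ p; have y0 : 0 < y by exact: powR_gt0.
have ly : ln (s ^+ 2) = 2 / p * ln y.
  by rewrite /y ln_powR lnXn ?posrE // mulr2n; field; rewrite gt_eqF.
have := ln_le_sub1 (_ : 0 < y^-1); rewrite invr_gt0 lnV ?posrE // => /(_ y0) h.
rewrite -/y ly (_ : y * _ = (mass w0 * p^-1 * (2 / p)) * (y * (1 - ln y))); last by ring.
rewrite (_ : p^-1 * _ = (mass w0 * p^-1 * (2 / p)) * 1); last by ring.
rewrite ler_wpM2l //; first by rewrite !mulr_ge0 ?invr_ge0 ?(ltW m0') ?(ltW p0).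
have : y * (1 - ln y) <= y * y^-1 by rewrite ler_wpM2l ?(ltW y0) //; lra.
by rewrite mulfV // gt_eqF.
Qed.

Lemma nehari_scaled z : nehari functional z -> z != 0 /\ scaled_energy z = 2 / p * mass z.
Proof.
move=> [z0 _]; rewrite diff_functional diff_scaled_energy_self mulKf ?gt_eqF // => /eqP.
by rewrite subr_eq0 => /eqP.
Qed.

Lemma within_continuous_eps (M : normedModType R) (f : R -> M) (s e : R) :
  {within `[0, 1], continuous f} -> s \in `[0, 1] -> 0 < e ->
  exists2 d : R, 0 < d & forall t : R, t \in `[0, 1] -> `|t - s| < d -> `|f t - f s| < e.
Proof.
move=> /subspace_continuousP fc s01 e0; have /fc/cvgrPdist_lt/(_ _ e0) : `[0, 1]%classic s by [].
move=> /nbhs_normP[d /= d0 dP]; exists d => // t t01 ts; rewrite distrC; apply: dP => //=.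
by rewrite distrC.
Qed.

(* Take the last parameter at which [0 <= A - (2 / p) B]: it is not a zero of the path,
   because this inequality also holds near 0. *)
Lemma path_crosses_nehari (e : H) (gamma : R -> H) : scaled_energy e - 2 / p * mass e < 0 ->
  paths e gamma -> exists2 t, t \in `[0, 1] &
    gamma t != 0 /\ scaled_energy (gamma t) = 2 / p * mass (gamma t).
Proof.
move=> eN [gc g0 g1]; pose Q w := scaled_energy w - 2 / p * mass w.
have Qc : continuous Q.
  move=> w; apply: differentiable_continuous; apply: differentiableB.
    exact: scaled_energy_differentiable.
  exact: differentiableZ (mass_differentiable w).
have qc : {within `[0, 1], continuous (Q \o gamma)}.
  have /subspace_continuousP gc' := gc; apply/subspace_continuousP => x x01.
  exact: cvg_comp (gc' x x01) (Qc (gamma x)).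
pose Z : set R := [set t | t \in `[0, 1] /\ 0 <= Q (gamma t)].
have Z0 : Z 0.
  split; first by rewrite in_itv /= lexx ler01.
  by rewrite g0 /Q scaled_energy_0 mass_0 mulr0 subrr.
have Zs : has_sup Z by split; [exists 0|exists 1 => t []; rewrite in_itv /= => /andP[]].
pose s := sup Z.
have s_ub t : Z t -> t <= s by move=> Zt; apply: ub_le_sup => //; case: Zs.
have s01 : s \in `[0, 1].
  rewrite in_itv /= s_ub //=; apply: ge_sup; first by case: Zs.
  by move=> t []; rewrite in_itv /= => /andP[].
(* The supremum is attained: if [Q] were negative at [s], it would be negative at nearby elements of
   [Z]. *)
have qs_ge0 : 0 <= Q (gamma s).
  rewrite leNgt; apply/negP => qs.
  have nq : 0 < - Q (gamma s) by rewrite oppr_gt0.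
  have [d d0 dP] := within_continuous_eps qc s01 nq.
  have [t Zt ts] := sup_adherent d0 Zs; have [t01 qt] := Zt.
  have := dP t t01; rewrite /= distrC ger0_norm ?subr_ge0 ?s_ub // => /(_ _).
  rewrite ltrBlDr -ltrBlDl ts => /(_ isT); rewrite ltNge => /negP; apply.
  by apply: le_trans (ler_norm _); lra.
have s_lt1 : s < 1.
  rewrite lt_neqAle; move: s01; rewrite in_itv /= => /andP[_ ->]; rewrite andbT.
  by apply/eqP => s1; move: qs_ge0; rewrite s1 g1 leNgt eN.
have after (d : R) : 0 < d -> exists t, [/\ t \in `[0, 1], `|t - s| < d & Q (gamma t) < 0].
  move=> d0; pose t := s + Num.min (d / 2) (1 - s).
  have m0' : 0 < Num.min (d / 2) (1 - s) by rewrite lt_min subr_gt0 s_lt1 divr_gt0.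
  have t01 : t \in `[0, 1].
    move: s01; rewrite !in_itv /= => /andP[s0 _]; rewrite addr_ge0 ?(ltW m0') //=.
    by rewrite -lerBrDl ge_min lexx orbT.
  exists t; split => //.
    rewrite /t (addrC s) addrK gtr0_norm //; apply: (@le_lt_trans _ _ (d / 2)); last by lra.
    by rewrite ge_min lexx.
  rewrite ltNge; apply/negP => qt; have := s_ub t (conj t01 qt).
  by rewrite /t; lra.
exists s => //; split.
  apply/eqP => gs0; have [r r0 small] := scaled_energy_small.
  have [d d0 dP] := within_continuous_eps gc s01 r0.
  have [t [t01 td qt]] := after d d0.
  have := dP t t01 td; rewrite gs0 subr0 => /ltW/small.
  by have := norm_part_ge0 (gamma t); move: qt; rewrite /Q; lra.
apply/eqP; rewrite -subr_eq0 eq_le -/(Q (gamma s)) qs_ge0 andbT leNgt; apply/negP => qs.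
have [d d0 dP] := within_continuous_eps qc s01 qs.
have [t [t01 td qt]] := after d d0.
have := dP t t01 td; rewrite /= distrC => /(le_lt_trans (ler_norm _)); lra.
Qed.

Theorem ground_state_exists (x0 : V) : exists w0,
  mountain_pass_solution functional w0 /\ ground_state_solution functional w0.
Proof.
have [w0 [m0' w0N wmin]] := nehari_minimizer (exists_mass_one x0).
have crit := nehari_minimizer_critical m0' w0N wmin.
have w0_neq0 : w0 != 0 by apply/eqP => E; move: m0'; rewrite E mass_0 ltxx.
(* On the Nehari manifold both the energy and the minimised quotient increase with the mass. *)
have least z : z != 0 -> scaled_energy z = 2 / p * mass z -> functional w0 <= functional z.
  move=> z0 zN; have mz := nehari_mass_gt0 z0 zN.
  rewrite /functional w0N zN !ler_wpM2l ?divr_ge0 ?invr_ge0 ?(ltW p0) //.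
  have := wmin z mz; rewrite zN mulfK ?gt_eqF // lerD2l.
  by rewrite ler_pM2l ?divr_gt0 // ler_ln ?posrE.
have w0_nehari : nehari functional w0.
  split => //; first exact: functional_differentiable.
  by rewrite diff_functional crit mulr0.
exists w0; split; last first.
  split => //; apply/eqP; rewrite eq_le; apply/andP; split.
    apply/ereal_infP => _ [z /nehari_scaled[z0 zN] <-]; rewrite lee_fin; exact: least.
  by apply: ge_ereal_inf; exists (functional w0)%:E => //; exists w0.
split.
  split; first exact: functional_differentiable.
  by move=> h; rewrite diff_functional crit mulr0.
have [r r0 small] := scaled_energy_small.
have nw0 : 0 < `|w0| by rewrite normr_gt0.
(* The first summand gives [ln (T ^ 2) >= 2 >= 2 / p], so that the energy at [T *: w0] is at most 0;
   the second puts this point outside the ball of radius [r]. *)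
pose T := expR 1 + 2 * r / `|w0|.
have rw0 : 0 < 2 * r / `|w0| by rewrite divr_gt0 // mulr_gt0.
have T0 : 0 < T by rewrite addr_gt0 // expR_gt0.
have lT : 2 <= ln (T ^+ 2).
  have l1 : 1 <= ln T by rewrite -[leLHS](expRK 1) ler_ln ?posrE ?expR_gt0 // /T lerDl ltW.
  by rewrite lnXn ?posrE //; move: (ln T) l1 => l; lra.
have tp : 2 / p <= 2 by rewrite ler_pdivrMr //; move: p4; lra.
have eN : scaled_energy (T *: w0) - 2 / p * mass (T *: w0) < 0.
  rewrite scaled_energyZ // massZ // w0N.
  rewrite (_ : _ - _ = - (T `^ p * mass w0 * ln (T ^+ 2))); last by ring.
  by rewrite oppr_lt0 !mulr_gt0 ?powR_gt0 //; lra.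
exists (T *: w0), r; split; last first.
  apply/eqP; rewrite eq_le; apply/andP; split.
    apply/ereal_infP => _ [gamma /(path_crosses_nehari eN)[t t01 [g0 gN]] <-].
    apply: (@le_trans _ _ (functional (gamma t))%:E); first by rewrite lee_fin least.
    by apply: ereal_sup_ubound; exists t.
  apply: ge_ereal_inf; exists (ereal_sup [set (functional (t *: (T *: w0)))%:E | t in `[0, 1]]).
    exists (fun t => t *: (T *: w0)) => //; split; rewrite ?scale0r ?scale1r //.
    by apply: continuous_subspaceT => t; apply: cvgZr_tmp; exact: cvg_id.
  apply: ge_ereal_sup => _ [t t01 <-]; rewrite lee_fin scalerA.
  apply: functional_ray_le => //; rewrite mulr_ge0 ?(ltW T0) //.
  by move: t01; rewrite /= in_itv /= => /andP[].
have f0 : functional 0 = 0 by rewrite /functional scaled_energy_0 mulr0.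
split => //.
- rewrite normrZ gtr0_norm // -ltr_pdivrMr //; apply: (@lt_le_trans _ _ (2 * r / `|w0|)).
    by rewrite -mulrA mulr_natl mulr2n ltrDl divr_gt0.
  by rewrite /T lerDr expR_ge0.
(* On the sphere the smallness estimate leaves at least [norm_part w / p], which [norm_part_ge]
   bounds below by this constant. *)
- apply: (@lt_le_trans _ _ (p^-1 * (r / 2) `^ p)%:E).
    by rewrite f0 lte_fin mulr_gt0 ?invr_gt0 // powR_gt0 // divr_gt0.
  apply/ereal_infP => _ [w /= wr <-]; rewrite lee_fin /functional ler_wpM2l ?invr_ge0 ?(ltW p0) //.
  rewrite -wr; apply: (le_trans (norm_part_ge w)).
  have := small w; rewrite wr lexx => /(_ isT).
  have : 0 <= 2 / p * mass w by rewrite mulr_ge0 ?mass_ge0 // divr_ge0 // ltW.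
  by lra.
rewrite f0 (functionalZ w0N T0) pmulr_rle0 ?powR_gt0 // pmulr_rle0 ?mulr_gt0 ?invr_gt0 //.
by lra.
Qed.

Let fzero (wt : V -> R) : finite_energy G p wt 0.
Proof. by rewrite /finite_energy modular_cst0 ?ltry. Qed.

Let indicator_Cc x : Cc (indicator x : V -> R).
Proof.
apply: (@sub_finite_set _ _ [set x]); last exact: finite_set1.
by move=> y; have [->|yx] := eqVneq y x; rewrite /= /indicator ?(negbTE yx) ?eqxx.
Qed.

Let local_has_sum (wt wt' : V -> R) (U U' : H -> V -> R) w :
  (forall x, c x <= wt x) -> (forall x, c x <= wt' x) ->
  energy_map G p wt U -> energy_map G p wt' U' ->
  has_sum (local_energy G p wt (U w) (U' w)) (total G p wt (U w) -
    (coupling G p (@sqln R) (U w) (U' w) + coupling G p (@sqln R) (U' w) (U w))).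
Proof.
move=> cwt cwt' UE UE'.
have wt0 x : 0 <= wt x by apply: le_trans (cwt x); apply: le_trans (c_ge x); exact: ltW.
have UK := energy_map_Lp c0_gt0 c_ge cwt UE w; have U'K := energy_map_Lp c0_gt0 c_ge cwt' UE' w.
have [_ _ Uf _] := UE.
have cs u v uK vK := coupling_has_sum p4 c0_gt0 c_ge m0_gt0 mu_ge inv_has_sum
  (@locally_lipschitz_sqln R) (K := `|w| `^ p) (u := u) (v := v) uK vK.
apply: eq_has_sum (has_sumB (total_has_sum wt0 (Uf w)) (has_sumD (cs _ _ UK U'K) (cs _ _ U'K UK))) => x.
by rewrite /local_energy; ring.
Qed.

Lemma critical_equations w : (forall h, 'd functional w h = 0) -> forall x,
  equation G p a (U1 w) (U2 w) x /\ equation G p b (U2 w) (U1 w) x.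
Proof.
move=> crit x; have [U1D U1Z _ _] := U1E; have [U2D U2Z _ _] := U2E.
have critA h : 'd scaled_energy w h = 0.
  by apply/eqP; have /eqP := crit h; rewrite diff_functional mulf_eq0 invr_eq0 gt_eqF.
have fa := Cc_finite_energy G p1 a_ge0 (indicator_Cc x).
have fb := Cc_finite_energy G p1 b_ge0 (indicator_Cc x).
have dA h (k : R) : is_derive (0 : R) 1 (fun s : R => scaled_energy (w + s *: h) + k) 0.
  have h1 := is_derive_along h (scaled_energy_differentiable w); rewrite critA in h1.
  by have := is_deriveDf h1 (is_derive_cst k (0 : R) (1 : R)); rewrite addr0.
split.
  have [e [e1 e2]] := surjective_pair fa (fzero b).
  have E1 s : U1 (w + s *: e) = U1 w + s *: indicator x by rewrite U1D U1Z e1.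
  have E2 s : U2 (w + s *: e) = U2 w by rewrite U2D U2Z e2 scaler0 addr0.
  (* The constant removes the norm of the fixed component, absent from [local_energy]. *)
  apply: (equation_of_critical p4 _ (dA e (- total G p b (U2 w)))) => s.
  have := local_has_sum (w + s *: e) c_a c_b U1E U2E.
  rewrite E1 E2; congr (has_sum _ _).
  by rewrite /scaled_energy /norm_part /log_part E1 E2; ring.
have [e [e1 e2]] := surjective_pair (fzero a) fb.
have E1 s : U1 (w + s *: e) = U1 w by rewrite U1D U1Z e1 scaler0 addr0.
have E2 s : U2 (w + s *: e) = U2 w + s *: indicator x by rewrite U2D U2Z e2.
apply: (equation_of_critical p4 _ (dA e (- total G p a (U1 w)))) => s.
have := local_has_sum (w + s *: e) c_b c_a U2E U1E.
rewrite E1 E2; congr (has_sum _ _).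
by rewrite /scaled_energy /norm_part /log_part E1 E2; ring.
Qed.

End Functional.

(** * Summability of the inverse potentials and instantiation on the product space *)

Section Assembly.
Context {R : realType} {V : choiceType} (G : weighted_graph R V).
Implicit Types (u v a b : V -> R) (x : V).

(** On the sublevel set [1 / a <= 1 / V0] and the volume is finite; off it the summability is
    assumed. *)
Lemma inverse_has_sum a (V0 M0 : R) : 0 < V0 -> (forall x, V0 <= a x) ->
  L1 G (~` sublevel a M0) (fun x => (a x)^-1) -> (volume G (sublevel a M0) < +oo)%E ->
  exists s, has_sum (fun x => (a x)^-1 * mu G x) s.
Proof.
move=> V00 aV ai av; set D := sublevel a M0.
have a0 x : 0 < a x := lt_le_trans V00 (aV x).
have m0 x := mu_gt0 G x.
pose f1 x := if x \in D then mu G x else 0.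
pose f2 x := if x \in ~` D then (a x)^-1 * mu G x else 0.
have f1_ge0 x : 0 <= f1 x by rewrite /f1; case: ifP => // _; exact: ltW.
have f2_ge0 x : 0 <= f2 x.
  by rewrite /f2; case: ifP => // _; rewrite mulr_ge0 ?invr_ge0 // ltW.
have h1 : has_sum f1 (fine (\esum_(x in [set: V]) (f1 x)%:E)).
  apply: has_sum_esum => //; apply: le_lt_trans av; rewrite /volume [leRHS]esum_mkcond.
  by apply: le_esum => x _; rewrite /f1; case: ifP.
have h2 : has_sum f2 (fine (\esum_(x in [set: V]) (f2 x)%:E)).
  apply: has_sum_esum => //; apply: le_lt_trans ai; rewrite [leRHS]esum_mkcond.
  apply: le_esum => x _; rewrite /f2; case: ifP => // _.
  by rewrite lee_fin ler_norm.
apply: dominated_has_sum (has_sumD (has_sumZ V0^-1 h1) h2) => x.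
rewrite ger0_norm ?mulr_ge0 ?invr_ge0 ?(ltW (a0 x)) ?(ltW (m0 x)) //.
rewrite /f1 /f2 in_setC; case: ifP => _ /=; last by rewrite mulr0 add0r.
by rewrite addr0 ler_wpM2r ?(ltW (m0 x)) // lef_pV2 ?posrE.
Qed.

Section Space.
Variables (p : R) (p4 : 4 < p) (p1 : 1 <= p) (w : V -> R) (w_gt0 : forall x, 0 < w x).
Local Notation W := (weighted_space G p1 w_gt0).

Let w_ge0 x : 0 <= w x. Proof. exact: ltW. Qed.

Lemma weighted_finite_energy (f : W) : finite_energy G p w f.
Proof. by rewrite /finite_energy -(enorm_lty _ p1) //; exact: weighted_enorm_lty. Qed.

Lemma weighted_funZ k (f : W) : weighted_fun (k *: f) = k *: (f : V -> R).
Proof. reflexivity. Qed.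

Lemma weighted_funD (f g : W) : weighted_fun (f + g) = (f : V -> R) + g.
Proof. reflexivity. Qed.

Lemma weighted_norm_total (f : W) : `|f| = total G p w f `^ p^-1.
Proof.
rewrite [LHS]/(fine (enorm G p w f)) enormE //; exact: weighted_finite_energy.
Qed.

Lemma weighted_norm_powR (f : W) : `|f| `^ p = total G p w f.
Proof.
rewrite weighted_norm_total -powRrM mulVf ?powRr1 ?total_ge0 //.
by rewrite gt_eqF // (lt_le_trans ltr01).
Qed.

End Space.
End Assembly.

Theorem theorem1p3 (R : realType) (V : choiceType) (G : weighted_graph R V)
    (a b : V -> R)
    (G_connected : connected_graph G)
    (mu_bounded : exists2 mu_min : R, 0 < mu_min & forall x, mu_min <= mu G x)
    (A1 : bounded_below_potentials a b)
    (A2' : integrable_inverse_potentials G a b)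
    (p : R) (p_gt4 : 4 < p) :
  exists w0 : energy_space G p_gt4 A1,
    [/\ solves_system G p a b w0.1 w0.2,
        mountain_pass_solution (energy G p_gt4 A1) w0
      & ground_state_solution (energy G p_gt4 A1) w0].
Proof.
have [[x0] _] := G_connected; have [m0 m0_gt0 mu_ge] := mu_bounded.
have [V0 V0_gt0 V0_le] := A1; have [M0 _ [ai bi av bv]] := A2'.
have [Sa aS] := inverse_has_sum V0_gt0 (fun x => proj1 (V0_le x)) ai av.
have [Sb bS] := inverse_has_sum V0_gt0 (fun x => proj2 (V0_le x)) bi bv.
have p_gt1 : 1 < p by lra.
have a0 := potential_gt0_l A1; have b0 := potential_gt0_r A1.
(* A common minorant of the potentials whose inverse is still summable, since
   [1 / c <= 1 / a + 1 / b]. *)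
pose c x := Num.min (a x) (b x).
have c_ge x : V0 <= c x by have [h1 h2] := V0_le x; rewrite le_min h1.
have c_a x : c x <= a x by rewrite ge_min lexx.
have c_b x : c x <= b x by rewrite ge_min lexx orbT.
have [S cS] : exists s, has_sum (fun x => (c x)^-1 * mu G x) s.
  apply: dominated_has_sum (has_sumD aS bS) => x.
  have m0x := mu_gt0 G x; have ia : 0 < (a x)^-1 by rewrite invr_gt0.
  have ib : 0 < (b x)^-1 by rewrite invr_gt0.
  rewrite -mulrDl normrM (gtr0_norm m0x) ler_wpM2r ?(ltW m0x) //.
  have ic : 0 < (c x)^-1 by rewrite invr_gt0 (lt_le_trans V0_gt0).
  rewrite (gtr0_norm ic) /c; case: (leP (a x) (b x)) => _; first by rewrite lerDl ltW.
  by rewrite lerDr ltW.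
pose H := energy_space G p_gt4 A1.
pose U1 (w : H) : V -> R := w.1; pose U2 (w : H) : V -> R := w.2.
have nE (w : H) : `|w| = `|w.1| + `|w.2| by [].
have U1E : energy_map G p a U1.
  split.
  - by move=> w h; exact: weighted_funD.
  - by move=> k w; exact: weighted_funZ.
  - move=> w; exact: weighted_finite_energy.
  move=> w.
  rewrite -weighted_norm_powR ge0_ler_powR ?nnegrE //; first by lra.
  by rewrite nE lerDl.
have U2E : energy_map G p b U2.
  split.
  - by move=> w h; exact: weighted_funD.
  - by move=> k w; exact: weighted_funZ.
  - move=> w; exact: weighted_finite_energy.
  move=> w.
  rewrite -weighted_norm_powR ge0_ler_powR ?nnegrE //; first by lra.
  by rewrite nE lerDr.
have normE (w : H) : `|w| = total G p a (U1 w) `^ p^-1 + total G p b (U2 w) `^ p^-1.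
  by rewrite nE !weighted_norm_total.
have surj u v : finite_energy G p a u -> finite_energy G p b v ->
    exists w : H, U1 w = u /\ U2 w = v.
  move=> uf vf.
  have uW : u \in weighted_pred G (exponent_ge1 p_gt4) (potential_gt0_l A1).
    by rewrite (finite_energy_weighted p_gt1 m0_gt0 mu_ge _ _ _ V0_gt0 (fun x => proj1 (V0_le x))); apply/asboolP.
  have vW : v \in weighted_pred G (exponent_ge1 p_gt4) (potential_gt0_r A1).
    by rewrite (finite_energy_weighted p_gt1 m0_gt0 mu_ge _ _ _ V0_gt0 (fun x => proj2 (V0_le x))); apply/asboolP.
  by exists ((WeightedSpace uW, WeightedSpace vW) : H).
have EE : energy G p_gt4 A1 = functional G p a b U1 U2.
  apply/funext => w; rewrite /energy /functional /scaled_energy /norm_part /log_part.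
  have L u v : log_term G p u v = coupling G p (@sqln R) u v by [].
  by rewrite !weighted_norm_powR !L; ring.
have [w0 [mp gs]] := ground_state_exists p_gt4 V0_gt0 c_ge c_a c_b m0_gt0 mu_ge cS U1E U2E normE surj x0.
exists w0; rewrite EE; split => //.
have [[_ crit] _] := mp.
exact: (critical_equations p_gt4 V0_gt0 c_ge c_a c_b m0_gt0 mu_ge cS U1E U2E surj crit).
Qed.
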